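(* Let $\{x_j\}_{j\in\mathbb{Z}}\subset\mathbb{R}$ be a complete interpolating sequence and let $\{\phi_\alpha\}_{\alpha\in\Lambda}$ be a regular family of interpolators. If $f\in PW_\pi$, then $$\lim_{\alpha\to\infty}\left\| f - I_{\alpha} f\right\|_{L^2(\mathbb{R})}=0,$$ where the limit is taken along $\alpha\in\Lambda$.
   Context: Fourier transform: $\hat g(\xi)=(2\pi)^{-1/2}\int_{\mathbb{R}}g(x)e^{-ix\xi}\,dx$ for $g\in L^1(\mathbb{R})$, extended in the usual way (in particular to $L^2(\mathbb{R})$). $PW_\pi=\{f\in L^2(\mathbb{R}):\operatorname{supp}(\hat f)\subset[-\pi,\pi]\}$; each $f\in PW_\pi$ is identified with its continuous representative, so $f(x_j)$ makes sense. A sequence $\{x_j\}_{j\in\mathbb{Z}}\subset\mathbb{R}$ is a complete interpolating sequence (CIS) if $\{e^{-ix_j\xi}\}_{j\in\mathbb{Z}}$ is a Riesz basis for $L^2([-\pi,\pi])$, i.e. its linear span is dense in $L^2([-\pi,\pi])$ and there is $C>0$ with $C^{-1}\|\{a_j\}\|_{l^2(\mathbb{Z})}\le\|\sum_j a_je^{-ix_j\xi}\|_{L^2([-\pi,\pi])}\le C\|\{a_j\}\|_{l^2(\mathbb{Z})}$ for all $\{a_j\}\in l^2(\mathbb{Z})$. Conditions (A1)-(A3) on a real-valued function $\phi$ on $\mathbb{R}$: (A1) $\phi,\hat\phi\in L^1(\mathbb{R})$ ($\phi$ is identified with its continuous representative); (A2) $\hat\phi(\xi)\ge 0$ for all $\xi\in\mathbb{R}$,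 and there is $\delta>0$ with $\hat\phi(\xi)\ge\delta$ on $[-\pi,\pi]$; (A3) with $M_j=\sup_{|\xi|\le\pi}\hat\phi(\xi+2\pi j)$, $\{M_j\}\in l^1(\mathbb{Z})$. Let $\Lambda\subset(0,\infty)$ be an unbounded set (discrete or continuous). A family $\{\phi_\alpha\}_{\alpha\in\Lambda}$ of real-valued functions is a regular family of interpolators if: (H1) each $\phi_\alpha$ satisfies (A1)-(A3); (H2) there is $C$ independent of $\alpha$ with $\sum_{j\ne0}M_j(\alpha)\le C m_\alpha$ for all $\alpha\in\Lambda$, where $M_j(\alpha)=\sup_{|\xi|\le\pi}\hat\phi_\alpha(\xi+2\pi j)$ and $m_\alpha=\inf_{|\xi|\le\pi}\hat\phi_\alpha(\xi)$; (H3) for almost every $|\xi|\le\pi$, $\lim_{\alpha\to\infty} m_\alpha/\hat\phi_\alpha(\xi)=0$. For $f\in PW_\pi$ and $\alpha\in\Lambda$, $I_\alpha f(x)=\sum_{j\in\mathbb{Z}}a_j\phi_\alpha(x-x_j)$, where $\{a_j\}\in l^2(\mathbb{Z})$ (depending on $\alpha$ and $f$) is the unique $l^2(\mathbb{Z})$ sequence such that $I_\alpha f(x_n)=f(x_n)$ for all $n\in\mathbb{Z}$ (such a sequence exists and is unique, and $I_\alpha f\in L^2(\mathbb{R})$). *)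

(* Defs.v *)
From HB Require Import structures.
From mathcomp Require Import all_boot all_order all_algebra.
From mathcomp Require Import all_classical all_reals all_analysis.
From mathcomp Require Import complex.

Set Implicit Arguments.
Unset Strict Implicit.
Unset Printing Implicit Defensive.

Import Order.TTheory GRing.Theory Num.Theory.
Import numFieldNormedType.Exports.
Export ComplexField.Normc.

Local Open Scope classical_set_scope.
Local Open Scope ring_scope.
Local Open Scope complex_scope.

(* Complex-valued functions on the line have type R -> R[i].  The type R[i]    *)
(* carries no topological or measurable structure here, so continuity,         *)
(* measurability, integrals and limits are taken on real and imaginary parts.  *)
(* On R[i] the order is the partial one: 0 <= z says that z is real and        *)
(* nonnegative.                                                                *)
Section definitions.
Context {R : realType}.
Implicit Types (f g F : R -> R[i]) (D : set R) (phi : R -> R) (x : int -> R).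

Local Notation mu := (@lebesgue_measure R).

Definition ccontinuous f : Prop :=
  continuous (@complex.Re R \o f) /\ continuous (@complex.Im R \o f).

Definition cintegral D f : R[i] :=
  Rintegral mu D (@complex.Re R \o f) +i* Rintegral mu D (@complex.Im R \o f).

Definition L1 f : Prop :=
  mu.-integrable [set: R] (EFin \o (@complex.Re R \o f)) /\
  mu.-integrable [set: R] (EFin \o (@complex.Im R \o f)).

Definition L2norm D f : \bar R :=
  Lnorm mu 2%:E (fun t => (normc (f t) * \1_D t)%:E).

Definition L2 D f : Prop :=
  [/\ measurable_fun D (@complex.Re R \o f),
      measurable_fun D (@complex.Im R \o f) & (L2norm D f < +oo)%E].

Definition l2norm (a : int -> R[i]) : \bar R :=
  ((\esum_(j in [set: int]) (normc (a j) ^+ 2)%:E) `^ 2^-1)%E.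

Definition l2 (a : int -> R[i]) : Prop := (l2norm a < +oo)%E.

(* u (-n) + ... + u n *)
Definition zsum_upto (u : int -> R[i]) (n : nat) : R[i] :=
  \sum_(k < n.*2.+1) u (k%:Z - n%:Z).

Definition zsum (u : int -> R[i]) : R[i] :=
  lim ((fun n => complex.Re (zsum_upto u n)) @ \oo) +i*
  lim ((fun n => complex.Im (zsum_upto u n)) @ \oo).

Definition expi (t : R) : R[i] := cos t +i* sin t.

(* The integral formula, meaningful for g in L1. *)
Definition fourier g : R -> R[i] := fun xi =>
  ((Num.sqrt (2 * pi))^-1)%:C *
  cintegral [set: R] (fun t => g t * expi (- (t * xi))).

(* F is a version of the extension of the transform to f in L2, i.e. the limit *)
(* in L2 of the transforms of the truncations of f to [-n, n], which are in    *)
(* L1 and L2.                                                                  *)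
Definition is_fourierL2 f F : Prop :=
  L2 [set: R] F /\
  L2norm [set: R]
    (fun xi => fourier (fun t => f t * (\1_(`[- n%:R, n%:R]%classic) t)%:C) xi
               - F xi) @[n --> \oo] --> 0%E.

(* Elements of the Paley-Wiener space are taken as their continuous            *)
(* representatives.  The support of a class of functions modulo null sets is   *)
(* contained in a closed set iff the function vanishes a.e. off that set.      *)
Definition PW f : Prop :=
  [/\ ccontinuous f, L2 [set: R] f &
      exists2 F, is_fourierL2 f F &
        {ae mu, forall xi, ~ `|xi| <= pi -> F xi = 0}].

Definition band : set R := `[- pi, pi]%classic.

Definition exponential x (j : int) : R -> R[i] := fun xi => expi (- (x j * xi)).

(* The series of exponentials converges in L2 of the band, to S. *)
Definition exponential_series x (a : int -> R[i]) (S : R -> R[i]) : Prop :=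
  L2 band S /\
  L2norm band
    (fun xi => zsum_upto (fun j => a j * exponential x j xi) n - S xi)
    @[n --> \oo] --> 0%E.

(* Every finite linear combination of the exponentials is of the form          *)
(* zsum_upto (fun j => c j * exponential x j xi) n.                            *)
Definition complete_interpolating x : Prop :=
  (forall g, L2 band g -> forall e : R, 0 < e ->
     exists (c : int -> R[i]) (n : nat),
       (L2norm band
          (fun xi => g xi - zsum_upto (fun j => c j * exponential x j xi) n)%R
        < e%:E)%E) /\
  (exists2 C : R, 0 < C & forall a, l2 a ->
     exists2 S, exponential_series x a S &
       ((C^-1)%:E * l2norm a <= L2norm band S)%E /\
       (L2norm band S <= C%:E * l2norm a)%E).

Definition cfun phi : R -> R[i] := fun t => (phi t)%:C.

(* For the functions considered below the transform is real-valued, hence     *)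
(* equal to its real part.                                                     *)
Definition rfourier phi : R -> R := fun xi => complex.Re (fourier (cfun phi) xi).

Definition M_ phi (j : int) : R :=
  sup [set rfourier phi (xi + 2 * pi * j%:~R) | xi in band].

Definition m_ phi : R := inf [set rfourier phi xi | xi in band].

(* The standing conditions on a single function; a real-valued function with   *)
(* integrable transform is taken as its continuous representative.             *)
Definition A1 phi : Prop :=
  [/\ continuous phi, L1 (cfun phi) & L1 (fourier (cfun phi))].

Definition A2 phi : Prop :=
  (forall xi, 0 <= fourier (cfun phi) xi) /\
  (exists2 delta : R, 0 < delta &
     forall xi, band xi -> delta%:C <= fourier (cfun phi) xi).

Definition A3 phi : Prop :=
  (\esum_(j in [set: int]) `|M_ phi j|%:E < +oo)%E.

Definition regular_family (Lambda : set R) (phi : R -> R -> R) : Prop :=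
  [/\ forall alpha, Lambda alpha ->
        [/\ A1 (phi alpha), A2 (phi alpha) & A3 (phi alpha)],
      exists C : R, forall alpha, Lambda alpha ->
        (\esum_(j in [set j : int | (j != 0)%R]) (M_ (phi alpha) j)%:E
           <= (C * m_ (phi alpha))%:E)%E &
      {ae mu, forall xi, `|xi| <= pi ->
        m_ (phi alpha) / rfourier (phi alpha) xi
          @[alpha --> within Lambda +oo] --> 0}].

Definition shifts phi x (a : int -> R[i]) : R -> R[i] :=
  fun t => zsum (fun j => a j * cfun phi (t - x j)).

Definition interpolates phi x f (a : int -> R[i]) : Prop :=
  l2 a /\ forall n, shifts phi x a (x n) = f (x n).

(* The coefficients are selected by definite description; the default value 0  *)
(* would only be used if no l2 sequence interpolated f.                        *)
Definition interpolant phi x f : R -> R[i] :=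
  shifts phi x (xget (cst 0) [set a | interpolates phi x f a]).

End definitions.

(* Main.v *)
(** Everything is read on the Fourier side.  Write F for the transform of f, and
    S_N for the sum of the a_j e^(-i x_j xi) over |j| <= N, a function on the whole
    line.  The N-th partial sum of I_alpha f is the inverse transform of phihat S_N,
    so f is interpolated at the nodes iff, for every finite combination g of the
    exponentials, <S_N, g> in L^2(phihat dxi) tends to <F, g> in L^2[-pi, pi].
    - Taking g = S_N, AM-GM gives m^2 |S_N|^2 <= \int |F|^2 m / phihat + o(1), norm
      and integral being over [-pi, pi]; by (H3) and dominated convergence, the
      right-hand side is small.
    - Off the band, phihat <= C m by (H2), and the Riesz bounds, translated by
      2 pi k, control S_N; on the band, F - phihat S_N is tested against the
      exponentials, which are dense.  Hence F - phihat S_N = O(m |S_N|) in L^2.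
    - The coefficients exist because the equations they solve are the Euler
      equations of a coercive quadratic functional on trigonometric sums.
    Working with finite sums only avoids gluing the L^2 limits of the exponential
    series on the translates of the band.  The inversion formulas for phi and f, and
    the bound of the L^2 norm of a function by that of its transform, are obtained
    from the Poisson kernel, the transform of e^(-e |xi|). *)
Require Import Defs.
From mathcomp Require Import all_boot all_order all_algebra.
From mathcomp Require Import all_classical all_reals all_analysis.
From mathcomp Require Import measurable_realfun complex ring lra zify.
Set Implicit Arguments.
Unset Strict Implicit.
Unset Printing Implicit Defensive.
Import Order.TTheory GRing.Theory Num.Theory.
Import numFieldNormedType.Exports.
Local Open Scope classical_set_scope.
Local Open Scope ring_scope.
Local Open Scope complex_scope.

(** * Weighted inner products *)

Section dotc.
Context {R : realType}.
Implicit Types (z w v : R[i]) (t : R).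

(** The obstacle is aliasing: the transform of f lives on the band, while phihat does not vanish
    outside it. (H2) only makes its outer part O(m), with m the infimum of phihat on the band, so
    all rests on m |S_N| being small. Without aliasing, S would be F / phihat, and m^2 |F /
    phihat|^2 <= |F|^2 m / phihat because m <= phihat on the band; AM-GM recovers this bound when
    aliasing is present. The order of limits matters. At fixed alpha, N tends to infinity first and
    the o(1) terms, whose rates depend on alpha, disappear. The constants that survive are the Riesz
    constant and that of (H2), both free of alpha; alpha tends to infinity last. The weight phihat
    is natural because the waves at s and t have in L^2(phihat) an inner product proportional to
    phi(t - s). The Poisson kernel serves twice: its decay like t^-2 makes its pairing with a
    function that is merely L^2 absolutely convergent, and its positivity and fixed mass make it fit
    for Schur's test. *)

Lemma cReD z w : complex.Re (z + w) = complex.Re z + complex.Re w.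
Proof. by case: z w => ? ? []. Qed.
Lemma cImD z w : complex.Im (z + w) = complex.Im z + complex.Im w.
Proof. by case: z w => ? ? []. Qed.
Lemma cReN z : complex.Re (- z) = - complex.Re z. Proof. by case: z. Qed.
Lemma cImN z : complex.Im (- z) = - complex.Im z. Proof. by case: z. Qed.
Lemma cReM z w : complex.Re (z * w) =
  complex.Re z * complex.Re w - complex.Im z * complex.Im w.
Proof. by case: z w => ? ? []. Qed.
Lemma cImM z w : complex.Im (z * w) =
  complex.Re z * complex.Im w + complex.Im z * complex.Re w.
Proof. by case: z w => ? ? []. Qed.
Lemma cRe0 : complex.Re (0 : R[i]) = 0. Proof. by []. Qed.
Lemma cIm0 : complex.Im (0 : R[i]) = 0. Proof. by []. Qed.

Definition cReE := (cReD, cImD, cReN, cImN, cReM, cImM, cRe0, cIm0).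

Lemma eqc z w : complex.Re z = complex.Re w -> complex.Im z = complex.Im w ->
  z = w.
Proof. by case: z w => ? ? [? ?] /= -> ->. Qed.

(* Complex quantities are paired with all [w], which determines them (dotc_ext)
   and keeps every integral real. *)
Definition dotc z w := complex.Re z * complex.Re w + complex.Im z * complex.Im w.

Lemma dotcC z w : dotc z w = dotc w z. Proof. by rewrite /dotc; ring. Qed.
Lemma dotcDl z w v : dotc (z + w) v = dotc z v + dotc w v.
Proof. by rewrite /dotc !cReE; ring. Qed.
Lemma dotcDr z w v : dotc v (z + w) = dotc v z + dotc v w.
Proof. by rewrite /dotc !cReE; ring. Qed.
Lemma dotcNl z w : dotc (- z) w = - dotc z w.
Proof. by rewrite /dotc !cReE; ring. Qed.
Lemma dotcNr z w : dotc z (- w) = - dotc z w.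
Proof. by rewrite /dotc !cReE; ring. Qed.
Lemma dotcBl z w v : dotc (z - w) v = dotc z v - dotc w v.
Proof. by rewrite dotcDl dotcNl. Qed.
Lemma dotcBr z w v : dotc v (z - w) = dotc v z - dotc v w.
Proof. by rewrite dotcDr dotcNr. Qed.
Lemma dotcZl t z w : dotc (t%:C * z) w = t * dotc z w.
Proof. by rewrite /dotc !cReE /=; ring. Qed.
Lemma dotcZr t z w : dotc w (t%:C * z) = t * dotc w z.
Proof. by rewrite /dotc !cReE /=; ring. Qed.
Lemma dotc0l z : dotc 0 z = 0. Proof. by rewrite /dotc /=; ring. Qed.
Lemma dotcMl z w v : dotc (z * w) v = dotc w (conjc z * v).
Proof. by case: z w v => ? ? [? ?] [? ?]; rewrite /dotc /=; ring. Qed.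
Lemma dotcc_ge0 z : 0 <= dotc z z.
Proof. by rewrite /dotc -!expr2 addr_ge0 ?sqr_ge0. Qed.
Lemma normc_sqr z : normc z ^+ 2 = dotc z z.
Proof.
by case: z => a b; rewrite /dotc /= sqr_sqrtr ?addr_ge0 ?sqr_ge0// !expr2.
Qed.
Lemma dotcM z w : dotc (z * w) (z * w) = dotc z z * dotc w w.
Proof. by rewrite /dotc !cReE; ring. Qed.
Lemma dotc_le z w : `|dotc z w| <= (dotc z z + dotc w w) / 2.
Proof.
have h1 := dotcc_ge0 (z - w); have h2 := dotcc_ge0 (z + w).
move: h1 h2; rewrite !(dotcBl, dotcBr, dotcDl, dotcDr) (dotcC w z) => h1 h2.
by rewrite ler_norml; apply/andP; split; lra.
Qed.
Lemma dotcD_le z w : dotc (z + w) (z + w) <= 2 * dotc z z + 2 * dotc w w.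
Proof.
have h1 := dotcc_ge0 (z - w).
move: h1; rewrite !(dotcBl, dotcBr, dotcDl, dotcDr) (dotcC w z) => h1; lra.
Qed.
Lemma dotc_ext z w : (forall v, dotc z v = dotc w v) -> z = w.
Proof.
move=> h; have := h (1 +i* 0); have := h (0 +i* 1).
by rewrite /dotc /= !(mulr0, mulr1, addr0, add0r) => h1 h2; apply: eqc.
Qed.
Lemma dotc_expi t : dotc (expi t) (expi t) = 1.
Proof. by rewrite /dotc /expi/= -!expr2 cos2Dsin2. Qed.
Lemma dotcMexpi z t : dotc (z * expi t) (z * expi t) = dotc z z.
Proof. by rewrite dotcM dotc_expi mulr1. Qed.
Lemma expiD (s t : R) : expi (s + t) = expi s * expi t.
Proof. by apply: eqc; rewrite !cReE /= ?cosD ?sinD; ring. Qed.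
End dotc.

Section ip.
Context {R : realType}.
Local Notation mu := (@lebesgue_measure R).
Implicit Types (w : R -> R) (f g h : R -> R[i]).

Definition integr (f : R -> R) := mu.-integrable [set: R] (EFin \o f).

Lemma integr_meas (f : R -> R) : integr f -> measurable_fun setT f.
Proof. by move=> /integrableP[/measurable_EFinP]. Qed.

Lemma integrD (f g : R -> R) : integr f -> integr g -> integr (fun t => f t + g t).
Proof. by move=> hf hg; exact: (integrableD measurableT hf hg). Qed.

Lemma integrN (f : R -> R) : integr f -> integr (fun t => - f t).
Proof. by move=> hf; exact: (integrableN hf). Qed.

Lemma integrB (f g : R -> R) : integr f -> integr g -> integr (fun t => f t - g t).
Proof. by move=> hf hg; apply: integrD => //; exact: integrN. Qed.

Lemma integrZ (k : R) (f : R -> R) : integr f -> integr (fun t => k * f t).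
Proof. by move=> hf; exact: (integrableZl measurableT k hf). Qed.

Lemma integr_le (f g : R -> R) : measurable_fun setT f ->
  (forall t, `|f t| <= g t) -> integr g -> integr f.
Proof.
move=> mf fg ig; apply: le_integrable ig => //.
  exact/measurable_EFinP.
by move=> t _ /=; rewrite lee_fin (le_trans (fg t)) ?ler_norm.
Qed.

Lemma eq_integr (f g : R -> R) : f =1 g -> integr f -> integr g.
Proof. by move=> /funext ->. Qed.

Lemma integral_EFin (f : R -> R) : integr f ->
  (\int[mu]_t (f t)%:E = (\int[mu]_t f t)%R%:E)%E.
Proof. by move=> hf; rewrite /Rintegral fineK //; exact: integrable_fin_num. Qed.

(** An infinite integral reads as 0 through [Rintegral], so a bound on that number proves nothing by
    itself. Bounds are established in the extended reals and converted here. *)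
Lemma ge0_integr (f : R -> R) (B : R) : measurable_fun setT f ->
  (forall t, 0 <= f t) -> (\int[mu]_t (f t)%:E <= B%:E)%E ->
  integr f /\ \int[mu]_t f t <= B.
Proof.
move=> mf f0 fB; have hf : integr f.
  apply/integrableP; split; first exact/measurable_EFinP.
  under eq_integral do rewrite /= ger0_norm//.
  exact: le_lt_trans fB (ltry _).
by split => //; rewrite -lee_fin -integral_EFin.
Qed.

Definition measc g := measurable_fun setT (@complex.Re R \o g) /\
  measurable_fun setT (@complex.Im R \o g).

Lemma measc_dot g h : measc g -> measc h ->
  measurable_fun setT (fun t => dotc (g t) (h t)).
Proof.
by move=> [? ?] [? ?]; apply: measurable_funD; exact: measurable_funM.
Qed.

Lemma meascD g h : measc g -> measc h -> measc (fun t => g t + h t).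
Proof.
move=> [g1 g2] [h1 h2]; split.
  rewrite (_ : _ \o _ = (@complex.Re R \o g) \+ (@complex.Re R \o h)).
    exact: measurable_funD.
  by apply/funext => t /=; rewrite cReD.
rewrite (_ : _ \o _ = (@complex.Im R \o g) \+ (@complex.Im R \o h)).
  exact: measurable_funD.
by apply/funext => t /=; rewrite cImD.
Qed.

Lemma meascM g h : measc g -> measc h -> measc (fun t => g t * h t).
Proof.
move=> [g1 g2] [h1 h2]; split.
  rewrite (_ : _ \o _ = fun t => complex.Re (g t) * complex.Re (h t)
     - complex.Im (g t) * complex.Im (h t)).
    by apply: measurable_funB; exact: measurable_funM.
  by apply/funext => t /=; rewrite cReM.
rewrite (_ : _ \o _ = fun t => complex.Re (g t) * complex.Im (h t)
     + complex.Im (g t) * complex.Re (h t)).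
  by apply: measurable_funD; exact: measurable_funM.
by apply/funext => t /=; rewrite cImM.
Qed.

Lemma measc_cst (z : R[i]) : measc (fun=> z).
Proof. by split; exact: measurable_cst. Qed.

Lemma measc_real (r : R -> R) : measurable_fun setT r -> measc (fun t => (r t)%:C).
Proof. by move=> mr; split => //=; exact: measurable_cst. Qed.

Lemma meascN g : measc g -> measc (fun t => - g t).
Proof.
move=> mg; rewrite (_ : (fun t => _) = fun t => (-1) * g t).
  by apply: meascM => //; exact: measc_cst.
by apply/funext => t; rewrite mulN1r.
Qed.

(* The real inner product of L^2(w dx; R[i]). *)
Definition ip w g h := \int[mu]_t (w t * dotc (g t) (h t)).

(** Membership in L^2(w dx). Measurability is asked on the whole line, even where [w] vanishes, so
    that weights can be changed without tracking supports. *)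
Definition sq w g := measc g /\ integr (fun t => w t * dotc (g t) (g t)).

Definition weight w := measurable_fun setT w /\ forall t, 0 <= w t.

Lemma ip_integr w g h : weight w -> sq w g -> sq w h ->
  integr (fun t => w t * dotc (g t) (h t)).
Proof.
move=> [mw w0] [mg ig] [mh ih].
apply: (@integr_le _ (fun t => 2^-1 * (w t * dotc (g t) (g t))
  + 2^-1 * (w t * dotc (h t) (h t)))).
- by apply: measurable_funM => //; exact: measc_dot.
- move=> t; rewrite normrM (ger0_norm (w0 t)).
  have := dotc_le (g t) (h t); have := w0 t => a b.
  apply: (le_trans (ler_wpM2l a b)); lra.
- by apply: integrD; exact: integrZ.
Qed.

Lemma sqD w g h : weight w -> sq w g -> sq w h -> sq w (fun t => g t + h t).
Proof.
move=> hw hg hh; split; first by apply: meascD; [case: hg|case: hh].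
apply: (@eq_integr (fun t => (w t * dotc (g t) (g t) + w t * dotc (h t) (h t))
  + (w t * dotc (g t) (h t) + w t * dotc (g t) (h t)))).
  by move=> t; rewrite !(dotcDl, dotcDr) (dotcC (h t) (g t)); ring.
by apply: integrD; apply: integrD; exact: ip_integr.
Qed.

Lemma sqM w (z : R[i]) g : weight w -> sq w g -> sq w (fun t => z * g t).
Proof.
move=> hw [mg ig]; split; first by apply: meascM => //; exact: measc_cst.
apply: (@eq_integr (fun t => dotc z z * (w t * dotc (g t) (g t)))).
  by move=> t; rewrite dotcM; ring.
exact: integrZ.
Qed.

Lemma sqN w g : weight w -> sq w g -> sq w (fun t => - g t).
Proof.
move=> hw hg; rewrite (_ : (fun t => _) = fun t => (-1) * g t).
  exact: sqM.
by apply/funext => t; rewrite mulN1r.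
Qed.

Lemma sqB w g h : weight w -> sq w g -> sq w h -> sq w (fun t => g t - h t).
Proof. by move=> hw hg hh; apply: sqD => //; exact: sqN. Qed.

Lemma sq0 w : sq w (fun=> 0).
Proof.
split; first exact: measc_cst.
apply: (@eq_integr (fun=> 0)); last exact: integrable0.
by move=> t; rewrite dotc0l mulr0.
Qed.

Lemma sq_sum I (s : seq I) w (g : I -> R -> R[i]) : weight w ->
  (forall i, sq w (g i)) -> sq w (fun t => \sum_(i <- s) g i t).
Proof.
move=> hw mg; elim: s => [|i s ih].
  by under eq_fun do rewrite big_nil; exact: sq0.
by under eq_fun do rewrite big_cons; exact: sqD.
Qed.

Lemma ipC w g h : ip w g h = ip w h g.
Proof. by apply: eq_Rintegral => t _; rewrite dotcC. Qed.

Lemma ipDl w f g h : weight w -> sq w f -> sq w g -> sq w h ->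
  ip w (fun t => f t + g t) h = ip w f h + ip w g h.
Proof.
move=> hw hf hg hh.
rewrite -(RintegralD measurableT (ip_integr hw hf hh) (ip_integr hw hg hh)).
by apply: eq_Rintegral => t _; rewrite dotcDl mulrDr.
Qed.

Lemma ipZl w (k : R) g h : weight w -> sq w g -> sq w h ->
  ip w (fun t => k%:C * g t) h = k * ip w g h.
Proof.
move=> hw hg hh; rewrite -RintegralZl //; last exact: ip_integr.
by apply: eq_Rintegral => t _; rewrite dotcZl; ring.
Qed.

Lemma ipNl w g h : weight w -> sq w g -> sq w h ->
  ip w (fun t => - g t) h = - ip w g h.
Proof.
move=> hw hg hh; rewrite -mulN1r -ipZl//; congr (ip _ _ _); apply/funext => t.
by rewrite rmorphN rmorph1 mulN1r.
Qed.

Lemma ipBl w f g h : weight w -> sq w f -> sq w g -> sq w h ->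
  ip w (fun t => f t - g t) h = ip w f h - ip w g h.
Proof. by move=> hw hf hg hh; rewrite ipDl ?ipNl//; exact: sqN. Qed.

Lemma ipDr w f g h : weight w -> sq w f -> sq w g -> sq w h ->
  ip w h (fun t => f t + g t) = ip w h f + ip w h g.
Proof. by move=> *; rewrite ipC ipDl // (ipC w h f) (ipC w h g). Qed.

Lemma ipBr w f g h : weight w -> sq w f -> sq w g -> sq w h ->
  ip w h (fun t => f t - g t) = ip w h f - ip w h g.
Proof. by move=> *; rewrite ipC ipBl // (ipC w h f) (ipC w h g). Qed.

Lemma ipZr w (k : R) g h : weight w -> sq w g -> sq w h ->
  ip w h (fun t => k%:C * g t) = k * ip w h g.
Proof. by move=> *; rewrite ipC ipZl // (ipC w h g). Qed.

Lemma ip0l w h : ip w (fun=> 0) h = 0.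
Proof.
rewrite /ip (_ : (fun t => _) = fun=> 0) ?Rintegral_cst// ?mul0r//.
by apply/funext => t; rewrite dotc0l mulr0.
Qed.

Lemma ip_suml I (s : seq I) w (g : I -> R -> R[i]) h : weight w ->
  (forall i, sq w (g i)) -> sq w h ->
  ip w (fun t => \sum_(i <- s) g i t) h = \sum_(i <- s) ip w (g i) h.
Proof.
move=> hw hg hh; elim: s => [|i s ih].
  by under eq_fun do rewrite big_nil; rewrite big_nil ip0l.
rewrite big_cons -ih -ipDl//; last exact: sq_sum.
by congr (ip _ _ _); apply/funext => t; rewrite big_cons.
Qed.

Lemma ip_ge0 w g : weight w -> 0 <= ip w g g.
Proof.
by move=> [_ w0]; apply: Rintegral_ge0 => t _; rewrite mulr_ge0 ?dotcc_ge0.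
Qed.

(** Shared by Cauchy-Schwarz, where [a] is a squared norm, and by the approximate Euler equation of
    [variational], where [a] is a tolerance. *)
Lemma discr_le (a b c : R) : 0 <= c -> (forall t, 0 <= a + 2 * t * b + t ^+ 2 * c) ->
  b ^+ 2 <= a * c.
Proof.
rewrite le_eqVlt => /predU1P[<-|fourier_cst] h.
  rewrite mulr0; case: (eqVneq b 0) => [->|b0]; first by rewrite expr2 mulr0.
  (* With [c = 0] the polynomial is affine; for nonzero [b] it would equal -1 at this point. *)
  have := h (- (a + 1) / (2 * b)); rewrite mulr0 addr0.
  have -> : 2 * (- (a + 1) / (2 * b)) * b = - (a + 1) by field.
  lra.
have := h (- b / c).
have -> : a + 2 * (- b / c) * b + (- b / c) ^+ 2 * c = (a * c - b ^+ 2) / c.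
  by field; rewrite gt_eqF.
by rewrite pmulr_lge0 ?invr_gt0// subr_ge0.
Qed.

Lemma ip_CS w g h : weight w -> sq w g -> sq w h ->
  ip w g h ^+ 2 <= ip w g g * ip w h h.
Proof.
move=> hw hg hh; apply: discr_le => [|t]; first exact: ip_ge0.
have : 0 <= ip w (fun s => g s + t%:C * h s) (fun s => g s + t%:C * h s).
  exact: ip_ge0.
have th : sq w (fun s => t%:C * h s) by exact: sqM.
rewrite !(ipDl, ipDr)//; try exact: sqD.
by rewrite !(ipZl, ipZr)// (ipC w h g); lra.
Qed.

Lemma ip_CSn w g h : weight w -> sq w g -> sq w h ->
  `|ip w g h| <= Num.sqrt (ip w g g) * Num.sqrt (ip w h h).
Proof.
move=> hw hg hh; rewrite -sqrtrM ?ip_ge0// -sqrtr_sqr ler_wsqrtr//.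
exact: ip_CS.
Qed.

(** The tool for changes of weight: from 1 to [lap e], and from phihat to the indicator of the band
    at the cost of a factor 1 / m. *)
Lemma ip_le w1 w2 (k : R) g : weight w1 -> weight w2 -> sq w2 g ->
  (forall t, w1 t <= k * w2 t) -> sq w1 g /\ ip w1 g g <= k * ip w2 g g.
Proof.
move=> [m1 p1] hw2 hg h; have i2 := ip_integr hw2 hg hg.
have mw : measurable_fun setT (fun t => w1 t * dotc (g t) (g t)).
  by apply: measurable_funM => //; apply: measc_dot; case: hg.
have hh t : w1 t * dotc (g t) (g t) <= k * (w2 t * dotc (g t) (g t)).
  by rewrite mulrA ler_wpM2r ?dotcc_ge0.
have s1 : sq w1 g.
  split; first by case: hg.
  apply: (integr_le mw _ (integrZ k i2)) => t.
  by rewrite ger0_norm ?mulr_ge0 ?dotcc_ge0.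
split => //; rewrite -RintegralZl //; apply: le_Rintegral => //.
- by case: s1.
- exact: integrZ.
Qed.

Lemma sq_bounded w g (B : R) : weight w -> integr w -> measc g ->
  (forall t, dotc (g t) (g t) <= B) -> sq w g.
Proof.
move=> [mw w0] iw mg gB; split => //.
apply: (@integr_le _ (fun t => B * w t)).
- by apply: measurable_funM => //; exact: measc_dot.
- move=> t; rewrite ger0_norm ?mulr_ge0 ?dotcc_ge0// mulrC.
  exact: ler_wpM2r.
- exact: integrZ.
Qed.

End ip.

(** * Symmetric sums over the integers *)

Section sum_upto.
(* [zsum_upto], for an arbitrary codomain. *)
Definition sum_upto {V : nmodType} (N : nat) (u : int -> V) : V :=
  \sum_(k < N.*2.+1) u (k%:Z - N%:Z).

Definition int_upto (N : nat) : seq int := [seq k%:Z - N%:Z | k <- iota 0 N.*2.+1].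

Lemma sum_upto_int_upto (V : nmodType) N (u : int -> V) : sum_upto N u = \sum_(j <- int_upto N) u j.
Proof.
rewrite /sum_upto -(big_mkord xpredT (fun k => u (k%:Z - N%:Z))) /int_upto big_map.
by rewrite /index_iota subn0.
Qed.

Lemma int_upto_uniq N : uniq (int_upto N).
Proof.
rewrite map_inj_in_uniq ?iota_uniq// => i j _ _ /addIr/eqP.
by rewrite eqz_nat => /eqP.
Qed.

Lemma mem_int_upto N j : (j \in int_upto N) = (`|j| <= N)%N.
Proof.
apply/mapP/idP => [[k]|jN]; first by rewrite mem_iota => /andP[_ ?] ->; lia.
by exists (absz (j + N%:Z)); [rewrite mem_iota|]; lia.
Qed.

(** Padding by zeros lets sums of different lengths be compared over one common range, and turns
    finitely many coefficients into an element of l2, to which the Riesz bounds apply. *)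
Definition cut {V : nmodType} N (a : int -> V) j : V :=
  if (`|j| <= N)%N then a j else 0.

Lemma sum_upto_cut (V : nmodType) N M (u : int -> V) : (N <= M)%N ->
  sum_upto M (cut N u) = sum_upto N u.
Proof.
move=> NM; rewrite !sum_upto_int_upto -big_mkcond/= -big_filter.
apply: perm_big; apply: uniq_perm; rewrite ?filter_uniq ?int_upto_uniq// => j.
rewrite mem_filter !mem_int_upto; lia.
Qed.

Lemma eq_sum_upto (V : nmodType) N (u v : int -> V) :
  (forall j, (`|j| <= N)%N -> u j = v j) -> sum_upto N u = sum_upto N v.
Proof.
by move=> uv; rewrite !sum_upto_int_upto; apply: eq_big_seq => j; rewrite mem_int_upto => /uv.
Qed.

Lemma sum_uptoD (V : nmodType) N (u v : int -> V) :
  sum_upto N (fun j => u j + v j) = sum_upto N u + sum_upto N v.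
Proof. by rewrite /sum_upto big_split. Qed.

Lemma sum_uptoB (V : zmodType) N (u v : int -> V) :
  sum_upto N (fun j => u j - v j) = sum_upto N u - sum_upto N v.
Proof. by rewrite /sum_upto sumrB. Qed.

Lemma sum_uptoZ (V : pzRingType) N (k : V) (u : int -> V) :
  sum_upto N (fun j => k * u j) = k * sum_upto N u.
Proof. by rewrite /sum_upto mulr_sumr. Qed.

Lemma le_sum_upto (R : numDomainType) N (u v : int -> R) :
  (forall j, (`|j| <= N)%N -> u j <= v j) -> sum_upto N u <= sum_upto N v.
Proof.
move=> uv; rewrite !sum_upto_int_upto !big_seq; apply: ler_sum => j.
by rewrite mem_int_upto => /uv.
Qed.

Lemma sum_upto_ge0 (R : numDomainType) N (u : int -> R) :
  (forall j, 0 <= u j) -> 0 <= sum_upto N u.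
Proof. by move=> u0; apply: sumr_ge0 => *. Qed.

Lemma sum_upto_mono (R : numDomainType) N M (u : int -> R) : (N <= M)%N ->
  (forall j, 0 <= u j) -> sum_upto N u <= sum_upto M u.
Proof.
move=> NM u0; rewrite -(sum_upto_cut u NM); apply: le_sum_upto => j _.
by rewrite /cut; case: ifP.
Qed.

Lemma sum_upto_delta (V : nmodType) N (i : int) (z : V) : (`|i| <= N)%N ->
  sum_upto N (fun j => if j == i then z else 0) = z.
Proof.
move=> iN; rewrite sum_upto_int_upto (bigD1_seq i) ?int_upto_uniq ?mem_int_upto//= eqxx.
by rewrite big1 ?addr0// => j /negbTE ->.
Qed.

Lemma sum_upto_term_le (R : numDomainType) N (i : int) (u : int -> R) : (`|i| <= N)%N ->
  (forall j, 0 <= u j) -> u i <= sum_upto N u.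
Proof.
move=> iN u0; rewrite -{1}(sum_upto_delta (u i) iN); apply: le_sum_upto => j _.
by case: eqP => [->|].
Qed.
End sum_upto.

(** * Square-summable sequences through their truncations *)

Section esum_sum_upto.
Context {R : realType}.
Implicit Types (f : int -> R).

Lemma sum_upto_le_esum f N : (forall j, 0 <= f j) ->
  ((sum_upto N f)%:E <= \esum_(j in [set: int]) (f j)%:E)%E.
Proof.
move=> f0; apply: esum_ge; exists [set` int_upto N]; first by split => //; exact: finite_seq.
by rewrite -fsbig_seq ?int_upto_uniq// sumEFin sum_upto_int_upto.
Qed.

Lemma esum_le_sum_upto f (B : R) : (forall j, 0 <= f j) -> (forall N, sum_upto N f <= B) ->
  (\esum_(j in [set: int]) (f j)%:E <= B%:E)%E.
Proof.
move=> f0 fB; apply: ub_ereal_sup => _ [X [fX _] <-].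
have /finite_seqP[s sE] := fX.
pose N := \max_(j <- s) `|j|%N.
have XN : X `<=` [set` int_upto N].
  move=> j; rewrite sE => js; rewrite /= mem_int_upto /N.
  exact: (@leq_bigmax_seq _ s xpredT (fun j : int => `|j|%N) j js isT).
apply: (@le_trans _ _ (\sum_(j \in [set` int_upto N]) (f j)%:E)%E).
  apply: lee_fsum_nneg_subset => //; first exact: finite_seq.
  - by move=> j /[!inE] /XN.
  - by move=> j _; rewrite lee_fin.
by rewrite -fsbig_seq ?int_upto_uniq// sumEFin -sum_upto_int_upto lee_fin.
Qed.

(** The l2 norm is handled through these real truncations: membership becomes a bound uniform in [N]
    ([l2P]), and tails become differences ([sqnorm_tail]). *)
Definition sqnorm N (a : int -> R[i]) : R := sum_upto N (fun j => dotc (a j) (a j)).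

Lemma sqnorm_ge0 N a : 0 <= sqnorm N a.
Proof. by apply: sum_upto_ge0 => j; exact: dotcc_ge0. Qed.

Lemma sqnorm_mono N M a : (N <= M)%N -> sqnorm N a <= sqnorm M a.
Proof. by move=> NM; apply: sum_upto_mono => // j; exact: dotcc_ge0. Qed.

Lemma l2normE (a : int -> R[i]) : l2norm a =
  ((\esum_(j in [set: int]) (dotc (a j) (a j))%:E) `^ 2^-1)%E.
Proof.
by rewrite /l2norm; congr (_ `^ _)%E; apply: eq_esum => j _; rewrite normc_sqr.
Qed.

Lemma l2P (a : int -> R[i]) : l2 a <-> exists B, forall N, sqnorm N a <= B.
Proof.
rewrite /l2 l2normE; split => [/lty_poweRy|[B aB]].
  have ge0 : (0 <= \esum_(j in [set: int]) (dotc (a j) (a j))%:E)%E.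
    by apply: esum_ge0 => j _; rewrite lee_fin dotcc_ge0.
  rewrite invr_eq0 pnatr_eq0/= => /(_ isT) h.
  exists (fine (\esum_(j in [set: int]) (dotc (a j) (a j))%:E)%E) => N.
  rewrite -lee_fin fineK ?ge0_fin_numE//.
  by apply: (@sum_upto_le_esum (fun j => dotc (a j) (a j))) => j; exact: dotcc_ge0.
apply: poweR_lty; apply: (le_lt_trans _ (ltry B)).
by apply: (@esum_le_sum_upto (fun j => dotc (a j) (a j))) => // j; exact: dotcc_ge0.
Qed.

Lemma l2norm_cut N (a : int -> R[i]) : l2norm (cut N a) = (Num.sqrt (sqnorm N a))%:E.
Proof.
have E M : (N <= M)%N -> sqnorm M (cut N a) = sqnorm N a.
  move=> NM; rewrite /sqnorm -(sum_upto_cut _ NM); apply: eq_sum_upto => j _.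
  by rewrite /cut; case: ifP => // _; rewrite dotc0l.
rewrite l2normE; have -> : (\esum_(j in [set: int])
    (dotc (cut N a j) (cut N a j))%:E = (sqnorm N a)%:E)%E.
  apply/eqP; rewrite eq_le; apply/andP; split.
    apply: (@esum_le_sum_upto (fun j => dotc (cut N a j) (cut N a j))) => [j|M].
      exact: dotcc_ge0.
    by rewrite -(E (maxn N M)) ?leq_maxl// sqnorm_mono// leq_maxr.
  rewrite -(E N)//.
  by apply: (@sum_upto_le_esum (fun j => dotc (cut N a j) (cut N a j))) => j; exact: dotcc_ge0.
by rewrite poweR12_sqrt// lee_fin sqnorm_ge0.
Qed.

Lemma bounded_mono_cauchy (u : nat -> R) (B : R) : {homo u : m n / (m <= n)%N >-> m <= n} ->
  (forall n, u n <= B) -> forall e, 0 < e ->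
  exists N0, forall n, (N0 <= n)%N -> forall m, u m <= u n + e.
Proof.
move=> um uB e e0; pose S := [set u n | n in [set: nat]].
have hs : has_sup S by split; [exists (u 0%N), 0%N|exists B => _ [n _ <-]].
have [_ [N0 _ <-] hN] := sup_adherent e0 hs.
exists N0 => n Nn m; have h1 := um _ _ Nn.
have : u m <= sup S by apply: sup_upper_bound => //; exists m.
lra.
Qed.

Lemma l2_cauchy (a : int -> R[i]) : l2 a -> forall e, 0 < e ->
  exists N0, forall n, (N0 <= n)%N -> forall m, sqnorm m a <= sqnorm n a + e.
Proof.
move=> /l2P[B aB]; apply: (@bounded_mono_cauchy (fun n => sqnorm n a) B) => //.
by move=> m n mn; exact: sqnorm_mono.
Qed.
End esum_sum_upto.

(** * L2 norms as integrals *)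

Section L2norm.
Context {R : realType}.
Local Notation mu := (@lebesgue_measure R).
Implicit Types (D : set R) (g h : R -> R[i]).

Lemma L2norm_integral D g : L2norm D g =
  ((\int[mu]_t (\1_D t * dotc (g t) (g t))%:E) `^ 2^-1)%E.
Proof.
rewrite /L2norm unlock /Lnorm; congr (_ `^ _)%E; apply: eq_integral => t _ /=.
rewrite powR_mulrn ?normr_ge0// real_normK ?num_real// exprMn normc_sqr.
by rewrite mulrC indicE; case: (_ \in _); rewrite /= ?expr1n// expr0n.
Qed.

Lemma weight_indic D : measurable D -> weight (\1_D : R -> R).
Proof.
by move=> mD; split=> [|t]; [exact: measurable_indic|rewrite indicE ler0n].
Qed.

Lemma L2norm_sq D g : sq \1_D g -> L2norm D g = (Num.sqrt (ip \1_D g g))%:E.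
Proof.
move=> [mg ig]; rewrite L2norm_integral integral_EFin// poweR12_sqrt//.
rewrite lee_fin Rintegral_ge0// => t _.
by rewrite mulr_ge0 ?dotcc_ge0// indicE ler0n.
Qed.

Lemma indic_dot_ge0 D g t : 0 <= \1_D t * dotc (g t) (g t).
Proof. by rewrite mulr_ge0 ?dotcc_ge0// indicE ler0n. Qed.

Lemma L2norm_fin_sq D g : measurable D -> measc g -> (L2norm D g < +oo)%E ->
  sq \1_D g.
Proof.
move=> mD mg; rewrite L2norm_integral => /lty_poweRy.
rewrite invr_eq0 pnatr_eq0/= => /(_ isT) h; split => //.
have mm : measurable_fun setT (fun t => \1_D t * dotc (g t) (g t)).
  by apply: measurable_funM; [exact: measurable_indic|exact: measc_dot].
suff hb : (\int[mu]_t (\1_D t * dotc (g t) (g t))%:E <=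
    (fine (\int[mu]_t (\1_D t * dotc (g t) (g t))%:E))%:E)%E.
  by case: (ge0_integr mm (indic_dot_ge0 D g) hb).
rewrite fineK// ge0_fin_numE//.
by apply: integral_ge0 => t _; rewrite lee_fin indic_dot_ge0.
Qed.

End L2norm.

(** * The Poisson kernel *)

Section lebesgue.
Context {R : realType}.
Local Notation mu := (@lebesgue_measure R).

(** Symmetry reduces the integral to the half-line [0, +oo[, where [F] is an antiderivative;
    nonnegativity of [f] lets the improper integral be computed before integrability is known. *)
Lemma even_FTC (f F : R -> R) (l : R) :
  (forall x, 0 <= f x) -> continuous f -> f =1 f \o -%R ->
  (forall x : R, 0 <= x -> is_derive x 1 F (f x)) ->
  F x @[x --> +oo] --> l ->
  integr f /\ \int[mu]_x f x = 2 * (l - F 0).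
Proof.
move=> f0 cf fe dF Fl.
have cF : {for 0, continuous F}.
  apply: differentiable_continuous; apply/derivable1_diffP.
  by case: (dF 0 (lexx _)).
have E : (\int[mu]_x (f x)%:E)%E = (2 * (l - F 0))%:E.
  rewrite ge0_symfun_integralT// EFinM; congr (_ * _)%E.
  rewrite (_ : [set x | _] = `[0, +oo[%classic); last first.
    by apply/seteqP; split => x/=; rewrite in_itv/= andbT.
  rewrite (@ge0_continuous_FTC2y _ f F 0 l)//.
  - exact: continuous_subspaceT.
  - by move=> x x0; case: (dF x (ltW x0)).
  - exact: cvg_at_right_filter.
  - move=> x; rewrite in_itv andbT => x0.
    by rewrite derive1E; case: (dF x (ltW x0)) => _ ->.
have mf : measurable_fun setT f by exact: continuous_measurable_fun.
have [//|] := @ge0_integr _ f (2 * (l - F 0)) mf f0; first by rewrite E.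
by move=> i _; split=> //; rewrite /Rintegral E.
Qed.

(** The image of Lebesgue measure under a translation agrees with it on the intervals ]a, b], hence
    everywhere by uniqueness. *)
Lemma ge0_integral_shift (c : R) (f : R -> \bar R) :
  measurable_fun setT f -> (forall x, 0 <= f x)%E ->
  (\int[mu]_x f (x + c)%R = \int[mu]_x f x)%E.
Proof.
move=> mf f0.
pose s := (fun x : R => x + c) : R -> measurableTypeR R.
have ms : measurable_fun setT s.
  exact: (@measurable_funD _ _ _ _ id (cst c)).
rewrite -[LHS](_ : (\int[pushforward mu s]_(y in setT) f y = _)%E); last first.
  by rewrite ge0_integral_pushforward.
apply: eq_measure_integral => A mA _; apply/esym.
apply: (@lebesgue_measure_unique R (pushforward mu s)) => // _ [[a b]] _ <-.
have sE : s @^-1` `]a, b]%classic = `](a - c), (b - c)]%classic.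
  by apply/seteqP; split => x /=; rewrite !in_itv/= /s lerBrDr ltrBlDr.
rewrite /pushforward; transitivity (mu `](a - c), (b - c)]%classic).
  rewrite !lebesgue_measure_itv/= !lte_fin ltrD2r.
  by case: ifP => // _; rewrite -!EFinB; congr (_%:E); ring.
by rewrite -sE.
Qed.

Lemma integral_opp (f : R -> R) : integr f ->
  integr (fun x => f (- x)) /\ \int[mu]_x f (- x) = \int[mu]_x f x.
Proof.
move=> hf; have mf := integr_meas hf.
pose s := -%R : R -> measurableTypeR R.
have ms : measurable_fun setT s by exact: oppr_measurable.
have mfs : measurable_fun setT (fun x : R => f (- x)).
  exact: (measurableT_comp mf ms).
have h (g : R -> \bar R) : measurable_fun setT g -> (forall x, 0 <= g x)%E ->
    (\int[mu]_x g (- x)%R = \int[mu]_x g x)%E.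
  move=> mg g0.
  rewrite -[LHS](_ : (\int[pushforward mu s]_(y in setT) g y = _)%E); last first.
    by rewrite ge0_integral_pushforward.
  apply: eq_measure_integral => A mA _; exact: lebesgue_measureN.
have hfs : integr (fun x => f (- x)).
  apply/integrableP; split; first exact/measurable_EFinP.
  move/integrableP: hf => [_]; rewrite (_ : (\int[mu]_x `|_| = \int[mu]_x `|(f (- x))%:E|)%E)//.
  rewrite (h (fun x => `|(f x)%:E|%E))//.
  exact/measurable_EFinP/measurableT_comp.
split => //; congr fine; rewrite [LHS]integralE [RHS]integralE; congr (_ - _)%E.
  rewrite -[RHS]h; [by apply: eq_integral => x _; rewrite !funeposE| |by move=> x; exact: funepos_ge0].
  by apply: measurable_funepos; exact/measurable_EFinP.
rewrite -[RHS]h; [by apply: eq_integral => x _; rewrite !funenegE| |by move=> x; exact: funeneg_ge0].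
by apply: measurable_funeneg; exact/measurable_EFinP.
Qed.

Lemma integral_odd (f : R -> R) : integr f -> (forall x, f (- x) = - f x) ->
  \int[mu]_x f x = 0.
Proof.
move=> hf fo; have [_] := integral_opp hf.
rewrite (_ : (fun x => f (- x)) = fun x => (-1) * f x); last first.
  by apply/funext => x; rewrite fo mulN1r.
rewrite RintegralZl// => h; lra.
Qed.

Definition lap (e x : R) : R := expR (- (e * `|x|)).

(** Left unnormalised: as the cosine transform of [lap e] it has mass 2 pi, which the square of
    [fourier_cst] cancels in the end. *)
Definition poisson (e t : R) : R := 2 * e / (e ^+ 2 + t ^+ 2).

Lemma continuous_lap e : continuous (lap e).
Proof.
move=> x; apply: continuous_comp; last exact: continuous_expR.
apply: cvgN; apply: cvgM; [exact: cvg_cst|exact: norm_continuous].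
Qed.

Lemma lap_ge0 e x : 0 <= lap e x. Proof. exact: expR_ge0. Qed.

Lemma lap_le1 e x : 0 <= e -> lap e x <= 1.
Proof. by move=> e0; rewrite -expR0 ler_expR oppr_le0 mulr_ge0. Qed.

Lemma lapN e x : lap e (- x) = lap e x.
Proof. by rewrite /lap normrN. Qed.

(** An antiderivative in [x] of [expR (- (e * x)) * cos (t * x)], which is the integrand on the
    half-line x >= 0. *)
Let Pcos (e t x : R) := expR (- (e * x)) * (- e * cos (t * x) + t * sin (t * x)) / (e ^+ 2 + t ^+ 2).

(* The 1 makes the integrand nonnegative, as the fundamental theorem of calculus
   on a half-line requires. *)
Lemma integral_lap1cos e t : 0 < e ->
  integr (fun x => lap e x * (1 + cos (t * x))) /\
  \int[mu]_x (lap e x * (1 + cos (t * x))) = 2 / e + poisson e t.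
Proof.
move=> e0; pose F x := - (expR (- (e * x)) / e) + Pcos e t x.
have d0 : e ^+ 2 + t ^+ 2 != 0 by rewrite gt_eqF// ltr_pwDl ?exprn_gt0 ?sqr_ge0.
have en0 : e != 0 by rewrite gt_eqF.
have -> : 2 / e + poisson e t = 2 * (0 - F 0).
  by rewrite /F /Pcos /poisson !mulr0 oppr0 expR0 cos0 sin0; field; apply/andP.
apply: even_FTC.
- move=> x; rewrite mulr_ge0 ?lap_ge0//; have := cos_geN1 (t * x); lra.
- move=> x; apply: cvgM; first exact: continuous_lap.
  apply: cvgD; first exact: cvg_cst.
  apply: continuous_comp; last exact: continuous_cos.
  by apply: cvgM; [exact: cvg_cst|exact: cvg_id].
- by move=> x /=; rewrite lapN mulrN cosN.
- move=> x x0; rewrite /lap ger0_norm// /F /Pcos.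
  apply: is_derive_eq; rewrite /GRing.scale/=.
  by field; apply/andP.
have cE : expR (- (e * x)) @[x --> +oo] --> 0.
  apply: (@cvg_comp _ _ _ (fun x => e * x) (fun z => expR (- z)) _ (pinfty_nbhs R));
    last exact: cvgr_expR.
  by apply: gt0_cvgMry => //; exact: cvg_id.
rewrite -[0](_ : - (0 / e) + 0 = 0); last by rewrite mul0r oppr0 addr0.
apply: cvgD; first by apply: cvgN; apply: cvgM => //; exact: cvg_cst.
pose K := (e + `|t|) / (e ^+ 2 + t ^+ 2).
have K0 : 0 <= K by rewrite divr_ge0 ?addr_ge0 ?sqr_ge0 ?normr_ge0// ltW.
apply: (@squeeze_cvgr _ _ _ _ (fun x => - (K * expR (- (e * x))))
  (fun x => K * expR (- (e * x)))).
- apply: nearW => x; rewrite -ler_norml /Pcos.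
  have d0' : 0 <= (e ^+ 2 + t ^+ 2)^-1 by rewrite invr_ge0 addr_ge0 ?sqr_ge0.
  rewrite normrM normrM (ger0_norm (expR_ge0 _)) (ger0_norm d0').
  rewrite -mulrA mulrC ler_wpM2r ?expR_ge0// ler_wpM2r//.
  rewrite (le_trans (ler_normD _ _))// lerD//.
    by rewrite normrM normrN (gtr0_norm e0) ler_piMr ?(ltW e0)// ler_norml cos_geN1 cos_le1.
  by rewrite normrM ler_piMr// ler_norml sin_geN1 sin_le1.
- rewrite -oppr0; apply: cvgN; rewrite -[0](mulr0 K).
  by apply: cvgM => //; exact: cvg_cst.
- by rewrite -[0](mulr0 K); apply: cvgM => //; exact: cvg_cst.
Qed.

Lemma integr_lap e : 0 < e -> integr (lap e).
Proof.
move=> e0; have [+ _] := integral_lap1cos 0 e0 => /(integrZ 2^-1); apply: eq_integr.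
by move=> x; rewrite mul0r cos0; field.
Qed.

Lemma integral_lap_cos e t : 0 < e ->
  integr (fun x => lap e x * cos (t * x)) /\
  \int[mu]_x (lap e x * cos (t * x)) = poisson e t.
Proof.
move=> e0; have [i1 E1] := integral_lap1cos t e0.
have [i2 E2] := integral_lap1cos 0 e0.
have i0 := integr_lap e0.
have E0 : \int[mu]_x lap e x = 2 / e.
  have : \int[mu]_x (2 * lap e x) = 2 / e + poisson e 0.
    rewrite -E2; apply: eq_Rintegral => x _; rewrite mul0r cos0; ring.
  rewrite RintegralZl// /poisson expr0n/= addr0 => h.
  apply: (@mulfI _ 2) => //; rewrite h; field; by rewrite gt_eqF.
have i : integr (fun x => lap e x * cos (t * x)).
  by apply: eq_integr (integrB i1 i0) => x; ring.
split => //; move: E1; rewrite (_ : (fun x => _) =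
    fun x => lap e x + lap e x * cos (t * x)); last by apply/funext => x; ring.
by rewrite RintegralD// E0 => /addrI.
Qed.

Lemma integral_lap_sin e t : 0 < e ->
  integr (fun x => lap e x * sin (t * x)) /\
  \int[mu]_x (lap e x * sin (t * x)) = 0.
Proof.
move=> e0; have i : integr (fun x => lap e x * sin (t * x)).
  apply: (@integr_le _ _ (lap e)); last exact: integr_lap.
  - apply: measurable_funM; first by apply: continuous_measurable_fun; exact: continuous_lap.
    apply: continuous_measurable_fun => x; apply: continuous_comp; last exact: continuous_sin.
    by apply: cvgM; [exact: cvg_cst|exact: cvg_id].
  - move=> x; rewrite normrM (ger0_norm (lap_ge0 _ _)) ler_piMr ?lap_ge0//.
    by rewrite ler_norml sin_geN1 sin_le1.
by split => //; apply: integral_odd => // x; rewrite lapN mulrN sinN mulrN.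
Qed.

Lemma poisson_ge0 e t : 0 < e -> 0 <= poisson e t.
Proof. by move=> e0; rewrite divr_ge0 ?addr_ge0 ?sqr_ge0 ?mulr_ge0 ?ltW. Qed.

Lemma poissonN e t : poisson e (- t) = poisson e t.
Proof. by rewrite /poisson sqrrN. Qed.

Lemma continuous_poisson e : 0 < e -> continuous (poisson e).
Proof.
move=> e0 x; apply: cvgM; first exact: cvg_cst.
apply: cvgV; first by rewrite gt_eqF// ltr_pwDl ?exprn_gt0 ?sqr_ge0.
by apply: cvgD; [exact: cvg_cst|exact: exprn_continuous].
Qed.

Lemma integral_poisson e : 0 < e ->
  integr (poisson e) /\ \int[mu]_x poisson e x = 2 * pi.
Proof.
move=> e0; pose F x := 2 * atan (e^-1 * x).
have en0 : e != 0 by rewrite gt_eqF.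
have -> : 2 * pi = 2 * (2 * (pi / 2) - F 0).
  by rewrite /F mulr0 atan0; field.
apply: even_FTC.
- by move=> x; exact: poisson_ge0.
- exact: continuous_poisson.
- by move=> x /=; rewrite poissonN.
- move=> x x0; rewrite /F /poisson.
  apply: is_derive_eq; rewrite /GRing.scale/=.
  by field; rewrite en0/= gt_eqF// ltr_pwDl ?exprn_gt0 ?sqr_ge0.
- apply: cvgM; first exact: cvg_cst.
  apply: (@cvg_comp _ _ _ (fun x => e^-1 * x) atan _ (pinfty_nbhs R));
    last exact: cvgy_atan.
  by apply: gt0_cvgMry; [rewrite invr_gt0|exact: cvg_id].
Qed.

Lemma integral_poisson_shift e x : 0 < e ->
  integr (fun t => poisson e (x - t)) /\ \int[mu]_t poisson e (x - t) = 2 * pi.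
Proof.
move=> e0; have [i E] := integral_poisson e0.
have mp : measurable_fun setT (poisson e) by exact: integr_meas.
have mps : measurable_fun setT (fun t : R => poisson e (x - t)).
  by apply: (measurableT_comp mp); apply: measurable_funB.
have E' : (\int[mu]_t (poisson e (x - t))%:E)%E = (2 * pi)%:E.
  rewrite -E -integral_EFin// -[RHS](@ge0_integral_shift (- x) (fun t => (poisson e t)%:E))//.
  - by apply: eq_integral => t _; rewrite -poissonN opprB.
  - exact/measurable_EFinP.
  - by move=> t; rewrite lee_fin poisson_ge0.
have [//||i' _] := @ge0_integr _ _ (2 * pi) mps; first by move=> t; exact: poisson_ge0.
  by rewrite E'.
by split => //; rewrite /Rintegral E'.
Qed.

(** From t^2 <= 2 (x - t)^2 + 2 x^2. This is the source of the weight 1 / (1 + t^2) in the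
    integrability hypotheses below, which every L^2 function satisfies. *)
Lemma poisson_decay (d x t : R) : 0 < d ->
  (d ^+ 2 + (x - t) ^+ 2)^-1 <= (2 + (1 + 2 * x ^+ 2) / d ^+ 2) / (1 + t ^+ 2).
Proof.
move=> d0; have t0 : 0 < 1 + t ^+ 2 by rewrite ltr_pwDl ?sqr_ge0.
have d20 : 0 < d ^+ 2 by rewrite exprn_gt0.
have xt0 : 0 < d ^+ 2 + (x - t) ^+ 2 by rewrite ltr_pwDl ?sqr_ge0.
rewrite ler_pdivlMr// mulrC ler_pdivrMr//.
have : 0 <= (2 * x - t) ^+ 2 by exact: sqr_ge0.
have : 0 <= ((1 + 2 * x ^+ 2) / d ^+ 2) * (x - t) ^+ 2.
  rewrite mulr_ge0 ?sqr_ge0// divr_ge0 ?sqr_ge0//; have := sqr_ge0 x; lra.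
have -> : (2 + (1 + 2 * x ^+ 2) / d ^+ 2) * (d ^+ 2 + (x - t) ^+ 2) =
  2 * d ^+ 2 + 2 * (x - t) ^+ 2 + (1 + 2 * x ^+ 2) +
   ((1 + 2 * x ^+ 2) / d ^+ 2) * (x - t) ^+ 2 by field; rewrite gt_eqF.
nra.
Qed.

Lemma integr_mul_poisson e x (v : R -> R) : 0 < e -> measurable_fun setT v ->
  integr (fun t => `|v t| / (1 + t ^+ 2)) -> integr (fun t => v t * poisson e (x - t)).
Proof.
move=> e0 mv iv.
apply: (integr_le _ _ (integrZ (2 * e * (2 + (1 + 2 * x ^+ 2) / e ^+ 2)) iv)).
  by apply: measurable_funM => //; have [/integr_meas] := integral_poisson_shift x e0.
move=> t; rewrite normrM (ger0_norm (poisson_ge0 _ e0)) /poisson.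
have h := poisson_decay x t e0.
apply: (@le_trans _ _ (`|v t| * (2 * e * ((2 + (1 + 2 * x ^+ 2) / e ^+ 2) / (1 + t ^+ 2))))).
  by apply: ler_wpM2l => //; apply: ler_wpM2l => //; rewrite mulr_ge0// ltW.
by rewrite le_eqVlt; apply/orP; left; apply/eqP; ring.
Qed.

(** The integral is split at |x - t| = d. Near x, the increment of [v] is small by continuity and
    the kernel has mass 2 pi; far from x, the kernel is at most [e] times a multiple of 1 / (1 +
    t^2), so that part vanishes with [e] even if [v] is unbounded. *)
Lemma poisson_approx (v : R -> R) (x : R) : continuous v ->
  integr (fun t => `|v t| / (1 + t ^+ 2)) ->
  forall eta, 0 < eta -> exists2 e0, 0 < e0 & forall e, 0 < e -> e < e0 ->
  `|\int[mu]_t (v t * poisson e (x - t)) - 2 * pi * v x| <= eta.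
Proof.
move=> cv iv eta eta0.
have mv : measurable_fun setT v by exact: continuous_measurable_fun.
have pi0 : 0 < 2 * pi :> R by rewrite mulr_gt0 ?pi_gt0.
pose eta' := eta / 2 / (2 * pi).
have eta'0 : 0 < eta' by rewrite !divr_gt0.
have /cvgrPdist_lt/(_ _ eta'0) := cv x.
case => d /= d0 dv.
pose K := 2 + (1 + 2 * x ^+ 2) / d ^+ 2.
have i1 : integr (fun t => (1 + t ^+ 2)^-1 : R).
  have [+ _] := @integral_poisson 1 ltr01 => /(integrZ 2^-1); apply: eq_integr => t.
  rewrite /poisson; field; rewrite gt_eqF// ltr_pwDl ?sqr_ge0//.
(* [e * g t] dominates the far part: |v t - v x| is at most |v t| + |v x|, and the kernel at most
   [e * (4 * K / (1 + t ^+ 2))]. *)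
pose g t := 4 * K * (`|v t| / (1 + t ^+ 2)) + 4 * K * `|v x| * (1 + t ^+ 2)^-1.
have ig : integr g by apply: integrD; exact: integrZ.
have K0 : 0 <= K.
  rewrite addr_ge0// divr_ge0 ?sqr_ge0//; have := sqr_ge0 x; lra.
have g0 t : 0 <= g t.
  have ct0 : 0 <= (1 + t ^+ 2)^-1 by rewrite invr_ge0 addr_ge0 ?sqr_ge0.
  by rewrite /g addr_ge0// !mulr_ge0.
pose B := \int[mu]_t g t.
have B0 : 0 <= B by exact: Rintegral_ge0.
exists (eta / 2 / (B + 1)); first by rewrite !divr_gt0// ltr_pwDr.
move=> e e0 eB; have [ip E] := integral_poisson_shift x e0.
have ivp := integr_mul_poisson x e0 mv iv.
have ivd : integr (fun t => (v t - v x) * poisson e (x - t)).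
  by apply: eq_integr (integrB ivp (integrZ (v x) ip)) => t; ring.
rewrite (_ : _ - _ = \int[mu]_t ((v t - v x) * poisson e (x - t))); last first.
  rewrite -E mulrC -RintegralZl// -RintegralB//; last exact: integrZ.
  by apply: eq_Rintegral => t _; ring.
apply: (le_trans (le_normr_Rintegral _ _)) => //.
apply: (@le_trans _ _ (\int[mu]_t (eta' * poisson e (x - t) + e * g t))).
  apply: le_Rintegral => //.
  - exact: integrable_norm.
  - by apply: integrD; exact: integrZ.
  move=> t _; rewrite normrM (ger0_norm (poisson_ge0 _ e0)).
  have [xt|xt] := ltP `|x - t| d.
    apply: (@le_trans _ _ (eta' * poisson e (x - t))).
      apply: ler_wpM2r; first exact: poisson_ge0.
      by rewrite distrC; apply/ltW/dv.
    by rewrite lerDl mulr_ge0// ltW.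
  apply: (@le_trans _ _ (e * g t)); last first.
    by rewrite lerDr mulr_ge0 ?poisson_ge0// ltW.
  have hK := poisson_decay x t d0; rewrite -/K in hK.
  have d2 : d ^+ 2 <= (x - t) ^+ 2.
    by rewrite -[leRHS]real_normK ?num_real// ler_pXn2r// nnegrE// ltW.
  have d20 : 0 < d ^+ 2 by rewrite exprn_gt0.
  (* The 4: as d^2 <= (x - t)^2, the sum d^2 + (x - t)^2 is at most twice e^2 + (x - t)^2, whatever
     [e] is. *)
  have pb : poisson e (x - t) <= e * (4 * K / (1 + t ^+ 2)).
    apply: (@le_trans _ _ (4 * e * (d ^+ 2 + (x - t) ^+ 2)^-1)); last first.
      by rewrite -!mulrA mulrCA; do 2 (apply: ler_wpM2l; first by rewrite ?ltW).
    rewrite /poisson ler_pdivrMr; last by rewrite ltr_pwDl ?exprn_gt0 ?sqr_ge0.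
    rewrite mulrAC ler_pdivlMr; last by rewrite ltr_pwDl ?sqr_ge0.
    have e2 := sqr_ge0 e.
    have : 0 <= e * (4 * (e ^+ 2 + (x - t) ^+ 2) - 2 * (d ^+ 2 + (x - t) ^+ 2)).
      by rewrite mulr_ge0 ?(ltW e0)//; lra.
    lra.
  apply: (@le_trans _ _ ((`|v t| + `|v x|) * (e * (4 * K / (1 + t ^+ 2))))).
    apply: ler_pM => //; first exact: poisson_ge0.
    by rewrite -[`|v x|]normrN ler_normD.
  by rewrite /g le_eqVlt; apply/orP; left; apply/eqP; ring.
rewrite RintegralD//; try exact: integrZ.
rewrite (RintegralZl eta' measurableT ip) (RintegralZl e measurableT ig) E -/B.
have -> : eta' * (2 * pi) = eta / 2 by rewrite /eta' divfK// gt_eqF.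
have : e * B <= eta / 2.
  apply: (@le_trans _ _ (eta / 2 / (B + 1) * B)).
    by apply: ler_wpM2r => //; exact: ltW.
  rewrite -mulrA ler_piMr ?divr_ge0 ?ltW// mulrC ltr_pdivrMr ?ltr_pwDr//; lra.
lra.
Qed.

End lebesgue.

(** * Fubini, dominated convergence and Fatou for real integrands *)

Section realint.
Context {R : realType}.
Local Notation mu := (@lebesgue_measure R).

(** Everything is dominated by |a(x) b(y)|. Two integrable factors and a kernel bounded by 1 is the
    shape of the oscillating integrals whose order is exchanged later. *)
Lemma prod_integrable (a b : R -> R) (K : R * R -> R) : integr a -> integr b ->
  measurable_fun setT K -> (forall z, `|K z| <= 1) ->
  [/\ (mu \x mu)%E.-integrable setT (EFin \o (fun z => a z.1 * b z.2 * K z)),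
      forall x, integr (fun y => a x * b y * K (x, y)) &
      forall y, integr (fun x => a x * b y * K (x, y))].
Proof.
move=> ia ib mK K1; pose f (z : R * R) := a z.1 * b z.2 * K z.
have ma := integr_meas ia; have mb := integr_meas ib.
have mf : measurable_fun setT f.
  apply: measurable_funM => //; apply: measurable_funM.
    exact: (measurableT_comp ma measurable_fst).
  exact: (measurableT_comp mb measurable_snd).
have fE x y : `|f (x, y)| <= `|a x| * `|b y|.
  by rewrite /f /= !normrM ler_piMr ?mulr_ge0.
have iy x : integr (fun y => f (x, y)).
  apply: (@integr_le _ _ (fun y => `|a x| * `|b y|)).
  - by apply: (measurableT_comp mf); exact: pair1_measurable.
  - exact: fE.
  - by apply: integrZ; exact: integrable_norm.
have ix y : integr (fun x => f (x, y)).
  apply: (@integr_le _ _ (fun x => `|b y| * `|a x|)).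
  - by apply: (measurableT_comp mf); exact: pair2_measurable.
  - by move=> x; rewrite mulrC; exact: fE.
  - by apply: integrZ; exact: integrable_norm.
have intf : (mu \x mu)%E.-integrable setT (EFin \o f).
  apply/integrable12ltyP; first exact/measurable_EFinP.
  apply: (@le_lt_trans _ _ (\int[mu]_x (`|a x| * \int[mu]_y `|b y|)%:E)%E).
    apply: ge0_le_integral => //.
    - by move=> x _; apply: integral_ge0.
    - have H : measurable_fun setT (fubini_F mu (fun z => (`|f z|)%:E)).
        apply: measurable_fun_fubini_tonelli_F => //.
        by apply/measurable_EFinP; exact: measurableT_comp.
      exact H.
    - by apply/measurable_EFinP; apply: measurable_funM => //; exact: measurableT_comp.
    move=> x _; have ibn : integr (fun y => `|b y|) by exact: integrable_norm.
    rewrite -RintegralZl// -integral_EFin; last exact: integrZ.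
    apply: ge0_le_integral => //.
    - by apply/measurable_EFinP/measurableT_comp => //; exact: integr_meas (iy x).
    - by apply/measurable_EFinP; apply: measurable_funM => //; exact: measurableT_comp.
    - by move=> y _ /=; rewrite lee_fin.
  rewrite integral_EFin ?ltry//.
  have ian : integr (fun y => `|a y|) by exact: integrable_norm.
  by apply: eq_integr (integrZ (\int[mu]_y `|b y|) ian) => x; rewrite mulrC.
by split.
Qed.

Lemma fubini_real (a b : R -> R) (K : R * R -> R) : integr a -> integr b ->
  measurable_fun setT K -> (forall z, `|K z| <= 1) ->
  \int[mu]_x (\int[mu]_y (a x * b y * K (x, y))) =
  \int[mu]_y (\int[mu]_x (a x * b y * K (x, y))).
Proof.
move=> ia ib mK K1; have [intf iy ix] := prod_integrable ia ib mK K1.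
congr fine; transitivity (\int[mu]_x \int[mu]_y (a x * b y * K (x, y))%R%:E)%E.
  by apply: eq_integral => x _; rewrite integral_EFin.
have F := Fubini intf; rewrite /= in F; rewrite F; apply: eq_integral => y _.
by rewrite integral_EFin.
Qed.

Lemma integr_fubini (a b : R -> R) (K : R * R -> R) : integr a -> integr b ->
  measurable_fun setT K -> (forall z, `|K z| <= 1) ->
  integr (fun x => \int[mu]_y (a x * b y * K (x, y))).
Proof.
move=> ia ib mK K1; have [intf iy ix] := prod_integrable ia ib mK K1.
rewrite /integr (_ : EFin \o _ = fubini_F mu
  (EFin \o (fun z : R * R => (a z.1 * b z.2 * K z)%R))); first exact: integrable_fubini_F.
by apply/funext => x /=; rewrite -integral_EFin.
Qed.

Lemma DCT_real (u : nat -> R -> R) (v g : R -> R) :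
  (forall n, measurable_fun setT (u n)) -> measurable_fun setT v ->
  {ae mu, forall x, u n x @[n --> \oo] --> v x} ->
  (forall n x, `|u n x| <= g x) -> integr g ->
  integr v /\ \int[mu]_x u n x @[n --> \oo] --> \int[mu]_x v x.
Proof.
move=> mun mv uv ug ig.
have [] := @dominated_convergence _ _ _ mu setT measurableT
  (fun n => EFin \o u n) (EFin \o v) (EFin \o g).
- by move=> n; apply/measurable_EFinP; exact: mun.
- exact/measurable_EFinP.
- move: uv; apply: filterS; first exact: (ae_filter_ringOfSetsType mu).
  move=> x ux _.
  by apply: cvg_EFin => //; exact: nearW.
- exact: ig.
- by apply: nearW => x n _; rewrite lee_fin.
move=> iv _ h; split=> //; apply: (@fine_cvg _ _ _ _ (fun n => \int[mu]_x (u n x)%:E)%E).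
by rewrite -integral_EFin.
Qed.

(** The bound stays in the extended reals because the limit is not yet known to be integrable. *)
Lemma fatou_real (u : nat -> R -> R) (v : R -> R) (B : R) :
  (forall n, measurable_fun setT (u n)) -> (forall n x, 0 <= u n x) ->
  (forall x, u n x @[n --> \oo] --> v x) ->
  (forall n, (\int[mu]_x (u n x)%:E <= B%:E)%E) ->
  (\int[mu]_x (v x)%:E <= B%:E)%E.
Proof.
move=> mun u0 uv uB.
have mE n : measurable_fun setT (EFin \o u n) by exact/measurable_EFinP.
have E0 n x : [set: R] x -> (0 <= (EFin \o u n) x)%E by move=> _; rewrite lee_fin.
have := @fatou _ _ _ mu setT measurableT _ mE E0.
rewrite [X in (X <= _)%E -> _](_ : _ = \int[mu]_x (v x)%:E)%E; last first.
  apply: eq_integral => x _.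
  have h : (fun n => (u n x)%:E) @ \oo --> (v x)%:E.
    by apply: cvg_EFin; [exact: nearW|exact: uv].
  exact: (cvg_limn_einf_sup h).1.
move=> /le_trans; apply; rewrite limn_einf_lim.
apply: lime_le; first exact: is_cvg_einfs.
apply: nearW => n; apply: (le_trans _ (uB n)).
by apply: ereal_inf_lbound; exists n => //=.
Qed.
End realint.

(** * Plancherel inequality and Fourier inversion *)

Section plancherel.
Context {R : realType}.
Local Notation mu := (@lebesgue_measure R).

Lemma integr_bounded (f K : R -> R) : integr f -> measurable_fun setT K ->
  (forall x, `|K x| <= 1) -> integr (fun x => f x * K x).
Proof.
move=> hf mK K1; apply: (@integr_le _ _ (fun x => `|f x|)).
- by apply: measurable_funM => //; exact: integr_meas.
- by move=> x; rewrite normrM ler_piMr.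
- exact: integrable_norm.
Qed.

Lemma continuous_mulr (T : R -> R) (k : R) : continuous T ->
  continuous (fun x : R => T (k * x)).
Proof.
move=> cT x; apply: continuous_comp; last exact: cT.
by apply: cvgM; [exact: cvg_cst|exact: cvg_id].
Qed.

Lemma continuous_mull (T : R -> R) (k : R) : continuous T ->
  continuous (fun x : R => T (x * k)).
Proof.
move=> cT x; apply: continuous_comp; last exact: cT.
by apply: cvgM; [exact: cvg_id|exact: cvg_cst].
Qed.

(** Dominated convergence with majorant |h|; continuity is tested along sequences, the setting of
    that theorem. *)
Lemma continuous_transform (h T : R -> R) : integr h -> continuous T ->
  (forall x, `|T x| <= 1) -> continuous (fun t : R => \int[mu]_x (h x * T (t * x))).
Proof.
move=> ih cT T1 a; apply/(@cvg_nbhsP _ R^o) => w wa.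
have mh := integr_meas ih.
have mT k : measurable_fun setT (fun x : R => T (k * x)).
  by apply: continuous_measurable_fun; exact: continuous_mulr.
apply: (@DCT_real _ (fun n x => h x * T (w n * x)) (fun x => h x * T (a * x))
   (fun x => `|h x|) _ _ _ _ _).2.
- by move=> n; exact: measurable_funM.
- exact: measurable_funM.
- apply: nearW => x; apply: cvgM; first exact: cvg_cst.
  apply: (@cvg_comp _ _ _ (fun n => w n * x) T _ (nbhs (a * x))); last exact: cT.
  by apply: cvgM => //; exact: cvg_cst.
- by move=> n x; rewrite normrM ler_piMr.
- exact: integrable_norm.
Qed.

Lemma transform_le (h T : R -> R) t : integr h -> continuous T ->
  (forall x, `|T x| <= 1) ->
  `|\int[mu]_x (h x * T (t * x))| <= \int[mu]_x `|h x|.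
Proof.
move=> ih cT T1.
have i : integr (fun x => h x * T (t * x)).
  apply: integr_bounded => //; apply: continuous_measurable_fun; exact: continuous_mulr.
apply: (le_trans (le_normr_Rintegral _ i)) => //; apply: le_Rintegral => //.
- exact: integrable_norm.
- exact: integrable_norm.
- by move=> x _; rewrite normrM ler_piMr.
Qed.

Lemma cvg_lap (t : R) : lap n.+1%:R^-1 t @[n --> \oo] --> (1 : R).
Proof.
have h : - (n.+1%:R^-1 * `|t|) @[n --> \oo] --> - (0 * `|t|).
  by apply: cvgN; apply: cvgM; [exact: cvg_harmonic|exact: cvg_cst].
have := continuous_cvg _ (@continuous_expR R _) h.
by rewrite mul0r oppr0 expR0 => hh; apply: hh.
Qed.

(* Schur's test: with the weight [lap e], the kernel of the squared transform is
   dominated by Poisson kernels, whose integral does not depend on [e]. *)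
Lemma plancherel_kernel (h T : R -> R) : integr h -> integr (fun x => h x ^+ 2) ->
  continuous T -> (forall x, `|T x| <= 1) ->
  (forall e xi eta, 0 < e -> `|\int[mu]_t (lap e t * (T (t * xi) * T (t * eta)))| <=
     (poisson e (xi - eta) + poisson e (xi + eta)) / 2) ->
  (\int[mu]_t ((\int[mu]_x (h x * T (t * x))) ^+ 2)%:E <=
    (2 * pi * \int[mu]_x (h x ^+ 2))%:E)%E.
Proof.
move=> ih ih2 cT T1 kT.
have mh := integr_meas ih; have mh2 := integr_meas ih2.
pose C t := \int[mu]_x (h x * T (t * x)).
have cC : continuous C by exact: continuous_transform.
have mC : measurable_fun setT C by exact: continuous_measurable_fun.
have mT k : measurable_fun setT (fun x : R => T (x * k)).
  by apply: continuous_measurable_fun; exact: continuous_mull.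
have mT2 : measurable_fun setT (fun z : R * R => T (z.1 * z.2)).
  apply: (measurableT_comp (continuous_measurable_fun cT)).
  by apply: measurable_funM; [exact: measurable_fst|exact: measurable_snd].
have md e : measurable_fun setT (lap e : R -> R).
  by apply: continuous_measurable_fun; exact: continuous_lap.
pose B := \int[mu]_x `|h x|.
have CB t : `|C t| <= B by exact: transform_le.
have ihT t : integr (fun x => h x * T (t * x)).
  apply: integr_bounded ih _ (fun x => T1 _).
  by apply: continuous_measurable_fun; exact: continuous_mulr.
have idC e : 0 < e -> integr (fun t => lap e t * C t).
  move=> e0; apply: (@integr_le _ _ (fun t => B * lap e t)).
  - exact: measurable_funM.
  - by move=> t; rewrite normrM mulrC (ger0_norm (lap_ge0 _ _)) ler_wpM2r ?lap_ge0.
  - by apply: integrZ; exact: integr_lap.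
(* For T = cos the kernel equals [Q e]; for T = sin it is half the difference of the same two
   Poisson terms, hence dominated. [Q e] is nonnegative, symmetric and of mass 2 pi in each
   variable. *)
pose Q e xi eta := (poisson e (xi - eta) + poisson e (xi + eta)) / 2 : R.
have Q0 e xi eta : 0 < e -> 0 <= Q e xi eta.
  by move=> e0; rewrite divr_ge0// addr_ge0// poisson_ge0.
have QC e xi eta : Q e xi eta = Q e eta xi.
  by rewrite /Q -poissonN opprB (addrC xi eta).
have iQ e xi : 0 < e -> integr (Q e xi) /\ \int[mu]_x Q e xi x = 2 * pi.
  move=> e0; have [i1 E1] := integral_poisson_shift xi e0.
  have [i2 E2] := integral_poisson_shift (- xi) e0.
  have QE : (fun y => 2^-1 * (poisson e (xi - y) + poisson e (- xi - y))) = Q e xi.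
    by apply/funext => y; rewrite /Q mulrC -[poisson e (- xi - y)]poissonN opprD !opprK.
  rewrite -QE; split; first by apply: integrZ; exact: integrD.
  rewrite (RintegralZl _ measurableT (integrD i1 i2)) (RintegralD measurableT i1 i2).
  by rewrite E1 E2; field.
(* The inequality under the weight [lap e]. Its bound does not depend on [e], so Fatou removes the
   weight at the end. *)
have D_e e : 0 < e -> (\int[mu]_t (lap e t * C t ^+ 2)%:E <=
    (2 * pi * \int[mu]_x (h x ^+ 2))%:E)%E.
  move=> e0; have id := integr_lap e0.
  pose k xi eta := \int[mu]_t (lap e t * (T (t * xi) * T (t * eta))).
  (* [D] is the transform of the weighted transform of [h]; Fubini makes the weighted square
     integral of [C] the pairing of [h] with [D]. *)
  pose D xi := \int[mu]_eta (h eta * k xi eta).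
  have DE xi : \int[mu]_t (lap e t * C t * T (t * xi)) = D xi.
    have mK : measurable_fun setT (fun z : R * R => T (z.1 * xi) * T (z.1 * z.2)).
      apply: measurable_funM => //.
      by apply: (measurableT_comp (mT xi)); exact: measurable_fst.
    have K1 (z : R * R) : `|T (z.1 * xi) * T (z.1 * z.2)| <= 1.
      by rewrite normrM mulr_ile1.
    have F := fubini_real id ih mK K1.
    transitivity (\int[mu]_t \int[mu]_eta
        (lap e t * h eta * (T (t * xi) * T (t * eta)))).
      apply: eq_Rintegral => t _.
      rewrite mulrAC -(RintegralZl _ measurableT (ihT t)).
      by apply: eq_Rintegral => eta _; ring.
    rewrite F.
    have ikT eta : integr (fun t => lap e t * (T (t * xi) * T (t * eta))).
      apply: integr_bounded id _ _; first exact: measurable_funM (mT xi) (mT eta).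
      by move=> t; rewrite normrM mulr_ile1.
    apply: eq_Rintegral => eta _; rewrite /k -(RintegralZl _ measurableT (ikT eta)).
    by apply: eq_Rintegral => t _; ring.
  have E1 : \int[mu]_t (lap e t * C t ^+ 2) = \int[mu]_xi (h xi * D xi).
    have := fubini_real (idC e e0) ih mT2 (fun z => T1 _).
    move=> F; transitivity (\int[mu]_t \int[mu]_xi (lap e t * C t * h xi * T (t * xi))).
      apply: eq_Rintegral => t _.
      rewrite expr2 mulrA {2}/C -(RintegralZl _ measurableT (ihT t)).
      by apply: eq_Rintegral => xi _; ring.
    have idCT xi : integr (fun t => lap e t * C t * T (t * xi)).
      exact: integr_bounded (idC e e0) (mT xi) (fun t => T1 _).
    rewrite F; apply: eq_Rintegral => xi _; rewrite -DE -(RintegralZl _ measurableT (idCT xi)).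
    by apply: eq_Rintegral => t _; ring.
  have idC2 : integr (fun t => lap e t * C t ^+ 2).
    apply: (@integr_le _ _ (fun t => B * `|lap e t * C t|)).
    - by apply: measurable_funM => //; exact: measurable_funX.
    - move=> t; rewrite expr2 mulrA normrM mulrC; exact: ler_wpM2r.
    - by apply: integrZ; exact: integrable_norm (idC e e0).
  rewrite integral_EFin// E1 lee_fin.
  have mQ : measurable_fun setT (fun z : R * R => Q e z.1 z.2).
    have mp : measurable_fun setT (poisson e : R -> R).
      by apply: continuous_measurable_fun; exact: continuous_poisson.
    apply: measurable_funM => //; apply: measurable_funD.
      apply: (measurableT_comp mp); apply: measurable_funB.
        exact: measurable_fst.
      exact: measurable_snd.
    apply: (measurableT_comp mp); apply: measurable_funD.
      exact: measurable_fst.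
    exact: measurable_snd.
  have T1' : (\int[mu]_x \int[mu]_y (h x ^+ 2 * Q e x y)%:E =
     (2 * pi * \int[mu]_x (h x ^+ 2))%:E)%E.
    rewrite -RintegralZl// -integral_EFin; last exact: integrZ.
    apply: eq_integral => x _; have [i E] := iQ e x e0.
    rewrite integral_EFin; last exact: integrZ.
    by rewrite (RintegralZl _ measurableT i) E mulrC.
  have mG : measurable_fun setT (fun z : R * R => h z.1 ^+ 2 * Q e z.1 z.2).
    apply: measurable_funM => //.
    by apply: (measurableT_comp mh2); exact: measurable_fst.
  have mG' : measurable_fun setT (fun z : R * R => h z.2 ^+ 2 * Q e z.1 z.2).
    apply: measurable_funM => //.
    by apply: (measurableT_comp mh2); exact: measurable_snd.
  have mG1 x : measurable_fun setT (fun y : R => h x ^+ 2 * Q e x y).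
    exact: (measurableT_comp mG (pair1_measurable x)).
  have mG1' x : measurable_fun setT (fun y : R => h y ^+ 2 * Q e x y).
    exact: (measurableT_comp mG' (pair1_measurable x)).
  have T2' : (\int[mu]_x \int[mu]_y (h y ^+ 2 * Q e x y)%:E =
     (2 * pi * \int[mu]_x (h x ^+ 2))%:E)%E.
    rewrite -T1'.
    rewrite (@fubini_tonelli _ _ _ _ _ mu mu (fun z : R * R => (h z.2 ^+ 2 * Q e z.1 z.2)%:E)).
    - by apply: eq_integral => x _; apply: eq_integral => y _ /=; rewrite QC.
    - exact/measurable_EFinP.
    - by move=> z; rewrite lee_fin mulr_ge0 ?sqr_ge0 ?Q0.
  (* By AM-GM, [W] dominates |h(x) h(y)| Q(x, y). Each half integrates to pi times the integral of
     [h ^+ 2]: the first by the mass of [Q e x], the second by exchanging the variables. *)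
  pose W x y := 2^-1 * (h x ^+ 2 * Q e x y) + 2^-1 * (h y ^+ 2 * Q e x y).
  have W0 x y : 0 <= W x y.
    by rewrite addr_ge0// mulr_ge0// mulr_ge0 ?sqr_ge0 ?Q0.
  have TW : (\int[mu]_x \int[mu]_y (W x y)%:E =
     (2 * pi * \int[mu]_x (h x ^+ 2))%:E)%E.
    pose G x := (\int[mu]_y (h x ^+ 2 * Q e x y)%:E)%E.
    pose G' x := (\int[mu]_y (h y ^+ 2 * Q e x y)%:E)%E.
    have mGF : measurable_fun setT G.
      by apply: (@measurable_fun_fubini_tonelli_F _ _ _ _ _ mu
        (fun z : R * R => (h z.1 ^+ 2 * Q e z.1 z.2)%:E)) => [|z];
        [exact/measurable_EFinP|rewrite lee_fin mulr_ge0 ?sqr_ge0 ?Q0].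
    have mGF' : measurable_fun setT G'.
      by apply: (@measurable_fun_fubini_tonelli_F _ _ _ _ _ mu
        (fun z : R * R => (h z.2 ^+ 2 * Q e z.1 z.2)%:E)) => [|z];
        [exact/measurable_EFinP|rewrite lee_fin mulr_ge0 ?sqr_ge0 ?Q0].
    have G0 x : (0 <= G x)%E.
      by apply: integral_ge0 => y _; rewrite lee_fin mulr_ge0 ?sqr_ge0 ?Q0.
    have G'0 x : (0 <= G' x)%E.
      by apply: integral_ge0 => y _; rewrite lee_fin mulr_ge0 ?sqr_ge0 ?Q0.
    transitivity (\int[mu]_x (2^-1%:E * G x + 2^-1%:E * G' x))%E.
      apply: eq_integral => x _; rewrite /G /G' -!ge0_integralZl_EFin//.
      + rewrite -ge0_integralD//.
        * by move=> y _; rewrite lee_fin mulr_ge0// mulr_ge0 ?sqr_ge0 ?Q0.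
        * by apply/measurable_EFinP; apply: measurable_funM => //; exact: mG1.
        * by move=> y _; rewrite lee_fin mulr_ge0// mulr_ge0 ?sqr_ge0 ?Q0.
        * by apply/measurable_EFinP; apply: measurable_funM => //; exact: mG1'.
      + by move=> y _; rewrite lee_fin mulr_ge0 ?sqr_ge0 ?Q0.
      + by apply/measurable_EFinP; exact: mG1'.
      + by move=> y _; rewrite lee_fin mulr_ge0 ?sqr_ge0 ?Q0.
      + by apply/measurable_EFinP; exact: mG1.
    rewrite ge0_integralD//.
    - rewrite !ge0_integralZl_EFin// T1' T2' -!EFinM -EFinD; congr (_%:E).
      by field.
    - by move=> x _; rewrite mule_ge0.
    - exact: measurable_funeM.
    - by move=> x _; rewrite mule_ge0.
    - exact: measurable_funeM.
  have hD x : (`|h x * D x|%:E <= \int[mu]_y (W x y)%:E)%E.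
    have [i E] := iQ e x e0.
    have ck : continuous (k x).
      have -> : k x = fun eta => \int[mu]_t (lap e t * T (t * x) * T (eta * t)).
        by apply/funext => eta; apply: eq_Rintegral => t _; rewrite (mulrC eta); ring.
      apply: continuous_transform => //.
      by apply: integr_bounded.
    have kQ y : `|k x y| <= Q e x y by exact: kT.
    have ihk : integr (fun y => h x * (h y * k x y)).
      apply: integrZ; apply: (@integr_le _ _ (fun y => (\int[mu]_t `|lap e t * T (t * x)|) * `|h y|)).
      - by apply: measurable_funM => //; exact: continuous_measurable_fun.
      - move=> y; rewrite normrM mulrC; apply: ler_wpM2r => //.
        have -> : k x y = \int[mu]_t (lap e t * T (t * x) * T (y * t)).
          by apply: eq_Rintegral => t _; rewrite (mulrC y); ring.
        by apply: transform_le => //; exact: integr_bounded.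
      - by apply: integrZ; exact: integrable_norm ih.
    have -> : h x * D x = \int[mu]_y (h x * (h y * k x y)).
      rewrite RintegralZl//; apply: (@integr_le _ _ (fun y => (\int[mu]_t `|lap e t * T (t * x)|) * `|h y|)).
      - by apply: measurable_funM => //; exact: continuous_measurable_fun.
      - move=> y; rewrite normrM mulrC; apply: ler_wpM2r => //.
        have -> : k x y = \int[mu]_t (lap e t * T (t * x) * T (y * t)).
          by apply: eq_Rintegral => t _; rewrite (mulrC y); ring.
        by apply: transform_le => //; exact: integr_bounded.
      - by apply: integrZ; exact: integrable_norm ih.
    rewrite EFin_normr_Rintegral//.
    apply: (le_trans (le_abse_integral _ _ _)) => //.
      by apply/measurable_EFinP; exact: integr_meas ihk.
    apply: ge0_le_integral => //.
    - by apply/measurable_EFinP/measurableT_comp => //; exact: integr_meas ihk.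
    - apply/measurable_EFinP; apply: measurable_funD.
        by apply: measurable_funM => //; exact: mG1.
      by apply: measurable_funM => //; exact: mG1'.
    move=> y _ /=; rewrite lee_fin /W !normrM.
    have := kQ y; have := Q0 e x y e0; have := normr_ge0 (h x); have := normr_ge0 (h y).
    rewrite -[h x ^+ 2]real_normK ?num_real// -[h y ^+ 2]real_normK ?num_real//.
    move: `|h x| `|h y| `|k x y| (Q e x y) => a b c q b0 a0 q0 cq.
    have : a * (b * c) <= a * (b * q) by do 2 apply: ler_wpM2l => //.
    have : 0 <= (a - b) ^+ 2 * q by rewrite mulr_ge0 ?sqr_ge0.
    lra.
  have ihD : integr (fun x => h x * D x).
    apply: (@integr_le _ _ (fun x => (\int[mu]_t `|lap e t * C t|) * `|h x|)).
    - apply: measurable_funM => //; apply: continuous_measurable_fun.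
      have -> : D = fun xi => \int[mu]_t (lap e t * C t * T (xi * t)).
        by apply/funext => xi; rewrite -DE; apply: eq_Rintegral => t _; rewrite (mulrC xi).
      by apply: continuous_transform => //; exact: idC.
    - move=> x; rewrite normrM mulrC; apply: ler_wpM2r => //.
      have -> : D x = \int[mu]_t (lap e t * C t * T (x * t)).
        by rewrite -DE; apply: eq_Rintegral => t _; rewrite (mulrC x).
      by apply: transform_le => //; exact: idC.
    - by apply: integrZ; exact: integrable_norm ih.
  have mGW : measurable_fun setT (fun x => \int[mu]_y (W x y)%:E)%E.
    apply: (@measurable_fun_fubini_tonelli_F _ _ _ _ _ mu
        (fun z : R * R => (W z.1 z.2)%:E)) => [|z]; last by rewrite lee_fin.
    by apply/measurable_EFinP; apply: measurable_funD; apply: measurable_funM.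
  rewrite -lee_fin -TW; apply: (@le_trans _ _ (\int[mu]_x `|h x * D x|%:E)%E).
    rewrite -integral_EFin//; apply: le_integral => //.
      by apply: integrable_norm ihD.
    by move=> x _; rewrite lee_fin ler_norm.
  apply: ge0_le_integral => //.
  by apply/measurable_EFinP; apply: measurableT_comp => //; exact: integr_meas ihD.
apply: (@fatou_real _ (fun n t => lap n.+1%:R^-1 t * C t ^+ 2)).
- by move=> n; apply: measurable_funM => //; exact: measurable_funX.
- by move=> n t; rewrite mulr_ge0 ?lap_ge0 ?sqr_ge0.
- move=> t; rewrite -[X in _ --> X]mul1r; apply: cvgM; last exact: cvg_cst.
  exact: cvg_lap.
- by move=> n; apply: D_e; rewrite invr_gt0.
Qed.
End plancherel.

(** * Inversion by Abel means *)

Section fourier.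
Context {R : realType}.
Local Notation mu := (@lebesgue_measure R).
Implicit Types (h H g G : R -> R[i]) (z w : R[i]).

(** [dotc] conjugates its second argument, so integrating the pairing of g(xi) with [wave w t xi]
    gives, up to [fourier_cst], the inverse transform of g at t paired with [w]. *)
Definition wave z (s xi : R) : R[i] := z * expi (- (s * xi)).

Definition fourier_cst : R := (Num.sqrt (2 * pi))^-1.

Lemma fourier_cst_gt0 : 0 < fourier_cst.
Proof. by rewrite invr_gt0 sqrtr_gt0 mulr_gt0 ?pi_gt0. Qed.

Lemma fourier_cst_sqr : fourier_cst * fourier_cst * (2 * pi) = 1.
Proof.
have p0 : 0 < 2 * pi :> R by rewrite mulr_gt0 ?pi_gt0.
have := sqr_sqrtr (ltW p0); rewrite /fourier_cst; set s := Num.sqrt _ => <-.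
by field; rewrite gt_eqF// sqrtr_gt0.
Qed.

Lemma L1_measc h : L1 h -> measc h.
Proof. by move=> [h1 h2]; split; apply: integr_meas. Qed.

Lemma L1_dot h w : L1 h -> integr (fun t => dotc (h t) w).
Proof.
move=> [h1 h2]; apply: (@eq_integr _ (fun t => complex.Re w * complex.Re (h t)
  + complex.Im w * complex.Im (h t))).
  by move=> t; rewrite /dotc; ring.
by apply: integrD; apply: integrZ.
Qed.

(** The factor -i extracts the imaginary part of z times the conjugate of w. A complex oscillating
    integral becomes two real ones with kernels bounded by 1, as the Fubini lemmas require. *)
Lemma dotc_rot z w (a b : R) : dotc (z * expi a) (w * expi b) =
  dotc z w * cos (b - a) + dotc ((0 +i* -1) * z) w * sin (b - a).
Proof. by rewrite /dotc cosB sinB !cReE /=; ring. Qed.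

Lemma dotc_expiN z w (a : R) : dotc z (w * expi (- a)) = dotc (z * expi a) w.
Proof. by rewrite /dotc !cReE /= cosN sinN; ring. Qed.

Lemma measc_expi (k : R) : measc (fun t => expi (k * t)).
Proof.
by split; apply: continuous_measurable_fun; apply: continuous_mulr;
  [exact: continuous_cos|exact: continuous_sin].
Qed.

Lemma abs_cos_le1 (t : R) : `|cos t| <= 1.
Proof. by rewrite ler_norml cos_geN1 cos_le1. Qed.

Lemma abs_sin_le1 (t : R) : `|sin t| <= 1.
Proof. by rewrite ler_norml sin_geN1 sin_le1. Qed.

Lemma L1_expi h (k : R) : L1 h -> L1 (fun t => h t * expi (k * t)).
Proof.
move=> [h1 h2].
have [mc ms] := measc_expi k.
split.
  apply: (@eq_integr _ (fun t => complex.Re (h t) * cos (k * t)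
     - complex.Im (h t) * sin (k * t))); first by move=> t /=; rewrite cReM.
  by apply: integrB; apply: integr_bounded => // t; [exact: abs_cos_le1|exact: abs_sin_le1].
apply: (@eq_integr _ (fun t => complex.Re (h t) * sin (k * t)
   + complex.Im (h t) * cos (k * t))); first by move=> t /=; rewrite cImM.
by apply: integrD; apply: integr_bounded => // t; [exact: abs_sin_le1|exact: abs_cos_le1].
Qed.

Lemma dot_cintegral h w : L1 h ->
  dotc (cintegral setT h) w = \int[mu]_t dotc (h t) w.
Proof.
move=> [h1 h2]; transitivity (\int[mu]_t (complex.Re w * complex.Re (h t)
  + complex.Im w * complex.Im (h t))); last first.
  by apply: eq_Rintegral => t _; rewrite /dotc; ring.
rewrite (RintegralD measurableT (integrZ _ h1) (integrZ _ h2)).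
rewrite (RintegralZl _ measurableT h1) (RintegralZl _ measurableT h2).
by rewrite /dotc /=; ring.
Qed.

Lemma L1_expiN h (k : R) : L1 h -> L1 (fun t => h t * expi (- (t * k))).
Proof.
move=> /(L1_expi (- k)); congr L1; apply/funext => t; congr (_ * expi _); ring.
Qed.

Lemma fourier_dot h xi w : L1 h ->
  dotc (fourier h xi) w = fourier_cst * \int[mu]_t dotc (h t * expi (- (t * xi))) w.
Proof. by move=> ih; rewrite /fourier dotcZl dot_cintegral//; exact: L1_expiN. Qed.

Lemma L1_iM h : L1 h -> L1 (fun t => (0 +i* -1) * h t).
Proof.
move=> [h1 h2]; split.
  by apply: eq_integr h2 => t /=; rewrite cReM /=; ring.
by apply: eq_integr (integrN h1) => t /=; rewrite cImM /=; ring.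
Qed.

(** Abel means of the inversion integral are Poisson integrals: after Fubini, integrating e^(-e
    |xi|) against the cosine of the phase produces the kernel, and the sine part is zero by
    oddness. *)
Lemma fourier_poisson h e x w : L1 h -> 0 < e ->
  ip (lap e) (fourier h) (wave w x) =
  fourier_cst * \int[mu]_t (dotc (h t) w * poisson e (x - t)).
Proof.
move=> ih e0.
pose a t := dotc (h t) w; pose b t := dotc ((0 +i* -1) * h t) w.
have ia : integr a by exact: L1_dot.
have ib : integr b by apply: (L1_dot w (L1_iM ih)).
have id := integr_lap e0.
have mz : measurable_fun setT (fun z : R * R => (z.2 - x) * z.1).
  apply: measurable_funM; last exact: measurable_fst.
  by apply: measurable_funB => //; exact: measurable_snd.
have mc : measurable_fun setT (fun z : R * R => cos ((z.2 - x) * z.1)).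
  by apply: (measurableT_comp (continuous_measurable_fun (@continuous_cos R)) mz).
have ms : measurable_fun setT (fun z : R * R => sin ((z.2 - x) * z.1)).
  by apply: (measurableT_comp (continuous_measurable_fun (@continuous_sin R)) mz).
have c1 (z : R * R) : `|cos ((z.2 - x) * z.1)| <= 1 by exact: abs_cos_le1.
have s1 (z : R * R) : `|sin ((z.2 - x) * z.1)| <= 1 by exact: abs_sin_le1.
have [_ ica ica'] := prod_integrable id ia mc c1.
have [_ isb isb'] := prod_integrable id ib ms s1.
have iFa := integr_fubini id ia mc c1.
have iFb := integr_fubini id ib ms s1.
rewrite /ip.
transitivity (\int[mu]_xi (fourier_cst * (\int[mu]_t (lap e xi * a t * cos ((t - x) * xi))
   + \int[mu]_t (lap e xi * b t * sin ((t - x) * xi))))).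
  apply: eq_Rintegral => xi _; rewrite fourier_dot// mulrCA; congr (_ * _).
  rewrite -(RintegralD measurableT (ica xi) (isb xi)) -RintegralZl//.
    apply: eq_Rintegral => t _; rewrite /wave dotc_rot /a /b.
    have -> : - (x * xi) - - (t * xi) = (t - x) * xi by ring.
    ring.
  exact: L1_dot (L1_expiN xi ih).
rewrite (RintegralZl _ measurableT (integrD iFa iFb)); congr (_ * _).
rewrite (RintegralD measurableT iFa iFb).
rewrite (fubini_real id ia mc c1) (fubini_real id ib ms s1) /=.
rewrite [X in _ + X](_ : _ = 0) ?addr0.
  apply: eq_Rintegral => t _; have [i E] := integral_lap_cos (t - x) e0.
  rewrite -[x - t]opprB poissonN -E -RintegralZl//.
  by apply: eq_Rintegral => xi _; rewrite /a; ring.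
rewrite -[RHS](_ : \int[mu]_t (0 : R) = _); last by rewrite Rintegral_cst ?mul0r.
apply: eq_Rintegral => t _; have [i E] := integral_lap_sin (t - x) e0.
rewrite -[RHS](mulr0 (b t)) -E -RintegralZl//.
by apply: eq_Rintegral => xi _; ring.
Qed.

(** [H] is tied to [h] by its Abel means rather than by an integral formula, so that both [phi],
    which is in L1, and a Paley-Wiener function, whose transform is an L2 limit, are covered. As [e]
    tends to 0, the left side converges by domination and the right side by [poisson_approx]. *)
Lemma inversion h H w x : continuous (fun t => dotc (h t) w) ->
  integr (fun t => `|dotc (h t) w| / (1 + t ^+ 2)) -> L1 H ->
  (forall e, 0 < e -> ip (lap e) H (wave w x) =
     fourier_cst * \int[mu]_t (dotc (h t) w * poisson e (x - t))) ->
  fourier_cst * \int[mu]_xi dotc (H xi) (wave w x xi) = dotc (h x) w.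
Proof.
move=> ch ih iH hH.
have iHe : integr (fun xi => dotc (H xi) (wave w x xi)).
  apply: eq_integr (L1_dot w (L1_expi x iH)) => xi.
  by rewrite /wave dotc_expiN.
have mHe := integr_meas iHe.
have cl : ip (lap n.+1%:R^-1) H (wave w x) @[n --> \oo] -->
    \int[mu]_xi dotc (H xi) (wave w x xi).
  apply: (@DCT_real _ (fun n xi => lap n.+1%:R^-1 xi * dotc (H xi) (wave w x xi)) _
    (fun xi => `|dotc (H xi) (wave w x xi)|) _ mHe _ _ _).2.
  - move=> n; apply: measurable_funM => //.
    by apply: continuous_measurable_fun; exact: continuous_lap.
  - apply: nearW => xi; rewrite -[X in _ --> X]mul1r.
    by apply: cvgM; [exact: cvg_lap|exact: cvg_cst].
  - move=> n xi; rewrite normrM ger0_norm ?lap_ge0// ler_piMl//.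
    by apply: lap_le1; rewrite invr_ge0.
  - exact: integrable_norm iHe.
have cr : ip (lap n.+1%:R^-1) H (wave w x) @[n --> \oo] -->
    fourier_cst * (2 * pi * dotc (h x) w).
  under eq_fun do rewrite hH ?invr_gt0//.
  apply: cvgM; first exact: cvg_cst.
  apply/cvgrPdist_le => eta eta0.
  have [e0 e00 he] := poisson_approx x ch ih eta0.
  have := @cvg_harmonic R; move/cvgrPdist_lt/(_ _ e00); apply: filterS => n.
  rewrite sub0r normrN ger0_norm ?invr_ge0// => hn.
  by rewrite distrC; apply: he => //; rewrite invr_gt0.
rewrite (cvg_unique _ cl cr)//.
transitivity ((fourier_cst * fourier_cst * (2 * pi)) * dotc (h x) w); first by ring.
by rewrite fourier_cst_sqr mul1r.
Qed.

End fourier.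

Section fourier2.
Context {R : realType}.
Local Notation mu := (@lebesgue_measure R).
Implicit Types (h H g G f F : R -> R[i]) (z w : R[i]).

Lemma lap_cos_cos (e xi eta : R) : 0 < e ->
  \int[mu]_t (lap e t * (cos (t * xi) * cos (t * eta))) =
    (poisson e (xi - eta) + poisson e (xi + eta)) / 2.
Proof.
move=> e0; have [i1 E1] := integral_lap_cos (xi - eta) e0.
have [i2 E2] := integral_lap_cos (xi + eta) e0.
rewrite -E1 -E2 mulrC -(RintegralD measurableT i1 i2).
rewrite -(RintegralZl _ measurableT (integrD i1 i2)).
apply: eq_Rintegral => t _; rewrite mulrBl mulrDl cosB cosD (mulrC xi) (mulrC eta).
by field.
Qed.

Lemma lap_sin_sin (e xi eta : R) : 0 < e ->
  \int[mu]_t (lap e t * (sin (t * xi) * sin (t * eta))) =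
    (poisson e (xi - eta) - poisson e (xi + eta)) / 2.
Proof.
move=> e0; have [i1 E1] := integral_lap_cos (xi - eta) e0.
have [i2 E2] := integral_lap_cos (xi + eta) e0.
rewrite -E1 -E2 mulrC -(RintegralB measurableT i1 i2).
rewrite -(RintegralZl _ measurableT (integrB i1 i2)).
apply: eq_Rintegral => t _; rewrite mulrBl mulrDl cosB cosD (mulrC xi) (mulrC eta).
by field.
Qed.

Lemma plancherel_cos (h : R -> R) : integr h -> integr (fun x => h x ^+ 2) ->
  let C t := \int[mu]_x (h x * cos (t * x)) in
  [/\ continuous C, integr (fun t => C t ^+ 2) &
      \int[mu]_t (C t ^+ 2) <= 2 * pi * \int[mu]_x (h x ^+ 2)].
Proof.
move=> ih ih2 C; have cC : continuous C.
  by apply: continuous_transform => //; [exact: continuous_cos|exact: abs_cos_le1].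
have mC2 : measurable_fun setT (fun t => C t ^+ 2).
  by apply: measurable_funX; exact: continuous_measurable_fun.
suff /(ge0_integr mC2 (fun t => sqr_ge0 (C t)))[] : (\int[mu]_t (C t ^+ 2)%:E <=
    (2 * pi * \int[mu]_x (h x ^+ 2))%:E)%E by split.
apply: plancherel_kernel => //; [exact: continuous_cos|exact: abs_cos_le1|].
move=> e xi eta e0; rewrite lap_cos_cos// ger0_norm//.
by rewrite divr_ge0// addr_ge0// poisson_ge0.
Qed.

Lemma plancherel_sin (h : R -> R) : integr h -> integr (fun x => h x ^+ 2) ->
  let C t := \int[mu]_x (h x * sin (t * x)) in
  [/\ continuous C, integr (fun t => C t ^+ 2) &
      \int[mu]_t (C t ^+ 2) <= 2 * pi * \int[mu]_x (h x ^+ 2)].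
Proof.
move=> ih ih2 C; have cC : continuous C.
  by apply: continuous_transform => //; [exact: continuous_sin|exact: abs_sin_le1].
have mC2 : measurable_fun setT (fun t => C t ^+ 2).
  by apply: measurable_funX; exact: continuous_measurable_fun.
suff /(ge0_integr mC2 (fun t => sqr_ge0 (C t)))[] : (\int[mu]_t (C t ^+ 2)%:E <=
    (2 * pi * \int[mu]_x (h x ^+ 2))%:E)%E by split.
apply: plancherel_kernel => //; [exact: continuous_sin|exact: abs_sin_le1|].
move=> e xi eta e0; rewrite lap_sin_sin//.
have := poisson_ge0 (xi - eta) e0; have := poisson_ge0 (xi + eta) e0.
by move=> *; rewrite ler_norml; apply/andP; split; lra.
Qed.

(* The constant is not optimal, but any constant will do. *)
Lemma plancherel G g : L1 G -> integr (fun t => dotc (G t) (G t)) ->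
  (forall t w, dotc (g t) w = fourier_cst * \int[mu]_xi dotc (G xi) (wave w t xi)) ->
  integr (fun t => dotc (g t) (g t)) /\
  \int[mu]_t dotc (g t) (g t) <= 4 * \int[mu]_xi dotc (G xi) (G xi).
Proof.
(* This is (p - q)^2 <= 2 p^2 + 2 q^2 and (r + s)^2 <= 2 r^2 + 2 s^2, for real and imaginary parts
   at once. *)
have alg (k p q r s : R) :
    k * (p - q) * (k * (p - q)) + k * (r + s) * (k * (r + s)) <=
    2 * (k * k) * (p ^+ 2 + q ^+ 2 + (r ^+ 2 + s ^+ 2)).
  have : 0 <= (k * (p + q)) ^+ 2 + (k * (r - s)) ^+ 2 by rewrite addr_ge0 ?sqr_ge0.
  lra.
move=> [i1 i2] iG gG.
pose G1 x := complex.Re (G x); pose G2 x := complex.Im (G x).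
have iG1 : integr (fun x => G1 x ^+ 2).
  apply: (integr_le _ _ iG); first exact: measurable_funX (integr_meas i1).
  by move=> t; rewrite ger0_norm ?sqr_ge0// /dotc -!expr2 lerDl sqr_ge0.
have iG2 : integr (fun x => G2 x ^+ 2).
  apply: (integr_le _ _ iG); first exact: measurable_funX (integr_meas i2).
  by move=> t; rewrite ger0_norm ?sqr_ge0// /dotc -!expr2 lerDr sqr_ge0.
have [cC1 iC1 bC1] := plancherel_cos i1 iG1.
have [cC2 iC2 bC2] := plancherel_cos i2 iG2.
have [cS1 iS1 bS1] := plancherel_sin i1 iG1.
have [cS2 iS2 bS2] := plancherel_sin i2 iG2.
pose C1 t := \int[mu]_x (G1 x * cos (t * x)).
pose C2 t := \int[mu]_x (G2 x * cos (t * x)).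
pose S1 t := \int[mu]_x (G1 x * sin (t * x)).
pose S2 t := \int[mu]_x (G2 x * sin (t * x)).
have mc t : measurable_fun setT (fun x : R => cos (t * x)).
  by apply: continuous_measurable_fun; apply: continuous_mulr; exact: continuous_cos.
have ms t : measurable_fun setT (fun x : R => sin (t * x)).
  by apply: continuous_measurable_fun; apply: continuous_mulr; exact: continuous_sin.
have j1c t := integr_bounded i1 (mc t) (fun x => abs_cos_le1 _).
have j2c t := integr_bounded i2 (mc t) (fun x => abs_cos_le1 _).
have j1s t := integr_bounded i1 (ms t) (fun x => abs_sin_le1 _).
have j2s t := integr_bounded i2 (ms t) (fun x => abs_sin_le1 _).
have Rg t : complex.Re (g t) = fourier_cst * (C1 t - S2 t).
  have := gG t 1; rewrite {1}/dotc /= mulr1 mulr0 addr0 => ->; congr (_ * _).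
  rewrite -(RintegralB measurableT (j1c t) (j2s t)); apply: eq_Rintegral => xi _.
  by rewrite /wave /dotc !cReE /= cosN sinN /G1 /G2; ring.
have Ig t : complex.Im (g t) = fourier_cst * (S1 t + C2 t).
  have := gG t (0 +i* 1); rewrite {1}/dotc /= mulr1 mulr0 add0r => ->; congr (_ * _).
  rewrite -(RintegralD measurableT (j1s t) (j2c t)); apply: eq_Rintegral => xi _.
  by rewrite /wave /dotc !cReE /= cosN sinN /G1 /G2; ring.
have mg : measurable_fun setT (fun t => dotc (g t) (g t)).
  rewrite (_ : (fun t => _) = fun t => (fourier_cst * (C1 t - S2 t)) ^+ 2 + (fourier_cst * (S1 t + C2 t)) ^+ 2).
    apply: measurable_funD; apply: measurable_funX; apply: measurable_funM => //.
      by apply: measurable_funB; exact: continuous_measurable_fun.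
    by apply: measurable_funD; exact: continuous_measurable_fun.
  by apply/funext => t; rewrite /dotc Rg Ig !expr2.
have c2 : 0 <= 2 * (fourier_cst * fourier_cst) :> R by rewrite mulr_ge0// mulr_ge0// ltW ?fourier_cst_gt0.
pose B t := 2 * (fourier_cst * fourier_cst) * (C1 t ^+ 2 + S2 t ^+ 2 + (S1 t ^+ 2 + C2 t ^+ 2)).
have iB : integr B by apply: integrZ; apply: integrD; apply: integrD.
have gB t : dotc (g t) (g t) <= B t.
  by rewrite /dotc Rg Ig; exact: alg.
have ig : integr (fun t => dotc (g t) (g t)).
  by apply: (integr_le mg _ iB) => t; rewrite ger0_norm ?dotcc_ge0.
split => //.
apply: (@le_trans _ _ (\int[mu]_t B t)); first by apply: le_Rintegral.
(* The 4 is a factor 2 from [alg] times the two transforms, cosine and sine, of each component; each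
   transform costs 2 pi, cancelled by [fourier_cst] squared. *)
rewrite (RintegralZl _ measurableT (integrD (integrD iC1 iS2) (integrD iS1 iC2))).
rewrite (RintegralD measurableT (integrD iC1 iS2) (integrD iS1 iC2)).
rewrite (RintegralD measurableT iC1 iS2) (RintegralD measurableT iS1 iC2).
rewrite [X in _ <= 4 * X](_ : _ = \int[mu]_x (G1 x ^+ 2) + \int[mu]_x (G2 x ^+ 2)); last first.
  by rewrite -RintegralD//; apply: eq_Rintegral => t _; rewrite /dotc -!expr2.
set y1 := \int[mu]_x (G1 x ^+ 2); set y2 := \int[mu]_x (G2 x ^+ 2).
have h1 : \int[mu]_t (C1 t ^+ 2) <= 2 * pi * y1 by exact: bC1.
have h2 : \int[mu]_t (S2 t ^+ 2) <= 2 * pi * y2 by exact: bS2.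
have h3 : \int[mu]_t (S1 t ^+ 2) <= 2 * pi * y1 by exact: bS1.
have h4 : \int[mu]_t (C2 t ^+ 2) <= 2 * pi * y2 by exact: bC2.
apply: (le_trans (ler_wpM2l c2 (lerD (lerD h1 h2) (lerD h3 h4)))).
have E y : fourier_cst * fourier_cst * (2 * pi * y) = y :> R by rewrite mulrA fourier_cst_sqr mul1r.
rewrite -[in leRHS](E y1) -[in leRHS](E y2) le_eqVlt; apply/orP; left; apply/eqP.
by move: (y1) (y2) (fourier_cst) (pi) => u v k p; ring.
Qed.

End fourier2.

(** * Recovering [phi] and Paley-Wiener functions from their transforms *)

Section interpolators.
Context {R : realType}.
Local Notation mu := (@lebesgue_measure R).
Implicit Types (h H g G f F : R -> R[i]) (z w : R[i]) (phi : R -> R).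

Lemma integr_cauchy : integr (fun t : R => (1 + t ^+ 2)^-1).
Proof.
have [+ _] := @integral_poisson R 1 ltr01 => /(integrZ 2^-1); apply: eq_integr => t.
by rewrite /poisson; field; rewrite gt_eqF// ltr_pwDl ?sqr_ge0.
Qed.

Lemma cauchy_ge0 (t : R) : 0 <= (1 + t ^+ 2)^-1.
Proof. by rewrite invr_ge0 addr_ge0 ?sqr_ge0. Qed.

Lemma cauchy_le1 (t : R) : (1 + t ^+ 2)^-1 <= 1.
Proof. by rewrite invf_le1 ?lerDl ?sqr_ge0// ltr_pwDl ?sqr_ge0. Qed.

Lemma measurable_cauchy : measurable_fun setT (fun t : R => (1 + t ^+ 2)^-1).
Proof. exact: integr_meas integr_cauchy. Qed.

Lemma wave_dot z w (s t xi : R) :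
  dotc (wave z s xi) (wave w t xi) = dotc 1 (wave (conjc z * w) (t - s) xi).
Proof.
rewrite /wave (_ : - ((t - s) * xi) = s * xi - t * xi); last by ring.
rewrite /dotc !cReE /= !cosN !sinN cosB sinB.
by case: z w => ? ? [? ?] /=; ring.
Qed.

Section phi.
Variable phi : R -> R.
Hypotheses (phi1 : A1 phi) (phi2 : A2 phi).
Local Notation ph := (rfourier phi).

(** The order on R[i] is partial: nonnegativity in (A2) already forces the transform to be real. *)
Lemma rfourierE xi : fourier (cfun phi) xi = (ph xi)%:C.
Proof.
by case: phi2 => /(_ xi)/ger0_Im h _; apply: eqc => //=; rewrite h.
Qed.

Lemma rfourier_ge0 xi : 0 <= ph xi.
Proof. by case: phi2 => /(_ xi) + _; rewrite rfourierE ler0c. Qed.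

Lemma integr_rfourier : integr ph.
Proof. by case: phi1 => _ _ []. Qed.

Lemma weight_rfourier : weight ph.
Proof. by split; [exact: integr_meas integr_rfourier|exact: rfourier_ge0]. Qed.

(** Fourier inversion for [phi] at t - s, read as a Gram matrix of waves in L^2(phihat). It turns
    shifts of [phi] into inner products, hence interpolation into linear conditions on trigonometric
    sums. *)
Lemma phi_ip z w s t :
  fourier_cst * ip ph (wave z s) (wave w t) = phi (t - s) * dotc z w.
Proof.
have [cphi iphi iphi'] := phi1.
have E v x : fourier_cst * \int[mu]_xi (ph xi * dotc 1 (wave v x xi)) = phi x * dotc 1 v.
  have Ed r u : dotc r%:C u = r * dotc 1 u.
    by rewrite -dotcZl mulr1.
  rewrite -Ed -[RHS](@inversion _ (cfun phi) (fourier (cfun phi)))//.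
  - by congr (_ * _); apply: eq_Rintegral => xi _; rewrite rfourierE Ed.
  - have -> : (fun t => dotc (cfun phi t) v) = (fun t => phi t * dotc 1 v).
      by apply/funext => y; rewrite Ed.
    by move=> y; apply: cvgM; [exact: cphi|exact: cvg_cst].
  - have i := integrable_norm (L1_dot v iphi).
    apply: (integr_le _ _ i).
      apply: measurable_funM; last exact: measurable_cauchy.
      exact: integr_meas i.
    move=> y; rewrite ger0_norm; last by rewrite mulr_ge0// cauchy_ge0.
    by rewrite ler_piMr// cauchy_le1.
  - by move=> e e0; exact: fourier_poisson.
rewrite /ip; under eq_Rintegral do rewrite wave_dot.
rewrite E; congr (_ * _).
by rewrite -{2}[z]mulr1 dotcMl.
Qed.

End phi.

Lemma measc_fourier h : L1 h -> measc (fourier h).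
Proof.
move=> ih; have [i1 i2] := ih.
have mc t : measurable_fun setT (fun x : R => cos (t * x)).
  by apply: continuous_measurable_fun; apply: continuous_mulr; exact: continuous_cos.
have ms t : measurable_fun setT (fun x : R => sin (t * x)).
  by apply: continuous_measurable_fun; apply: continuous_mulr; exact: continuous_sin.
have j1c t := integr_bounded i1 (mc t) (fun x => abs_cos_le1 _).
have j2c t := integr_bounded i2 (mc t) (fun x => abs_cos_le1 _).
have j1s t := integr_bounded i1 (ms t) (fun x => abs_sin_le1 _).
have j2s t := integr_bounded i2 (ms t) (fun x => abs_sin_le1 _).
have cc (k : R -> R) : integr k -> continuous (fun t : R => \int[mu]_x (k x * cos (t * x))).
  by move=> ik; apply: continuous_transform => //; [exact: continuous_cos|exact: abs_cos_le1].
have cs (k : R -> R) : integr k -> continuous (fun t : R => \int[mu]_x (k x * sin (t * x))).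
  by move=> ik; apply: continuous_transform => //; [exact: continuous_sin|exact: abs_sin_le1].
split.
  rewrite (_ : _ \o _ = fun xi => fourier_cst * (\int[mu]_x (complex.Re (h x) * cos (xi * x))
      + \int[mu]_x (complex.Im (h x) * sin (xi * x)))); last first.
    apply/funext => xi; have := fourier_dot xi 1 ih.
    rewrite {1}/dotc /= mulr1 mulr0 addr0 => ->; congr (_ * _).
    rewrite -(RintegralD measurableT (j1c xi) (j2s xi)); apply: eq_Rintegral => t _.
    by rewrite /dotc !cReE /= cosN sinN (mulrC t); ring.
  apply: measurable_funM => //; apply: measurable_funD; apply: continuous_measurable_fun.
    exact: cc.
  exact: cs.
rewrite (_ : _ \o _ = fun xi => fourier_cst * (\int[mu]_x (complex.Im (h x) * cos (xi * x))
      - \int[mu]_x (complex.Re (h x) * sin (xi * x)))); last first.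
  apply/funext => xi; have := fourier_dot xi (0 +i* 1) ih.
  rewrite {1}/dotc /= mulr1 mulr0 add0r => ->; congr (_ * _).
  rewrite -(RintegralB measurableT (j2c xi) (j1s xi)); apply: eq_Rintegral => t _.
  by rewrite /dotc !cReE /= cosN sinN (mulrC t); ring.
apply: measurable_funM => //; apply: measurable_funB; apply: continuous_measurable_fun.
  exact: cc.
exact: cs.
Qed.

Lemma measc_wave z s : measc (wave z s).
Proof.
apply: meascM; first exact: measc_cst.
by have := measc_expi (- s); congr measc; apply/funext => t; congr expi; ring.
Qed.

Lemma dotc_wave z s xi : dotc (wave z s xi) (wave z s xi) = dotc z z.
Proof. by rewrite /wave dotcMexpi. Qed.

Lemma sq_wave (wt : R -> R) z s : weight wt -> integr wt -> sq wt (wave z s).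
Proof.
move=> hw iw; apply: (@sq_bounded _ _ _ (dotc z z)) => //; first exact: measc_wave.
by move=> t; rewrite dotc_wave.
Qed.

Lemma weight_lap e : weight (lap e : R -> R).
Proof.
split; last by move=> t; exact: lap_ge0.
by apply: continuous_measurable_fun; exact: continuous_lap.
Qed.

(** The inequality |c| <= 1 + c^2 and the finite length of the interval take the place of
    Cauchy-Schwarz. *)
Lemma sq_L1 f (D : set R) : sq \1_[set: R] f -> (exists a b : R, D = `[a, b]%classic) ->
  L1 (fun t => f t * (\1_D t)%:C).
Proof.
move=> [mf]; under eq_fun do rewrite indicT mul1r.
move=> i [a [b ->]]; set D' := `[a, b]%classic.
have iD : integr (\1_D' : R -> R) by exact: (@integrable_indic_itv R a b true false).
have mfD : measc (fun t => f t * (\1_D' t)%:C).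
  by apply: meascM => //; apply: measc_real; apply: measurable_indic; exact: measurable_itv.
have h (c : R -> R) : measurable_fun setT c -> (forall t, (c t) ^+ 2 <= dotc (f t) (f t)) ->
    forall c', measurable_fun setT c' -> (forall t, c' t = c t * \1_D' t) -> integr c'.
  move=> mc cf c' mc' c'E; apply: (integr_le mc' _ (integrD iD i)) => t.
  rewrite c'E normrM indicE; case: (_ \in _) => /=.
    rewrite normr1 mulr1; have := cf t; rewrite -real_normK ?num_real//.
    have := sqr_ge0 (`|c t| - 1); nra.
  by rewrite normr0 mulr0 add0r dotcc_ge0.
case: mf => m1 m2; split.
  apply: (h (fun t => complex.Re (f t))) => //.
  - by move=> t; rewrite /dotc -!expr2 lerDl sqr_ge0.
  - by case: mfD.
  - by move=> t /=; rewrite cReM /=; ring.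
apply: (h (fun t => complex.Im (f t))) => //.
- by move=> t; rewrite /dotc -!expr2 lerDr sqr_ge0.
- by case: mfD.
- by move=> t /=; rewrite cImM /=; ring.
Qed.

Lemma measurable_band : measurable (band : set R).
Proof. exact: measurable_itv. Qed.

(** The L2 transform [F0] vanishes off the band only almost everywhere. Cutting it makes this exact
    and, the band being bounded, puts it in L1; inversion then holds at every point since [f] is
    continuous. *)
Lemma PW_band f : PW f -> exists F, [/\ L1 F, sq \1_band F,
  (forall xi, ~ band xi -> F xi = 0) &
  (forall w x, fourier_cst * ip \1_band F (wave w x) = dotc (f x) w)].
Proof.
move=> [[cf1 cf2] [mf1 mf2 nf] [F0 [[mF1 mF2 nF] cvF] F0band]].
have mf : measc f by split.
have mF0 : measc F0 by split.
have sf : sq \1_[set: R] f by exact: L2norm_fin_sq.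
have sF0 : sq \1_[set: R] F0 by exact: L2norm_fin_sq.
have w1 : weight (\1_[set: R] : R -> R) by exact: weight_indic.
have wb : weight (\1_band : R -> R) by apply: weight_indic; exact: measurable_band.
pose F xi := F0 xi * (\1_band xi)%:C.
have iF : L1 F by apply: sq_L1 => //; exists (- pi), pi.
have mF : measc F by exact: L1_measc.
have Foff xi : ~ band xi -> F xi = 0.
  by move=> nb; rewrite /F indicE memNset// mulr0.
have Fon xi : band xi -> F xi = F0 xi.
  by move=> nb; rewrite /F indicE mem_set// mulr1.
have sF : sq \1_band F.
  split => //; have [_] := sF0; apply: integr_le.
    by apply: measurable_funM; [case: wb|exact: measc_dot].
  move=> t; rewrite indicT mul1r ger0_norm ?indic_dot_ge0// indicE.
  have [/set_mem tb|] := boolP (t \in band); first by rewrite mul1r Fon.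
  by rewrite mul0r dotcc_ge0.
have aeF (W : R -> R) w x : weight W -> ip W F0 (wave w x) = ip W F (wave w x).
  move=> [mW _]; congr fine; apply: ae_eq_integral => //.
  - apply/measurable_EFinP; apply: measurable_funM => //; apply: measc_dot => //.
    exact: measc_wave.
  - apply/measurable_EFinP; apply: measurable_funM => //; apply: measc_dot => //.
    exact: measc_wave.
  - move: F0band; apply: filterS; first exact: (ae_filter_ringOfSetsType mu).
    move=> xi h _.
    have [/Fon ->//|nb] := pselect (band xi); rewrite Foff// h//.
    by move=> ab; apply: nb; rewrite /band /= in_itv/= -ler_norml.
have if2 : integr (fun t => dotc (f t) (f t)).
  by case: sf => _; apply: eq_integr => t; rewrite indicT mul1r.
have ifc w : integr (fun t => `|dotc (f t) w| / (1 + t ^+ 2)).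
  apply: (integr_le _ _ (integrD if2 (integrZ (dotc w w) integr_cauchy))).
    apply: measurable_funM; last exact: measurable_cauchy.
    by apply: measurableT_comp => //; apply: measc_dot => //; exact: measc_cst.
  move=> t; have c1 := cauchy_le1 t; have c2 := cauchy_ge0 t.
  rewrite ger0_norm ?mulr_ge0//.
  apply: (@le_trans _ _ ((dotc (f t) (f t) + dotc w w) / 2 / (1 + t ^+ 2))).
    by apply: ler_wpM2r => //; exact: dotc_le.
  have := dotcc_ge0 (f t); have := dotcc_ge0 w; nra.
have cfw w : continuous (fun t => dotc (f t) w).
  move=> t; apply: cvgD; apply: cvgM; try exact: cvg_cst.
    exact: cf1.
  exact: cf2.
exists F; split => // w x.
rewrite -(@inversion _ f F w x) //.
  congr (_ * _); apply: eq_Rintegral => xi _; rewrite indicE.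
  have [/set_mem tb|/negP nb] := boolP (xi \in band); first by rewrite mul1r.
  by rewrite mul0r Foff ?dotc0l// => h; apply: nb; rewrite inE.
move=> e e0; rewrite -aeF; last exact: weight_lap.
(* The Poisson identity required by [inversion] holds for the truncations of [f], which are in L1.
   Both sides pass to the limit: the Poisson integral by domination, the pairing by L2 convergence
   and Cauchy-Schwarz, as [lap e] is at most 1. *)
pose D n : set R := `[- n%:R, n%:R]%classic.
pose fn n t := f t * (\1_(D n) t)%:C.
have ifn n : L1 (fn n) by apply: sq_L1 => //; exists (- n%:R), n%:R.
have icv : fourier_cst * \int[mu]_t (dotc (fn n t) w * poisson e (x - t)) @[n --> \oo] -->
    fourier_cst * \int[mu]_t (dotc (f t) w * poisson e (x - t)).
  apply: cvgM; first exact: cvg_cst.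
  have mP : measurable_fun setT (fun t : R => poisson e (x - t)).
    by apply: integr_meas; have [] := integral_poisson_shift x e0.
  have mfw : measurable_fun setT (fun t => dotc (f t) w).
    by apply: continuous_measurable_fun.
  apply: (@DCT_real _ (fun n t => dotc (fn n t) w * poisson e (x - t)) _
    (fun t => `|dotc (f t) w * poisson e (x - t)|) _ _ _ _ _).2.
  - move=> n; apply: measurable_funM => //.
    by apply: measc_dot; [exact: L1_measc|exact: measc_cst].
  - exact: measurable_funM.
  - apply: nearW => t; apply: cvgM; last exact: cvg_cst.
    apply: cvg_near_cst; exists (Num.truncn `|t|).+1 => // n /= tn.
    rewrite /fn indicE mem_set ?mulr1// /D/= in_itv/= -ler_norml.
    apply: ltW; apply: (lt_le_trans (truncnS_gt _)).
    by rewrite ler_nat.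
  - move=> n t; rewrite !normrM; apply: ler_wpM2r => //.
    rewrite /fn indicE; case: (_ \in _); first by rewrite mulr1.
    by rewrite mulr0 dotc0l normr0.
  - exact: integrable_norm (integr_mul_poisson x e0 mfw (ifc w)).
have lcv : ip (lap e) (fourier (fn n)) (wave w x) @[n --> \oo] -->
    ip (lap e) F0 (wave w x).
  pose K := Num.sqrt (ip (lap e) (wave w x) (wave w x)).
  have K0 : 0 <= K by exact: sqrtr_ge0.
  apply/cvgrPdist_le => eta eta0.
  have /fine_cvgP[fin /cvgrPdist_lt] := cvF.
  have eK : 0 < eta / (K + 1) by rewrite divr_gt0// ltr_pwDr.
  move=> /(_ _ eK); apply: filterS2 fin => n fin.
  have mfn : measc (fourier (fn n)) by exact: measc_fourier.
  have sd : sq \1_[set: R] (fun xi => fourier (fn n) xi - F0 xi).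
    apply: L2norm_fin_sq => //; first by apply: meascD => //; exact: meascN.
    by rewrite ltey_eq fin.
  rewrite /= -/(fn n) (L2norm_sq sd) sub0r normrN /= ger0_norm ?sqrtr_ge0// => dn.
  have we := @weight_lap e.
  have ie := integr_lap e0.
  have [sd' le] : sq (lap e) (fun xi => fourier (fn n) xi - F0 xi) /\
    ip (lap e) (fun xi => fourier (fn n) xi - F0 xi) (fun xi => fourier (fn n) xi - F0 xi)
    <= 1 * ip \1_[set: R] (fun xi => fourier (fn n) xi - F0 xi) (fun xi => fourier (fn n) xi - F0 xi).
    by apply: ip_le => // t; rewrite indicT mulr1 lap_le1// ltW.
  have [sF0' _] : sq (lap e) F0 /\ ip (lap e) F0 F0 <= 1 * ip \1_[set: R] F0 F0.
    by apply: ip_le => // t; rewrite indicT mulr1 lap_le1// ltW.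
  have sfn : sq (lap e) (fourier (fn n)).
    have := sqD we sd' sF0'; congr sq; apply/funext => t; exact: subrK.
  have se : sq (lap e) (wave w x) by exact: sq_wave.
  rewrite distrC -ipBl//; apply: (le_trans (ip_CSn we sd' se)).
  rewrite -/K; apply: (@le_trans _ _ (eta / (K + 1) * K)).
    apply: ler_wpM2r => //; apply: (le_trans _ (ltW dn)).
    by apply: ler_wsqrtr; rewrite mul1r in le.
  rewrite -mulrA ler_piMr ?(ltW eta0)// mulrC ltW// ltr_pdivrMr ?ltr_pwDr//; lra.
apply: (cvg_unique _ lcv) => //.
rewrite (_ : (fun n => ip _ _ _) =
  fun n => fourier_cst * \int[mu]_t (dotc (fn n t) w * poisson e (x - t)))//.
by apply/funext => n; rewrite fourier_poisson.
Qed.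

End interpolators.

(** * Trigonometric sums and the Riesz bounds *)

Section riesz.
Context {R : realType}.
Local Notation mu := (@lebesgue_measure R).
Implicit Types (a b : int -> R[i]) (x : int -> R).

Definition tsum x N a (xi : R) : R[i] := sum_upto N (fun j => wave (a j) (x j) xi).

Lemma tsum_zsum x N a xi :
  zsum_upto (fun j => a j * exponential x j xi) N = tsum x N a xi.
Proof. by []. Qed.

Lemma sq_tsum (W : R -> R) x N a : weight W -> integr W -> sq W (tsum x N a).
Proof. by move=> hw iw; apply: sq_sum => // k; exact: sq_wave. Qed.

Lemma tsum_cut x N M a : (N <= M)%N -> tsum x M (cut N a) = tsum x N a.
Proof.
move=> NM; apply/funext => xi; rewrite /tsum -(sum_upto_cut _ NM); apply: eq_sum_upto => j _.
by rewrite /cut /wave; case: ifP => // _; rewrite mul0r.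
Qed.

Lemma tsumD x N a b xi : tsum x N (fun j => a j + b j) xi = tsum x N a xi + tsum x N b xi.
Proof. by rewrite /tsum -sum_uptoD; apply: eq_sum_upto => j _; rewrite /wave mulrDl. Qed.

Lemma tsumB x N a b xi : tsum x N (fun j => a j - b j) xi = tsum x N a xi - tsum x N b xi.
Proof. by rewrite /tsum -sum_uptoB; apply: eq_sum_upto => j _; rewrite /wave mulrBl. Qed.

Lemma tsumZ x N z b xi : tsum x N (fun j => z * b j) xi = z * tsum x N b xi.
Proof. by rewrite /tsum -sum_uptoZ; apply: eq_sum_upto => j _; rewrite /wave mulrA. Qed.

Lemma sqnorm_cut N M a : (N <= M)%N -> sqnorm M (cut N a) = sqnorm N a.
Proof.
move=> NM; rewrite /sqnorm -(sum_upto_cut _ NM); apply: eq_sum_upto => j _.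
by rewrite /cut; case: ifP => // _; rewrite dotc0l.
Qed.

Definition wband : R -> R := \1_band.

Lemma weight_band : weight wband.
Proof. by apply: weight_indic; exact: measurable_band. Qed.

Lemma integr_band : integr wband.
Proof. exact: (@integrable_indic_itv R (- pi) pi true false). Qed.

(** [L2 band] asks for measurability on the band, [sq] on the line; extension by zero bridges the
    two and leaves the norms over the band unchanged. *)
Lemma L2_restrict (S : R -> R[i]) : L2 band S ->
  exists S', [/\ sq wband S', L2norm band S' = L2norm band S &
    forall T : R -> R[i], L2norm band (fun t => T t - S t) = L2norm band (fun t => T t - S' t)].
Proof.
move=> [mR mI nS]; pose S' t := S t * (\1_band t)%:C.
have mb : measurable (band : set R) by exact: measurable_band.
have E (g : R -> R) : measurable_fun band g -> measurable_fun setT (g \_ band).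
  by move=> mg; apply/(measurable_restrict _ mb measurableT); rewrite setTI.
have mS : measc S'.
  split.
    rewrite (_ : _ \o S' = (@complex.Re R \o S) \_ band); first exact: E.
    apply/funext => t; rewrite /S' patchE /= cReM /= indicE.
    by case: (_ \in _) => /=; rewrite ?(mulr1, mulr0) ?(subr0, addr0).
  rewrite (_ : _ \o S' = (@complex.Im R \o S) \_ band); first exact: E.
  apply/funext => t; rewrite /S' patchE /= cImM /= indicE.
  by case: (_ \in _) => /=; rewrite ?(mulr1, mulr0) ?(add0r, addr0).
have nE : L2norm band S' = L2norm band S.
  rewrite !L2norm_integral; congr (_ `^ _)%E; apply: eq_integral => t _.
  by rewrite /S' indicE; case: (_ \in _); rewrite ?mulr1// !mul0r.
exists S'; split => //; first by apply: L2norm_fin_sq => //; rewrite nE.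
move=> T; rewrite !L2norm_integral; congr (_ `^ _)%E; apply: eq_integral => t _.
by rewrite /S' indicE; case: (_ \in _); rewrite ?mulr1// !mul0r.
Qed.

(** By Cauchy-Schwarz a difference of norm 0 is orthogonal to both functions. This exchanges them in
    norms without speaking of equality almost everywhere. *)
Lemma ip_eq0_eq (W : R -> R) g h : weight W -> sq W g -> sq W h ->
  ip W (fun t => g t - h t) (fun t => g t - h t) = 0 -> ip W g g = ip W h h.
Proof.
move=> hw hg hh e0.
have sgh : sq W (fun t => g t - h t) by exact: sqB.
have zero k : sq W k -> ip W (fun t => g t - h t) k = 0.
  move=> hk; have := ip_CS hw sgh hk; rewrite e0 mul0r => h0.
  by apply/eqP; rewrite -sqrf_eq0 eq_le h0 sqr_ge0.
have := zero g hg; rewrite ipBl// => /eqP; rewrite subr_eq0 => /eqP ->.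
by have := zero h hh; rewrite ipBl// => /eqP; rewrite subr_eq0 (ipC W g h) => /eqP.
Qed.

(** The definition controls an L2 limit [S] of the series. For a padded finite sequence the partial
    sums are eventually the trigonometric sum itself, which is thus at distance 0 from [S]. The
    constant is squared because norms become squared norms. *)
Lemma riesz_bounds x : complete_interpolating x ->
  exists2 C : R, 0 < C & forall N a,
    sqnorm N a <= C * ip wband (tsum x N a) (tsum x N a) /\
    ip wband (tsum x N a) (tsum x N a) <= C * sqnorm N a.
Proof.
move=> [_ [C C0 hC]]; exists (C ^+ 2); first by rewrite exprn_gt0.
move=> N a; have wb := weight_band; have ib := integr_band.
have la : l2 (cut N a) by rewrite /l2 l2norm_cut ltry.
have [S [LS cS] [h1 h2]] := hC _ la.
have [S' [sS' nS' dS']] := L2_restrict LS.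
have sT : sq wband (tsum x N a) by exact: sq_tsum.
have sD : sq wband (fun t => tsum x N a t - S' t) by exact: sqB.
have d0 : L2norm band (fun t => tsum x N a t - S' t) = 0%E.
  rewrite -dS'.
  have : L2norm band (fun xi => zsum_upto (fun j => cut N a j * exponential x j xi) n - S xi)
    @[n --> \oo] --> L2norm band (fun t => tsum x N a t - S t).
    apply: cvg_near_cst; exists N => // n /= Nn.
    by congr (L2norm band _); apply/funext => xi; rewrite tsum_zsum tsum_cut.
  by move=> h; apply/esym; apply: (cvg_unique _ cS h).
have e0 : ip wband (fun t => tsum x N a t - S' t) (fun t => tsum x N a t - S' t) = 0.
  move: d0; rewrite (L2norm_sq sD) => -[] /eqP; rewrite sqrtr_eq0 => h.
  by apply/eqP; rewrite eq_le h ip_ge0.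
rewrite (ip_eq0_eq wb sT sS' e0).
move: h1 h2; rewrite -nS' (L2norm_sq sS') l2norm_cut -!EFinM !lee_fin.
have q0 : 0 <= ip wband S' S' by exact: ip_ge0.
have n0 := sqnorm_ge0 N a; rewrite -/wband.
move: (ip wband S' S') (sqnorm N a) q0 n0 => q n q0 n0.
have := sqr_sqrtr q0; have := sqr_sqrtr n0.
have := sqrtr_ge0 q; have := sqrtr_ge0 n.
move: (Num.sqrt q) (Num.sqrt n) => u v v0 u0 <- <- h1 h2.
split; rewrite -exprMn ler_pXn2r// ?nnegrE ?mulr_ge0// ?(ltW C0)//.
by move: h1; rewrite mulrC ler_pdivrMr// mulrC.
Qed.

Definition twist x (k : int) a : int -> R[i] :=
  fun j => a j * expi (- (x j * (2 * pi * k%:~R))).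

Lemma tsum_twist x N k a xi : tsum x N a (xi + 2 * pi * k%:~R) = tsum x N (twist x k a) xi.
Proof.
apply: eq_sum_upto => j _; rewrite /wave /twist -[RHS]mulrA -expiD; congr (_ * expi _); ring.
Qed.

Lemma sqnorm_twist x N k a : sqnorm N (twist x k a) = sqnorm N a.
Proof. by apply: eq_sum_upto => j _; rewrite dotcMexpi. Qed.

Lemma band_shift x N a k : 
  (\int[mu]_xi (wband (xi - 2 * pi * k%:~R) * dotc (tsum x N a xi) (tsum x N a xi))%:E =
  (ip wband (tsum x N (twist x k a)) (tsum x N (twist x k a)))%:E)%E.
Proof.
have sS b : sq wband (tsum x N b) by apply: sq_tsum; [exact: weight_band|exact: integr_band].
have mW : measurable_fun setT (fun xi : R => wband (xi - 2 * pi * k%:~R)).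
  apply: (measurableT_comp weight_band.1).
  exact: (@measurable_funD _ _ _ _ id (cst _)).
have mS b : measurable_fun setT (fun xi => dotc (tsum x N b xi) (tsum x N b xi)).
  by apply: measc_dot; case: (sS b).
rewrite -[LHS](@ge0_integral_shift R (2 * pi * k%:~R) (fun xi : R =>
  (wband (xi - 2 * pi * k%:~R) * dotc (tsum x N a xi) (tsum x N a xi))%:E)); last 2 first.
- by apply/measurable_EFinP; exact: measurable_funM.
- by move=> xi; rewrite lee_fin mulr_ge0 ?dotcc_ge0// weight_band.2.
rewrite -integral_EFin; last by case: (sS (twist x k a)).
by apply: eq_integral => xi _; rewrite addrK tsum_twist.
Qed.

(** Adjacent translates share an endpoint, which is harmless as the covering serves for upper
    bounds. *)
Lemma band_cover (K : nat) (xi : R) : `|xi| <= (K.*2.+1)%:R * pi ->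
  exists2 k : int, (`|k| <= K)%N & band (xi - 2 * pi * k%:~R).
Proof.
have p0 := pi_gt0 R.
elim: K => [|K ih] h.
  exists 0 => //; rewrite mulr0 subr0 /band /= in_itv/= -ler_norml.
  by move: h; rewrite mul1r.
have [/ih[k kK kb]|h'] := leP `|xi| ((K.*2.+1)%:R * pi).
  by exists k => //; exact: leqW.
have E : (K.+1.*2.+1)%:R = (K.*2.+1)%:R + 2 :> R by rewrite doubleS -[K.*2.+3]addn2 natrD.
have E2 : (K.*2.+1)%:R = 2 * K%:R + 1 :> R by rewrite -addn1 natrD -mul2n natrM.
move: h h'; rewrite E E2; case: (ger0P xi) => xi0 h h'.
  exists (K.+1)%:Z; first by rewrite absz_nat.
  by rewrite /band /= in_itv/= -pmulrn -[K.+1%:R]natr1; apply/andP; split; lra.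
exists (- (K.+1)%:Z); first by rewrite abszN absz_nat.
by rewrite /band /= in_itv/= rmorphN /= -pmulrn -[K.+1%:R]natr1; apply/andP; split; lra.
Qed.

(* The line is covered by the translates of the band by multiples of 2 pi; up to
   a change of phase of the coefficients, a trigonometric sum on such a translate
   is a trigonometric sum on the band. *)
Lemma weight_bound x (C : R) (W : R -> R) (Wk : int -> R) (B : R) N a :
  (forall N a, ip wband (tsum x N a) (tsum x N a) <= C * sqnorm N a) -> 0 <= C ->
  weight W -> integr W -> (forall k, 0 <= Wk k) ->
  (forall k xi, band xi -> W (xi + 2 * pi * k%:~R) <= Wk k) ->
  (forall K, sum_upto K Wk <= B) ->
  ip W (tsum x N a) (tsum x N a) <= B * (C * sqnorm N a).
Proof.
move=> hC C0 hW iW Wk0 hWk hB.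
have sS V : weight V -> integr V -> sq V (tsum x N a) by exact: sq_tsum.
pose Q xi := dotc (tsum x N a xi) (tsum x N a xi).
have Q0 xi : 0 <= Q xi by exact: dotcc_ge0.
have mQ : measurable_fun setT Q.
  by apply: measc_dot; case: (sS W hW iW).
have Cn0 : 0 <= C * sqnorm N a by rewrite mulr_ge0 ?sqnorm_ge0.
have mWs k : measurable_fun setT (fun xi : R => wband (xi - 2 * pi * k%:~R)).
  apply: (measurableT_comp weight_band.1).
  exact: (@measurable_funD _ _ _ _ id (cst _)).
(* Blocks of 2 K + 1 translates exhaust the line; on each, [W] is dominated by a finite sum, and
   Fatou passes to the whole line. *)
pose D K : set R := `[- ((K.*2.+1)%:R * pi), (K.*2.+1)%:R * pi]%classic.
have mD K : measurable (D K) by exact: measurable_itv.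
suff H : (\int[mu]_xi (W xi * Q xi)%:E <= (B * (C * sqnorm N a))%:E)%E.
  have mWQ : measurable_fun setT (fun xi => W xi * Q xi).
    by apply: measurable_funM => //; case: hW.
  have WQ0 t : 0 <= W t * Q t by rewrite mulr_ge0//; case: hW.
  by case: (ge0_integr mWQ WQ0 H).
apply: (@fatou_real _ (fun K xi => \1_(D K) xi * (W xi * Q xi))).
- move=> K; apply: measurable_funM; first by apply: measurable_indic; exact: mD.
  by apply: measurable_funM => //; case: hW.
- by move=> K xi; rewrite !mulr_ge0// ?indicE ?ler0n//; case: hW.
- move=> xi; rewrite -[X in _ --> X]mul1r; apply: cvgM; last exact: cvg_cst.
  apply: cvg_near_cst; exists (Num.truncn `|xi|).+1 => // K /= hK.
  rewrite indicE mem_set// /D /= in_itv/= -ler_norml.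
  apply: ltW; apply: (lt_le_trans (truncnS_gt _)).
  apply: (@le_trans _ _ K%:R); first by rewrite ler_nat.
  have p2 := pi_ge2 R.
  apply: (@le_trans _ _ (K.*2.+1)%:R); first by rewrite ler_nat; lia.
  by rewrite ler_peMr//; lra.
- move=> K.
  apply: (@le_trans _ _ (\int[mu]_xi (\sum_(k <- int_upto K)
     (Wk k)%:E * (wband (xi - 2 * pi * k%:~R) * Q xi)%:E))%E).
    apply: ge0_le_integral => //.
    + by move=> xi _; rewrite lee_fin !mulr_ge0// ?indicE ?ler0n//; case: hW.
    + apply/measurable_EFinP; apply: measurable_funM; first by apply: measurable_indic; exact: mD.
      by apply: measurable_funM => //; case: hW.
    + apply: emeasurable_sum => k; apply: measurable_funeM.
      by apply/measurable_EFinP; apply: measurable_funM => //; exact: mWs.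
    move=> xi _; under eq_bigr do rewrite -EFinM.
    rewrite sumEFin lee_fin -sum_upto_int_upto indicE.
    have s0 k : 0 <= Wk k * (wband (xi - 2 * pi * k%:~R) * Q xi).
      by rewrite mulr_ge0// mulr_ge0// weight_band.2.
    have [/set_mem|] := boolP (xi \in D K); last by rewrite mul0r sum_upto_ge0.
    rewrite /D /= in_itv/= -ler_norml => /band_cover[k kK kb].
    apply: (le_trans _ (sum_upto_term_le kK s0)).
    rewrite mul1r /wband indicE mem_set// mul1r; apply: ler_wpM2r => //.
    by have := hWk k _ kb; rewrite subrK.
  rewrite ge0_integral_sum//.
  + under eq_bigr => k _.
      rewrite ge0_integralZl_EFin//; last 2 first.
      * by move=> xi _; rewrite lee_fin mulr_ge0// weight_band.2.
      * by apply/measurable_EFinP; apply: measurable_funM => //; exact: mWs.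
      rewrite band_shift -EFinM; over.
    rewrite sumEFin lee_fin -sum_upto_int_upto.
    apply: (@le_trans _ _ (sum_upto K (fun k => (C * sqnorm N a) * Wk k))).
      apply: le_sum_upto => k _; rewrite mulrC ler_wpM2r//.
      by rewrite -(sqnorm_twist x N k a).
    by rewrite sum_uptoZ mulrC ler_wpM2r.
  + move=> k; apply: measurable_funeM.
    by apply/measurable_EFinP; apply: measurable_funM => //; exact: mWs.
  + by move=> k xi _; rewrite -EFinM lee_fin mulr_ge0// mulr_ge0// weight_band.2.
Qed.

End riesz.

(** * Existence of the interpolant *)

Section real_cauchy.
Context {R : realType}.
Local Notation mu := (@lebesgue_measure R).

Lemma real_cauchy_cvg (u : nat -> R) :
  (forall e, 0 < e -> exists N, forall n, (N <= n)%N -> `|u n - u N| <= e) ->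
  cvg (u @ \oo).
Proof.
move=> h; apply/cauchy_cvgP/cauchy_exP => e e0.
have e2 : 0 < e / 2 by rewrite divr_gt0.
have [N hN] := h _ e2; exists (u N), N => // n /= Nn.
rewrite /= -ball_normE /ball_ /= distrC; apply: (le_lt_trans (hN n Nn)); lra.
Qed.

Lemma cvg_sum_upto (u : nat -> int -> R) (v : int -> R) N :
  (forall j, u n j @[n --> \oo] --> v j) -> sum_upto N (u n) @[n --> \oo] --> sum_upto N v.
Proof.
move=> uv; rewrite /sum_upto; elim: (N.*2.+1) => [|k ih].
  by rewrite big_ord0; under eq_fun do rewrite big_ord0; exact: cvg_cst.
by rewrite big_ord_recr; under eq_fun do rewrite big_ord_recr; exact: cvgD.
Qed.

Lemma sqnormD_le N (a b : int -> R[i]) :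
  sqnorm N (fun j => a j + b j) <= 2 * sqnorm N a + 2 * sqnorm N b.
Proof. by rewrite /sqnorm -!sum_uptoZ -sum_uptoD; apply: le_sum_upto => j _; exact: dotcD_le. Qed.

(** Each coordinate is Cauchy; the finite sums [sqnorm M] then pass to the limit in the second
    index, with a bound independent of [M]. *)
Lemma l2_complete (b : nat -> int -> R[i]) (D : R) :
  (forall M n m, sqnorm M (fun j => b n j - b m j) <= D * (n.+1%:R^-1 + m.+1%:R^-1)) ->
  exists a, forall n M, sqnorm M (fun j => a j - b n j) <= D * n.+1%:R^-1.
Proof.
move=> bD.
have D0 : 0 <= D.
  have := bD 0%N 0%N 0%N; have := sqnorm_ge0 0 (fun j => b 0%N j - b 0%N j).
  rewrite invr1 => h1 h2; lra.
have cv (p : R[i] -> R) : (forall z w, p (z - w) = p z - p w) ->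
    (forall z, p z ^+ 2 <= dotc z z) -> forall j, cvg ((fun n => p (b n j)) @ \oo).
  move=> pB pd j; apply: real_cauchy_cvg => e e0.
  (* Beyond [N] the two tolerances add up to at most 2 / (N + 1), so the squared distance is at most
     e^2. *)
  pose N := Num.truncn (D * 2 / e ^+ 2).
  exists N => n Nn; rewrite -pB -(@ler_pXn2r _ 2) ?nnegrE ?normr_ge0 ?(ltW e0)//.
  rewrite real_normK ?num_real//; apply: (le_trans (pd _)).
  have jj : (`|j| <= `|j|)%N by [].
  have d0 i : 0 <= dotc (b n i - b N i) (b n i - b N i) by exact: dotcc_ge0.
  apply: (le_trans (sum_upto_term_le jj d0)); apply: (le_trans (bD _ _ _)).
  apply: (@le_trans _ _ (D * (2 * N.+1%:R^-1))).
    apply: ler_wpM2l => //.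
    have : n.+1%:R^-1 <= N.+1%:R^-1 :> R by rewrite lef_pV2 ?posrE// ler_nat.
    by move: (n.+1%:R^-1) (N.+1%:R^-1) => u v; lra.
  have e20 : 0 < e ^+ 2 by rewrite exprn_gt0.
  rewrite mulrA ler_pdivrMr// [leRHS]mulrC -ler_pdivrMr//.
  by apply/ltW; exact: truncnS_gt.
have cR := cv (@complex.Re R) _ _; have cI := cv (@complex.Im R) _ _.
have {}cR j : cvg ((fun n => complex.Re (b n j)) @ \oo).
  apply: cR => [z w|z]; first by rewrite cReD cReN.
  by rewrite /dotc -!expr2 lerDl sqr_ge0.
have {}cI j : cvg ((fun n => complex.Im (b n j)) @ \oo).
  apply: cI => [z w|z]; first by rewrite cImD cImN.
  by rewrite /dotc -!expr2 lerDr sqr_ge0.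
pose a j := lim ((fun n => complex.Re (b n j)) @ \oo) +i*
  lim ((fun n => complex.Im (b n j)) @ \oo).
exists a => n M.
have h1 : sqnorm M (fun j => b m j - b n j) @[m --> \oo] --> sqnorm M (fun j => a j - b n j).
  have dR j : complex.Re (b m j - b n j) @[m --> \oo] --> complex.Re (a j - b n j).
    rewrite cReD; under eq_fun do rewrite cReD.
    by apply: cvgD; [exact: cR|exact: cvg_cst].
  have dI j : complex.Im (b m j - b n j) @[m --> \oo] --> complex.Im (a j - b n j).
    rewrite cImD; under eq_fun do rewrite cImD.
    by apply: cvgD; [exact: cI|exact: cvg_cst].
  by apply: cvg_sum_upto => j; apply: cvgD; apply: cvgM; [exact: dR|exact: dR|exact: dI|exact: dI].
have h2 : D * (m.+1%:R^-1 + n.+1%:R^-1) @[m --> \oo] --> D * (0 + n.+1%:R^-1).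
  by apply: cvgM; [exact: cvg_cst|apply: cvgD; [exact: cvg_harmonic|exact: cvg_cst]].
rewrite add0r in h2; apply: (ler_cvg_to h1 h2).
by apply: nearW => m; exact: bD.
Qed.

Lemma l2_of_close (a b : int -> R[i]) (D : R) N :
  (forall M, sqnorm M (fun j => a j - cut N b j) <= D) -> l2 a.
Proof.
move=> h; apply/l2P; exists (2 * D + 2 * sqnorm N b) => M.
have -> : sqnorm M a = sqnorm M (fun j => (a j - cut N b j) + cut N b j).
  by apply: eq_sum_upto => j _; rewrite subrK.
apply: (le_trans (sqnormD_le _ _ _)); apply: lerD; first by rewrite ler_pM2l.
rewrite ler_pM2l//; have : sqnorm (maxn M N) (cut N b) = sqnorm N b by rewrite sqnorm_cut ?leq_maxr.
by move=> <-; rewrite sqnorm_mono ?leq_maxl.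
Qed.

(* [v n] minimises [ip W g g - 2 * ip V F g] over [P] up to [n.+1%:R^-1]; the two
   bounds are the parallelogram identity and the Euler equation. *)
Lemma variational (W V : R -> R) (P : set (R -> R[i])) (F : R -> R[i]) (K : R) :
  weight W -> weight V -> sq V F -> P !=set0 ->
  (forall g, P g -> sq W g /\ sq V g) ->
  (forall g h (k l : R), P g -> P h -> P (fun t => k%:C * g t + l%:C * h t)) ->
  0 <= K -> (forall g, P g -> ip V F g ^+ 2 <= K * ip W g g) ->
  exists v : nat -> R -> R[i], [/\ forall n, P (v n),
    forall n m, ip W (fun t => v n t - v m t) (fun t => v n t - v m t) <=
      2 * (n.+1%:R^-1 + m.+1%:R^-1) &
    forall n w, P w -> (ip W (v n) w - ip V F w) ^+ 2 <= n.+1%:R^-1 * ip W w w].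
Proof.
move=> hW hV sF [g0 Pg0] Psq PD K0 LK.
pose J g := ip W g g - 2 * ip V F g.
(* With q the quadratic and l the linear term, l^2 <= K q gives 2 |l| <= q + K by AM-GM. *)
have JK g : P g -> - K <= J g.
  move=> Pg; have := LK _ Pg; have := ip_ge0 g hW; rewrite /J.
  move: (ip W g g) (ip V F g) => q l q0 h.
  have : (2 * l) ^+ 2 <= (q + K) ^+ 2 by have := sqr_ge0 (q - K); nra.
  by move=> h'; rewrite leNgt; apply/negP => h''; nra.
pose S := [set J g | g in P].
have hS : has_inf S.
  by split; [exists (J g0), g0|exists (- K) => _ [g Pg <-]; exact: JK].
have Jinf g : P g -> inf S <= J g.
  by move=> Pg; apply: ge_inf; [case: hS|exists g].
have /choice[v hv] : forall n : nat, exists g, P g /\ J g < inf S + n.+1%:R^-1.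
  move=> n; have n0 : 0 < n.+1%:R^-1 :> R by rewrite invr_gt0.
  by have [_ [g Pg <-] h] := inf_adherent n0 hS; exists g.
exists v; split.
- by move=> n; case: (hv n).
- move=> n m; have [Pn Jn] := hv n; have [Pm Jm] := hv m.
  have [sn sn'] := Psq _ Pn; have [sm sm'] := Psq _ Pm.
  have E : ip W (fun t => v n t - v m t) (fun t => v n t - v m t) =
      ip W (v n) (v n) - ip W (v n) (v m) - (ip W (v m) (v n) - ip W (v m) (v m)).
    by rewrite ipBl ?ipBr//; exact: sqB.
  rewrite E.
  (* The midpoint of [v n] and [v m] is a competitor. *)
  have := Jinf _ (PD _ _ 2^-1 2^-1 Pn Pm).
  have a1 := sqM (2^-1)%:C hW sn; have a2 := sqM (2^-1)%:C hW sm.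
  have a3 := sqM (2^-1)%:C hV sn'; have a4 := sqM (2^-1)%:C hV sm'.
  have a5 := sqD hW a1 a2.
  by move: Jn Jm; rewrite /J !(ipDl, ipDr)// !(ipZl, ipZr)//;
    rewrite (ipC W (v m) (v n)); move: (n.+1%:R^-1) (m.+1%:R^-1) => p q; lra.
- move=> n w Pw; have [Pn Jn] := hv n.
  have [sn sn'] := Psq _ Pn; have [sw sw'] := Psq _ Pw.
  (* For all t, J(v n + t w) is at least the infimum, hence above J(v n) - 1 / (n + 1); this is a
     quadratic inequality in t with constant term [n.+1%:R^-1]. *)
  apply: discr_le => [|t]; first exact: ip_ge0.
  have := Jinf _ (PD _ _ 1 t Pn Pw); move: Jn; rewrite /J.
  have a1 := sqM 1%:C hW sn; have a2 := sqM t%:C hW sw.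
  have a3 := sqM 1%:C hV sn'; have a4 := sqM t%:C hV sw'.
  have a5 := sqD hW a1 a2.
  rewrite !(ipDl, ipDr)// !(ipZl, ipZr)//.
  rewrite (ipC W w (v n)).
  by move: (n.+1%:R^-1) => p; lra.
Qed.
End real_cauchy.

(** * One interpolator: weights, convergence of the series, existence *)

Section one_interpolator.
Context {R : realType}.
Local Notation mu := (@lebesgue_measure R).
Variables (phi : R -> R).
Hypotheses (phi1 : A1 phi) (phi2 : A2 phi).
Local Notation ph := (rfourier phi).

(** The supremum of an unbounded set is a default value; this bound by the L1 norm of [phi] makes
    the suprema in [M_] genuine. *)
Lemma rfourier_bounded : exists B, forall xi, ph xi <= B.
Proof.
have [_ [iphi _] _] := phi1.
have i1 : L1 (cfun phi) by have [] := phi1.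
exists (fourier_cst * \int[mu]_t `|phi t|) => xi.
have E (z : R[i]) : complex.Re z = dotc z 1 by rewrite /dotc /= mulr1 mulr0 addr0.
rewrite /rfourier E fourier_dot//; apply: ler_wpM2l; first exact: ltW fourier_cst_gt0.
apply: le_Rintegral => //.
- exact: L1_dot (L1_expiN xi i1).
- exact: integrable_norm iphi.
move=> t _; rewrite /cfun /dotc !cReE /= cosN sinN !(mul0r, mulr0, mulr1, subr0, addr0).
by apply: (le_trans (ler_norm _)); rewrite normrM ler_piMr// abs_cos_le1.
Qed.

Lemma rfourier_le_M k xi : band xi -> ph (xi + 2 * pi * k%:~R) <= M_ phi k.
Proof.
move=> xb; have [B hB] := rfourier_bounded.
by apply: ub_le_sup; [exists B => _ [y _ <-]|exists xi].
Qed.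

Lemma band0 : band (0 : R).
Proof. by rewrite /band /= in_itv/= oppr_le0 pi_ge0. Qed.

Lemma M_ge0 k : 0 <= M_ phi k.
Proof. by apply: (le_trans _ (rfourier_le_M k band0)); exact: rfourier_ge0. Qed.

Lemma m_gt0 : 0 < m_ phi.
Proof.
case: phi2 => _ [d d0 hd]; apply: (lt_le_trans d0).
apply: lb_le_inf; first by exists (ph 0), 0 => //; exact: band0.
by move=> _ [xi xb <-]; have := hd _ xb; rewrite rfourierE// lecR.
Qed.

Lemma m_le xi : band xi -> m_ phi <= ph xi.
Proof.
move=> xb; apply: ge_inf; last by exists xi.
by exists 0 => _ [y _ <-]; exact: rfourier_ge0.
Qed.

Lemma m_band xi : wband xi <= (m_ phi)^-1 * ph xi.
Proof.
have m0 := m_gt0; rewrite /wband indicE; have [/set_mem xb|] := boolP (xi \in band).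
  by rewrite mulrC ler_pdivlMr// mul1r m_le.
by rewrite mulr_ge0 ?rfourier_ge0// invr_ge0 ltW.
Qed.

Lemma sum_upto_M : A3 phi -> exists2 B : R, 0 <= B & forall K, sum_upto K (M_ phi) <= B.
Proof.
move=> h3; exists (fine (\esum_(j in [set: int]) `|M_ phi j|%:E)%E).
  by apply: fine_ge0; apply: esum_ge0 => j _; rewrite lee_fin.
move=> K; rewrite -lee_fin fineK; last first.
  by rewrite ge0_fin_numE//; apply: esum_ge0 => j _; rewrite lee_fin.
rewrite (eq_esum (b := fun j => (M_ phi j)%:E)); last first.
  by move=> j _; rewrite ger0_norm// M_ge0.
by apply: sum_upto_le_esum => j; exact: M_ge0.
Qed.

(** (H2) omits j = 0; a zero term there lets the sum run over symmetric ranges. *)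
Definition M_off (j : int) : R := if j == 0 then 0 else M_ phi j.

Lemma M_off_ge0 k : 0 <= M_off k.
Proof. by rewrite /M_off; case: ifP => // _; exact: M_ge0. Qed.

Lemma sum_upto_M_off (C : R) :
  (\esum_(j in [set j : int | (j != 0)%R]) (M_ phi j)%:E <= (C * m_ phi)%:E)%E ->
  forall K, sum_upto K M_off <= C * m_ phi.
Proof.
move=> h K; rewrite -lee_fin; apply: (le_trans _ h).
rewrite esum_mkcond (eq_esum (b := fun j => (M_off j)%:E)); last first.
  move=> j _; rewrite /M_off; case: eqP => [->|/eqP j0]; last by rewrite mem_set.
  by rewrite memNset//= eqxx.
by apply: sum_upto_le_esum => j; exact: M_off_ge0.
Qed.

Definition off_weight (xi : R) : R := ph xi * \1_(~` band) xi.

Lemma weight_off : weight off_weight.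
Proof.
split; last by move=> t; rewrite mulr_ge0 ?rfourier_ge0// indicE ler0n.
apply: measurable_funM; first exact: (weight_rfourier phi1 phi2).1.
by apply: measurable_indic; apply: measurableC; exact: measurable_band.
Qed.

Lemma off_weight_le xi : off_weight xi <= ph xi.
Proof.
by rewrite /off_weight indicE; case: (_ \in _); rewrite ?mulr1// mulr0 rfourier_ge0.
Qed.

Lemma integr_off : integr off_weight.
Proof.
apply: (integr_le weight_off.1 _ (integr_rfourier phi1)) => t.
by rewrite ger0_norm ?off_weight_le// weight_off.2.
Qed.

Lemma off_weight_M_off k xi : band xi -> off_weight (xi + 2 * pi * k%:~R) <= M_off k.
Proof.
move=> xb; rewrite /M_off; case: eqP => [->|_].
  by rewrite mulr0 addr0 /off_weight indicE memNset ?mulr0// => h; exact: h.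
exact: le_trans (off_weight_le _) (rfourier_le_M _ xb).
Qed.

(** One nonnegative term is at most the whole sum. This pointwise form of (H2) is what handles
    phihat when it enters squared. *)
Lemma rfourier_off (C : R) : (forall K, sum_upto K M_off <= C * m_ phi) ->
  forall xi, off_weight xi <= C * m_ phi.
Proof.
move=> hC xi; pose K := (Num.truncn `|xi|).+1.
have h : `|xi| <= (K.*2.+1)%:R * pi.
  apply: ltW; apply: (lt_le_trans (truncnS_gt _)).
  have p2 := pi_ge2 R.
  apply: (@le_trans _ _ (K.*2.+1)%:R); first by rewrite ler_nat -addnn -addnS leq_addr.
  by rewrite ler_peMr//; lra.
have [k kK kb] := band_cover h.
have := off_weight_M_off k kb; rewrite subrK => /le_trans; apply.
exact: le_trans (sum_upto_term_le kK M_off_ge0) (hC K).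
Qed.

Variable x : int -> R.

Lemma dotc_suml I (s : seq I) (g : I -> R[i]) w :
  dotc (\sum_(i <- s) g i) w = \sum_(i <- s) dotc (g i) w.
Proof.
by elim: s => [|i s ih]; rewrite ?(big_nil, dotc0l)// !big_cons dotcDl ih.
Qed.

Lemma dotc_shifts_partial a N t w :
  dotc (zsum_upto (fun j => a j * cfun phi (t - x j)) N) w =
  fourier_cst * ip ph (tsum x N a) (wave w t).
Proof.
have wp := weight_rfourier phi1 phi2; have ip_ := integr_rfourier phi1.
rewrite /tsum /sum_upto ip_suml//; [|by move=> k; exact: sq_wave|exact: sq_wave].
rewrite mulr_sumr /zsum_upto dotc_suml; apply: eq_bigr => k _.
by rewrite phi_ip// /cfun mulrC dotcZl.
Qed.

Variable C : R.
Hypotheses (C0 : 0 < C)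
  (C1 : forall N a, sqnorm N a <= C * ip wband (tsum x N a) (tsum x N a))
  (C2 : forall N a, ip wband (tsum x N a) (tsum x N a) <= C * sqnorm N a).

(** The constant comes from (A3) and depends on [phi]. It serves for convergence in [N] at fixed
    [phi]; bounds uniform in the family come from (H2). *)
Lemma energy_bound : A3 phi -> exists2 K : R, 0 < K &
  forall N a, ip ph (tsum x N a) (tsum x N a) <= K * sqnorm N a.
Proof.
move=> h3; have [B B0 hB] := sum_upto_M h3; exists ((B + 1) * C).
  by rewrite mulr_gt0// ltr_pwDr.
move=> N a; rewrite -mulrA; apply: (weight_bound (Wk := M_ phi)) => //.
- exact: ltW.
- exact: weight_rfourier.
- exact: integr_rfourier.
- exact: M_ge0.
- exact: rfourier_le_M.
- by move=> K; apply: (le_trans (hB K)); rewrite lerDl.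
Qed.

(** Makes the wave at a node an admissible test function in the Euler equation. *)
Lemma tsum_delta (i : int) w : tsum x `|i|%N (fun j => if j == i then w else 0) = wave w (x i).
Proof.
apply/funext => xi; rewrite /tsum.
rewrite (@eq_sum_upto _ _ _ (fun j => if j == i then wave w (x i) xi else 0)) ?sum_upto_delta//.
by move=> j _; case: eqP => [->//|]; rewrite /wave mul0r.
Qed.

Hypothesis phi3 : A3 phi.

Lemma ip_tsum_close K : 0 < K ->
  (forall N a, ip ph (tsum x N a) (tsum x N a) <= K * sqnorm N a) ->
  forall N a w t (e : R), sqnorm N a <= e ->
  `|ip ph (tsum x N a) (wave w t)| <= Num.sqrt (K * e) * Num.sqrt (ip ph (wave w t) (wave w t)).
Proof.
move=> K0 hK N a w t e ne.
have wp := weight_rfourier phi1 phi2; have ip_ := integr_rfourier phi1.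
apply: (le_trans (ip_CSn wp _ _)); [exact: sq_tsum|exact: sq_wave|].
apply: ler_wpM2r; first exact: sqrtr_ge0.
by apply: ler_wsqrtr; apply: (le_trans (hK _ _)); rewrite ler_pM2l.
Qed.

Lemma tsumB_cut N M a b : (N <= M)%N ->
  tsum x M (fun j => a j - cut N b j) = (fun xi => tsum x M a xi - tsum x N b xi).
Proof. by move=> NM; apply/funext => xi; rewrite tsumB tsum_cut. Qed.

Lemma sqnorm_tail N M (a : int -> R[i]) : (N <= M)%N ->
  sqnorm M (fun j => a j - cut N a j) = sqnorm M a - sqnorm N a.
Proof.
move=> NM; rewrite -(sqnorm_cut a NM) -sum_uptoB; apply: eq_sum_upto => j _.
by rewrite /cut; case: ifP => _; rewrite ?subrr ?subr0 ?dotc0l ?subr0 ?subrr.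
Qed.

(** [zsum] takes limits without asserting that they exist. For coefficients in l2 the energy bound
    makes the pairings Cauchy; testing with 1 and i gives the real and imaginary parts. *)
Lemma shifts_cvg a t w : l2 a ->
  fourier_cst * ip ph (tsum x N a) (wave w t) @[N --> \oo] --> dotc (shifts phi x a t) w.
Proof.
move=> la; have [K K0 hK] := energy_bound phi3.
have wp := weight_rfourier phi1 phi2; have ip_ := integr_rfourier phi1.
have cvu v : cvg ((fun N => fourier_cst * ip ph (tsum x N a) (wave v t)) @ \oo).
  apply: real_cauchy_cvg => e e0.
  pose q := Num.sqrt (ip ph (wave v t) (wave v t)).
  have q0 : 0 <= q by exact: sqrtr_ge0.
  (* Makes [fourier_cst * (d * q)] at most [e]; the 1 covers q = 0. *)
  pose d := e / (fourier_cst * (q + 1)).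
  have cq : 0 < fourier_cst * (q + 1) by rewrite mulr_gt0 ?fourier_cst_gt0// ltr_pwDr.
  have d0 : 0 < d by rewrite divr_gt0.
  have d20 : 0 < d ^+ 2 / K by rewrite divr_gt0// exprn_gt0.
  have [N0 hN] := l2_cauchy la d20; exists N0 => n Nn.
  have ne : sqnorm n (fun j => a j - cut N0 a j) <= d ^+ 2 / K.
    by rewrite sqnorm_tail// lerBlDl hN.
  have := ip_tsum_close K0 hK v t ne; rewrite tsumB_cut// ipBl//;
    try exact: sq_tsum; try exact: sq_wave.
  rewrite -/q [K * _]mulrC divfK ?gt_eqF// sqrtr_sqr (gtr0_norm d0) => h.
  rewrite -mulrBr normrM (gtr0_norm fourier_cst_gt0).
  apply: (le_trans (ler_wpM2l (ltW fourier_cst_gt0) h)).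
  have q1 : 0 < q + 1 by rewrite ltr_pwDr.
  have -> : fourier_cst * (d * q) = e * (q / (q + 1)).
    by rewrite /d; field; rewrite !gt_eqF ?fourier_cst_gt0.
  by rewrite ler_piMr ?(ltW e0)// ler_pdivrMr// mul1r lerDl.
have cR := cvu 1; have cI := cvu (0 +i* 1).
pose u N := zsum_upto (fun j => a j * cfun phi (t - x j)) N.
have uR : (fun N => fourier_cst * ip ph (tsum x N a) (wave 1 t)) = (fun N => complex.Re (u N)).
  apply/funext => N; rewrite -dotc_shifts_partial -/(u N) /dotc /=; ring.
have uI : (fun N => fourier_cst * ip ph (tsum x N a) (wave (0 +i* 1) t)) = (fun N => complex.Im (u N)).
  apply/funext => N; rewrite -dotc_shifts_partial -/(u N) /dotc /=; ring.
rewrite uR in cR; rewrite uI in cI.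
rewrite (_ : (fun N => _) = fun N => complex.Re (u N) * complex.Re w
    + complex.Im (u N) * complex.Im w); last first.
  by apply/funext => N; rewrite -dotc_shifts_partial.
rewrite /shifts /zsum -/(u _) /dotc /=.
by apply: cvgD; apply: cvgM; try exact: cvg_cst; [exact: cR|exact: cI].
Qed.

Lemma shifts_bound K : 0 < K ->
  (forall N a, ip ph (tsum x N a) (tsum x N a) <= K * sqnorm N a) ->
  forall a N b t w (e : R), l2 a -> (forall M, sqnorm M (fun j => a j - cut N b j) <= e) ->
  `|dotc (shifts phi x a t) w - fourier_cst * ip ph (tsum x N b) (wave w t)| <=
   fourier_cst * (Num.sqrt (K * e) * Num.sqrt (ip ph (wave w t) (wave w t))).
Proof.
move=> K0 hK a N b t w e la ne.
have wp := weight_rfourier phi1 phi2; have ip_ := integr_rfourier phi1.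
have h : `|fourier_cst * ip ph (tsum x M a) (wave w t) - fourier_cst * ip ph (tsum x N b) (wave w t)| @[M --> \oo]
    --> `|dotc (shifts phi x a t) w - fourier_cst * ip ph (tsum x N b) (wave w t)|.
  by apply: cvg_norm; apply: cvgB; [exact: shifts_cvg|exact: cvg_cst].
apply: (ler_cvg_to h (cvg_cst _)).
exists N => // M /= NM; have := ip_tsum_close K0 hK w t (ne M).
rewrite tsumB_cut// ipBl//; try exact: sq_tsum; try exact: sq_wave.
by rewrite -mulrBr normrM (gtr0_norm fourier_cst_gt0); apply: ler_wpM2l; exact: ltW fourier_cst_gt0.
Qed.

(** A minimising sequence of trigonometric sums is Cauchy in L^2(phihat), hence on the band, where
    phihat >= m, hence in its coefficients by the lower Riesz bound. The Euler equation tested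
    against the wave at [x i] is the interpolation condition there. *)
Lemma interpolant_exists (f F : R -> R[i]) : sq wband F ->
  (forall w t, fourier_cst * ip wband F (wave w t) = dotc (f t) w) ->
  exists a, interpolates phi x f a.
Proof.
move=> sF Ff; have [K K0 hK] := energy_bound phi3.
have wp := weight_rfourier phi1 phi2; have ip_ := integr_rfourier phi1.
have wb := @weight_band R; have ib := @integr_band R.
have m0 := m_gt0; have mi0 : 0 < (m_ phi)^-1 by rewrite invr_gt0.
pose P : set (R -> R[i]) := [set g | exists N a, g = tsum x N a].
have Psq g : P g -> sq ph g /\ sq wband g.
  by move=> [N [a ->]]; split; exact: sq_tsum.
have bm g : P g -> ip wband g g <= (m_ phi)^-1 * ip ph g g.
  move=> /Psq[s1 s2]; by have [_] := ip_le wb wp s1 m_band.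
(* Coercivity constant: Cauchy-Schwarz on the band, where the squared norm of a sum is at most 1 / m
   times its energy. *)
have [] := @variational _ ph wband P F (ip wband F F / m_ phi) wp wb sF.
- by exists (tsum x 0 (fun=> 0)); exists 0%N, (fun=> 0).
- exact: Psq.
- move=> _ _ k l [N [a ->]] [M [b ->]].
  exists (maxn N M), (fun j => k%:C * cut N a j + l%:C * cut M b j).
  apply/funext => t; rewrite tsumD (tsumZ _ _ _ (cut N a)) (tsumZ _ _ _ (cut M b)).
  by rewrite !tsum_cut ?leq_maxl ?leq_maxr.
- by rewrite divr_ge0 ?ip_ge0// ltW.
- move=> g Pg; have [s1 s2] := Psq _ Pg.
  apply: (le_trans (ip_CS wb sF s2)); rewrite -mulrA.
  by apply: ler_wpM2l; [exact: ip_ge0|exact: bm].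
move=> v [/choice[Nn /choice[an vE]] vcauchy veuler].
pose b n := cut (Nn n) (an n).
pose D := C * (m_ phi)^-1 * 2.
have bD M n m : sqnorm M (fun j => b n j - b m j) <= D * (n.+1%:R^-1 + m.+1%:R^-1).
  pose M' := maxn M (maxn (Nn n) (Nn m)).
  have h1 : (M <= M')%N by exact: leq_maxl.
  have h2 : (Nn n <= M')%N by rewrite /M' !leq_max leqnn orbT.
  have h3 : (Nn m <= M')%N by rewrite /M' !leq_max leqnn !orbT.
  apply: (le_trans (sqnorm_mono _ h1)); apply: (le_trans (C1 _ _)).
  rewrite tsumB_cut// tsum_cut// -!vE /D -!mulrA ler_pM2l//.
  have Pd : P (fun t => v n t - v m t).
    exists M', (fun j => b n j - b m j).
    by rewrite tsumB_cut// tsum_cut// -!vE.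
  by apply: (le_trans (bm _ Pd)); rewrite ler_pM2l.
have [a ha] := l2_complete bD.
have la : l2 a by apply: l2_of_close (ha 0%N).
exists a; split => // i; apply: dotc_ext => w.
rewrite -Ff; apply/eqP; rewrite -subr_eq0 -normr_le0.
pose q := Num.sqrt (ip ph (wave w (x i)) (wave w (x i))).
(* Two errors, both vanishing with n: the distance from [a] to the coefficients of [v n], and the
   failure of [v n] to solve the Euler equation exactly. *)
have hn n : `|dotc (shifts phi x a (x i)) w - fourier_cst * ip wband F (wave w (x i))| <=
    fourier_cst * (Num.sqrt (K * (D * n.+1%:R^-1)) * q) +
    fourier_cst * (Num.sqrt (n.+1%:R^-1) * q).
  have s1 := shifts_bound K0 hK (x i) w la (ha n).
  rewrite -vE in s1.
  have Pe : P (wave w (x i)) by rewrite -tsum_delta; do 2 eexists.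
  have s2 := veuler n _ Pe.
  rewrite -(subrKA (fourier_cst * ip ph (v n) (wave w (x i)))).
  apply: (le_trans (ler_normD _ _)); apply: lerD; first exact: s1.
  rewrite -mulrBr normrM (gtr0_norm fourier_cst_gt0); apply: ler_wpM2l; first exact: ltW fourier_cst_gt0.
  by rewrite -sqrtr_sqr /q -sqrtrM ?ler_wsqrtr// invr_ge0.
have cv : fourier_cst * (Num.sqrt (K * (D * n.+1%:R^-1)) * q) + fourier_cst * (Num.sqrt (n.+1%:R^-1) * q)
    @[n --> \oo] --> fourier_cst * (Num.sqrt (K * (D * 0)) * q) + fourier_cst * (Num.sqrt 0 * q).
  apply: cvgD; (apply: cvgM; first exact: cvg_cst); (apply: cvgM; last exact: cvg_cst).
    apply: continuous_cvg; first exact: sqrt_continuous.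
    by apply: cvgM; [exact: cvg_cst|apply: cvgM; [exact: cvg_cst|exact: cvg_harmonic]].
  by apply: continuous_cvg; [exact: sqrt_continuous|exact: cvg_harmonic].
rewrite !mulr0 sqrtr0 !mul0r !mulr0 addr0 in cv.
by apply: (ler_cvg_to (cvg_cst _) cv); exact: nearW.
Qed.

End one_interpolator.

(** * The interpolation error *)

Section error_estimate.
Context {R : realType}.
Local Notation mu := (@lebesgue_measure R).

(** [u] is tested against sums S within e of itself: |u|^2 = <u, S> + <u, u - S> <= kappa |S| + e
    |u|, with |S| <= |u| + e. *)
Lemma band_density (x : int -> R) (u : R -> R[i]) (kappa : R) :
  complete_interpolating x -> sq wband u -> 0 <= kappa ->
  (forall N b, `|ip wband u (tsum x N b)| <= kappa * Num.sqrt (ip wband (tsum x N b) (tsum x N b))) ->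
  ip wband u u <= kappa ^+ 2.
Proof.
move=> [hd _] su k0 hk; have wb := @weight_band R.
have lu : L2 band u.
  case: (su) => -[m1 m2] _; split.
  - exact: measurable_funTS.
  - exact: measurable_funTS.
  - by rewrite (L2norm_sq su) ltry.
have qu0 := ip_ge0 u wb.
pose U := Num.sqrt (ip wband u u).
have U0 : 0 <= U by exact: sqrtr_ge0.
have UE : U ^+ 2 = ip wband u u by exact: sqr_sqrtr.
have H e : 0 < e -> U ^+ 2 <= kappa * U + e * (U + kappa).
  move=> e0; have [c [n hc]] := hd _ lu _ e0.
  set S := tsum x n c.
  have sS : sq wband S by apply: sq_tsum => //; exact: integr_band.
  have sD : sq wband (fun t => u t - S t) by exact: sqB.
  move: hc; rewrite (L2norm_sq sD) lte_fin.
  have qD0 := ip_ge0 (fun t => u t - S t) wb.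
  set d := Num.sqrt _ => de.
  have d0 : 0 <= d by exact: sqrtr_ge0.
  have dE : d ^+ 2 = ip wband (fun t => u t - S t) (fun t => u t - S t) by exact: sqr_sqrtr.
  have h1 := ip_CSn wb su sD; rewrite -/U -/d in h1.
  have E1 : ip wband u (fun t => u t - S t) = U ^+ 2 - ip wband u S by rewrite ipBr// UE.
  have E2 : d ^+ 2 = U ^+ 2 - 2 * ip wband u S + ip wband S S.
    by rewrite dE ipBl// !ipBr// UE (ipC wband S u); ring.
  have s2 : ip wband S S <= (U + e) ^+ 2.
    have : ip wband S S = d ^+ 2 - U ^+ 2 + 2 * ip wband u S by rewrite E2; ring.
    move=> ->; move: h1; rewrite E1 ler_norml => /andP[h1 _].
    have : U * d <= U * e by apply: ler_wpM2l => //; exact: ltW.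
    have : d ^+ 2 <= e ^+ 2 by rewrite ler_pXn2r ?nnegrE ?(ltW e0)// ltW.
    nra.
  have s3 : Num.sqrt (ip wband S S) <= U + e.
    have : Num.sqrt (ip wband S S) <= Num.sqrt ((U + e) ^+ 2) by exact: ler_wsqrtr.
    by rewrite sqrtr_sqr ger0_norm// addr_ge0// ltW.
  have h2 : ip wband u S <= kappa * (U + e).
    apply: (le_trans (ler_norm _)); apply: (le_trans (hk _ _)).
    exact: ler_wpM2l.
  move: h1; rewrite E1 => /(le_trans (ler_norm _)) h1.
  have : U * d <= U * e by apply: ler_wpM2l => //; exact: ltW.
  lra.
have {}H : U ^+ 2 <= kappa * U.
  apply/ler_addgt0Pr => e e0.
  have Uk : 0 < U + kappa + 1 by rewrite ltr_pwDr// addr_ge0.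
  have := H (e / (U + kappa + 1)); rewrite divr_gt0// => /(_ isT) /le_trans; apply.
  rewrite lerD2l mulrAC ler_pdivrMr// ler_wpM2l ?(ltW e0)//; lra.
rewrite -UE; nra.
Qed.

Variables (phi : R -> R).
Hypotheses (phi1 : A1 phi) (phi2 : A2 phi) (phi3 : A3 phi).
Local Notation ph := (rfourier phi).
Variables (x : int -> R) (C H : R).
Hypotheses (C0 : 0 < C) (xCIS : complete_interpolating x)
  (C1 : forall N a, sqnorm N a <= C * ip wband (tsum x N a) (tsum x N a))
  (C2 : forall N a, ip wband (tsum x N a) (tsum x N a) <= C * sqnorm N a)
  (H2 : forall K, sum_upto K (M_off phi) <= H * m_ phi).
Variables (f F : R -> R[i]).
Hypotheses (F1 : L1 F) (F2 : sq wband F) (F0 : forall xi, ~ band xi -> F xi = 0)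
  (Ff : forall w t, fourier_cst * ip wband F (wave w t) = dotc (f t) w).
Variable a : int -> R[i].
Hypothesis ha : interpolates phi x f a.
Local Notation S := (tsum x ^~ a).

Let wp := weight_rfourier phi1 phi2.
Let ip_ := integr_rfourier phi1.
Let wb := @weight_band R.
Let ib := @integr_band R.
Let wo := weight_off phi1 phi2.
Let io := integr_off phi1 phi2.
Let m0 : 0 < m_ phi := m_gt0 phi2.
Let la : l2 a := ha.1.

Let Hm0 : 0 <= H * m_ phi.
Proof.
apply: (le_trans _ (H2 0)); apply: sum_upto_ge0 => j; exact: M_off_ge0.
Qed.

Lemma ip_tsum (W : R -> R) g N b : weight W -> sq W g -> (forall w t, sq W (wave w t)) ->
  ip W g (tsum x N b) = sum_upto N (fun j => ip W g (wave (b j) (x j))).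
Proof.
move=> hW sg sez; rewrite ipC /tsum /sum_upto ip_suml//.
by apply: eq_bigr => k _; rewrite ipC.
Qed.

(** For a single wave this is the interpolation condition at its node; finite sums follow by
    additivity. *)
Lemma interpolation_weak N b :
  ip ph (S M) (tsum x N b) @[M --> \oo] --> ip wband F (tsum x N b).
Proof.
rewrite ip_tsum//; last by move=> w t; exact: sq_wave.
rewrite (_ : (fun M => _) = fun M => sum_upto N (fun j => ip ph (S M) (wave (b j) (x j)))); last first.
  by apply/funext => M; rewrite ip_tsum//; [exact: sq_tsum|move=> w t; exact: sq_wave].
apply: cvg_sum_upto => j.
have h := @shifts_cvg _ _ phi1 phi2 x C C0 C2 phi3 a (x j) (b j) la.
rewrite ha.2 -Ff in h.
have cn : fourier_cst != 0 :> R by rewrite gt_eqF// fourier_cst_gt0.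
rewrite -[ip wband F _](mulKf cn) (_ : (fun M => ip ph _ _) =
  fun M => fourier_cst^-1 * (fourier_cst * ip ph (S M) (wave (b j) (x j)))); last first.
  by apply/funext => M; rewrite mulKf.
by apply: cvgM; [exact: cvg_cst|exact: h].
Qed.

(** By Cauchy-Schwarz in the energy only the l2 tail of [a] enters, so the weak limit is uniform
    over test sums of any length. Both the density argument and the choice of [S N] itself as test
    need this uniformity. *)
Lemma weak_error tau : 0 < tau -> exists N0, forall N, (N0 <= N)%N ->
  forall N' b, `|ip wband F (tsum x N' b) - ip ph (S N) (tsum x N' b)| <= tau * Num.sqrt (sqnorm N' b).
Proof.
move=> t0; have [K K0 hK] := energy_bound phi1 phi2 C0 C2 phi3.
(* Each of the two energies contributes a factor [Num.sqrt K], and K (tau / K) = tau. *)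
have e0 : 0 < (tau / K) ^+ 2 by rewrite exprn_gt0// divr_gt0.
have [N0 hN0] := l2_cauchy la e0; exists N0 => N N0N N' b.
have h : `|ip ph (S M) (tsum x N' b) - ip ph (S N) (tsum x N' b)| @[M --> \oo]
    --> `|ip wband F (tsum x N' b) - ip ph (S N) (tsum x N' b)|.
  by apply: cvg_norm; apply: cvgB; [exact: interpolation_weak|exact: cvg_cst].
apply: (ler_cvg_to h (cvg_cst _)); exists N => // M /= NM.
have sM N1 b1 : sq ph (tsum x N1 b1) by exact: sq_tsum.
have E : ip ph (S M) (tsum x N' b) - ip ph (S N) (tsum x N' b) =
    ip ph (tsum x M (fun j => a j - cut N a j)) (tsum x N' b) by rewrite tsumB_cut// ipBl.
rewrite E; apply: (le_trans (ip_CSn wp _ _)) => //.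
have h1 : ip ph (tsum x M (fun j => a j - cut N a j)) (tsum x M (fun j => a j - cut N a j))
    <= K * (tau / K) ^+ 2.
  apply: (le_trans (hK _ _)); rewrite ler_pM2l// sqnorm_tail// lerBlDl; exact: hN0.
have h2 := hK N' b.
apply: (le_trans (ler_pM _ _ (ler_wsqrtr h1) (ler_wsqrtr h2))); rewrite ?sqrtr_ge0//.
rewrite [Num.sqrt (K * (tau / K) ^+ 2)]sqrtrM ?(ltW K0)//.
rewrite [Num.sqrt (K * sqnorm N' b)]sqrtrM ?(ltW K0)//.
rewrite sqrtr_sqr ger0_norm; last by rewrite divr_ge0 ?(ltW t0) ?(ltW K0).
have := sqr_sqrtr (ltW K0); set k := Num.sqrt K => kE.
rewrite le_eqVlt; apply/orP; left; apply/eqP.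
transitivity (k ^+ 2 * (tau / K) * Num.sqrt (sqnorm N' b)); first by ring.
by rewrite kE mulrCA divff ?mulr1// gt_eqF.
Qed.

(** m times the squared norm of F / phihat in L^2(phihat) over the band, F / phihat being the
    solution of the problem without aliasing. *)
Definition defect : R := \int[mu]_xi (wband xi * dotc (F xi) (F xi) * (m_ phi / ph xi)).

Lemma ratio_le1 xi : wband xi * (m_ phi / ph xi) <= wband xi.
Proof.
rewrite /wband indicE; have [/set_mem xb|] := boolP (xi \in band); last by rewrite !mul0r.
have h := m_le phi2 xb.
by rewrite mul1r ler_pdivrMr ?mul1r// (lt_le_trans m0).
Qed.

Lemma ratio_ge0 xi : 0 <= m_ phi / ph xi.
Proof. by rewrite divr_ge0 ?(ltW m0)// rfourier_ge0. Qed.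

Lemma measurable_ratio : measurable_fun setT (fun xi => m_ phi / ph xi).
Proof.
rewrite (_ : (fun xi => _) = fun xi => m_ phi * (ph xi `^ (-1))); last first.
  by apply/funext => xi; rewrite powR_inv1// rfourier_ge0.
apply: measurable_funM => //.
by apply: (measurableT_comp (measurable_powR _)); case: wp.
Qed.

Lemma integr_defect : integr (fun xi => wband xi * dotc (F xi) (F xi) * (m_ phi / ph xi)).
Proof.
have [mF iF] := F2; apply: (integr_le _ _ iF).
  by apply: measurable_funM; [exact: integr_meas iF|exact: measurable_ratio].
move=> t; have q0 := dotcc_ge0 (F t); have w0 := wb.2 t.
rewrite ger0_norm; last by rewrite mulr_ge0 ?ratio_ge0// mulr_ge0.
by rewrite mulrAC; apply: ler_wpM2r => //; exact: ratio_le1.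
Qed.

(** Half of the band energy, produced by AM-GM, is absorbed by the energy on the other side, whose
    part off the band is dropped. *)
Lemma energy_estimate N (eps : R) :
  `|ip wband F (S N) - ip ph (S N) (S N)| <= eps ->
  m_ phi ^+ 2 * ip wband (S N) (S N) <= defect + 2 * m_ phi * eps.
Proof.
move=> he; have sp : sq ph (S N) by exact: sq_tsum.
have sb : sq wband (S N) by exact: sq_tsum.
pose Wp xi := wband xi * ph xi.
have wW : weight Wp.
  split; last by move=> t; rewrite mulr_ge0 ?wb.2 ?wp.2.
  by apply: measurable_funM; [case: wb|case: wp].
have W1 t : Wp t <= 1 * ph t.
  by rewrite ler_wpM2r ?wp.2// /wband indicE lern1 leq_b1.
have [sW hW] := ip_le wW wp sp W1.
have hm : ip wband (S N) (S N) <= (m_ phi)^-1 * ip Wp (S N) (S N).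
  have W2 t : wband t <= (m_ phi)^-1 * Wp t.
    rewrite /Wp /wband indicE; have [/set_mem tb|] := boolP (t \in band); last by rewrite mul0r mulr0.
    by rewrite mul1r mulrC ler_pdivlMr// mul1r m_le.
  by have [_] := ip_le wb wW sW W2.
(* AM-GM: [dotc F S <= |F|^2 / (2 phihat) + phihat |S|^2 / 2]. *)
have hAG : ip wband F (S N) <= 2^-1 * ((m_ phi)^-1 * defect) + 2^-1 * ip Wp (S N) (S N).
  have iD := integrZ 2^-1 (integrZ (m_ phi)^-1 integr_defect).
  have iW := integrZ 2^-1 sW.2.
  rewrite -(RintegralZl _ measurableT integr_defect).
  rewrite -(RintegralZl _ measurableT (integrZ _ integr_defect)).
  rewrite -(RintegralZl _ measurableT sW.2) -(RintegralD measurableT iD iW).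
  apply: le_Rintegral => //; [exact: ip_integr|exact: integrD|].
  move=> t _; rewrite /Wp /wband indicE.
  have [/set_mem tb|] := boolP (t \in band); last by rewrite !mul0r !mulr0 addr0.
  have p0 : 0 < ph t by apply: (lt_le_trans m0); exact: m_le.
  have := dotcc_ge0 (F t - (ph t)%:C * S N t).
  rewrite !(dotcBl, dotcBr) !(dotcZl, dotcZr) (dotcC (S N t) (F t)) => h.
  rewrite !mul1r -(ler_pM2l p0).
  have -> : ph t * (2^-1 * ((m_ phi)^-1 * (dotc (F t) (F t) * (m_ phi / ph t))) +
     2^-1 * (ph t * dotc (tsum x N a t) (tsum x N a t))) =
     2^-1 * dotc (F t) (F t) + 2^-1 * (ph t * (ph t * dotc (tsum x N a t) (tsum x N a t))).
    by field; rewrite !gt_eqF.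
  lra.
have h1 : ip Wp (S N) (S N) <= (m_ phi)^-1 * defect + 2 * eps.
  move: he; rewrite ler_norml => /andP[he _]; lra.
have {}hm : m_ phi * ip wband (S N) (S N) <= ip Wp (S N) (S N).
  by rewrite -ler_pdivlMl.
have : m_ phi * (m_ phi * ip wband (S N) (S N)) <= m_ phi * ((m_ phi)^-1 * defect + 2 * eps).
  by rewrite ler_pM2l//; apply: le_trans h1.
rewrite mulrDr mulVKf ?gt_eqF//; lra.
Qed.

Lemma tsum_bounded N b : exists2 B, 0 <= B &
  forall xi, dotc (tsum x N b xi) (tsum x N b xi) <= B.
Proof.
rewrite /tsum; have [B B0 hB] : exists2 B, 0 <= B & forall xi,
  dotc (\sum_(j <- int_upto N) wave (b j) (x j) xi) (\sum_(j <- int_upto N) wave (b j) (x j) xi) <= B.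
  elim: (int_upto N) => [|j s [B B0 hB]].
    by exists 0 => // xi; rewrite big_nil dotc0l.
  exists (2 * dotc (b j) (b j) + 2 * B).
    by rewrite addr_ge0// mulr_ge0// dotcc_ge0.
  move=> xi; rewrite big_cons; apply: (le_trans (dotcD_le _ _)).
  by rewrite dotc_wave lerD2l ler_pM2l.
by exists B => // xi; rewrite sum_upto_int_upto.
Qed.

(** One [C] bounds the sum on a translate by its coefficients, the other bounds the coefficients by
    the sum on the band. *)
Let E := H * m_ phi * C ^+ 2.

Let E0 : 0 <= E.
Proof. by rewrite /E mulr_ge0// exprn_ge0// ltW. Qed.

Lemma off_energy N b :
  ip (off_weight phi) (tsum x N b) (tsum x N b) <= E * ip wband (tsum x N b) (tsum x N b).
Proof.
have h : ip (off_weight phi) (tsum x N b) (tsum x N b) <= H * m_ phi * (C * sqnorm N b).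
  apply: (weight_bound (Wk := M_off phi)) => //.
  - exact: ltW.
  - exact: M_off_ge0.
  - exact: off_weight_M_off.
apply: (le_trans h); rewrite /E -[leRHS]mulrA; apply: ler_wpM2l => //.
by rewrite expr2 -mulrA ler_pM2l.
Qed.

Definition residual N xi : R[i] := F xi - (ph xi)%:C * S N xi.

Lemma L1_rfourier_tsum N : L1 (fun xi => (ph xi)%:C * S N xi).
Proof.
have [B B0 hB] := tsum_bounded N a; have [mS _] := sq_tsum x N a wp ip_.
have mpS : measc (fun xi => (ph xi)%:C * S N xi).
  by apply: meascM => //; apply: measc_real; case: wp.
have h (p : R[i] -> R) : (forall r z, p (r%:C * z) = r * p z) ->
    (forall z, p z ^+ 2 <= dotc z z) -> measurable_fun setT (p \o (fun xi => (ph xi)%:C * S N xi)) ->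
    integr (p \o (fun xi => (ph xi)%:C * S N xi)).
  move=> pZ pd mp; apply: (integr_le mp _ (integrZ (1 + B) ip_)) => t /=.
  rewrite pZ normrM (ger0_norm (wp.2 t)) mulrC; apply: ler_wpM2r; first exact: wp.2.
  have := le_trans (pd _) (hB t); rewrite -real_normK ?num_real//.
  have := sqr_ge0 (`|p (S N t)| - 1); nra.
split; apply: h.
- by move=> r z; rewrite cReM /=; ring.
- by move=> z; rewrite /dotc -!expr2 lerDl sqr_ge0.
- by case: mpS.
- by move=> r z; rewrite cImM /=; ring.
- by move=> z; rewrite /dotc -!expr2 lerDr sqr_ge0.
- by case: mpS.
Qed.

Lemma sq_rfourier_tsum N : sq wband (fun xi => (ph xi)%:C * S N xi).
Proof.
have [B B0 hB] := tsum_bounded N a; have [P hP] := rfourier_bounded phi1.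
apply: (@sq_bounded _ _ _ (P ^+ 2 * B)) => //; first exact: L1_measc (L1_rfourier_tsum N).
move=> t; rewrite dotcZl dotcZr mulrA -expr2.
apply: ler_pM => //; [exact: sqr_ge0|exact: dotcc_ge0|].
have p0 := wp.2 t; by rewrite ler_pXn2r// nnegrE// (le_trans p0).
Qed.

Lemma sq_residual N : sq wband (residual N).
Proof. by apply: sqB => //; exact: sq_rfourier_tsum. Qed.

(** Over the band, <phihat S_N, g> is the full energy pairing less its part off the band. The former
    is close to <F, g> by hypothesis; the latter is at most E |S_N| |g| by Cauchy-Schwarz and
    [off_energy] for both factors. *)
Lemma residual_band N (tau : R) : 0 <= tau ->
  (forall N' b, `|ip wband F (tsum x N' b) - ip ph (S N) (tsum x N' b)| <= tau * Num.sqrt (sqnorm N' b)) ->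
  ip wband (residual N) (residual N) <=
    (tau * Num.sqrt C + E * Num.sqrt (ip wband (S N) (S N))) ^+ 2.
Proof.
move=> t0 ht; apply: (band_density xCIS).
- exact: sq_residual.
- by rewrite addr_ge0// mulr_ge0// sqrtr_ge0.
move=> M b.
have sp : sq ph (tsum x M b) by exact: sq_tsum.
have spN : sq ph (S N) by exact: sq_tsum.
have sb : sq wband (tsum x M b) by exact: sq_tsum.
have so : sq (off_weight phi) (tsum x M b) by exact: sq_tsum.
have soN : sq (off_weight phi) (S N) by exact: sq_tsum.
have e1 : ip wband (fun xi => (ph xi)%:C * S N xi) (tsum x M b) =
    ip ph (S N) (tsum x M b) - ip (off_weight phi) (S N) (tsum x M b).
  rewrite -(RintegralB measurableT (ip_integr wp spN sp) (ip_integr wo soN so)).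
  apply: eq_Rintegral => t _; rewrite dotcZl /wband /off_weight !indicE in_setC.
  by case: (t \in band) => /=; ring.
have -> : ip wband (residual N) (tsum x M b) =
    (ip wband F (tsum x M b) - ip ph (S N) (tsum x M b)) + ip (off_weight phi) (S N) (tsum x M b).
  by rewrite ipBl ?e1//; [ring|exact: sq_rfourier_tsum].
apply: (le_trans (ler_normD _ _)); rewrite mulrDl; apply: lerD.
  apply: (le_trans (ht M b)); rewrite -mulrA; apply: ler_wpM2l => //.
  by rewrite -sqrtrM ?(ltW C0)// ler_wsqrtr.
apply: (le_trans (ip_CSn wo soN so)).
have h1 := off_energy N a; have h2 := off_energy M b.
apply: (le_trans (ler_pM _ _ (ler_wsqrtr h1) (ler_wsqrtr h2))); rewrite ?sqrtr_ge0//.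
rewrite [Num.sqrt (E * ip wband (S N) _)]sqrtrM//.
rewrite [Num.sqrt (E * ip wband (tsum x M b) _)]sqrtrM//.
have := sqr_sqrtr E0; set k := Num.sqrt E => kE.
by rewrite -kE le_eqVlt; apply/orP; left; apply/eqP; ring.
Qed.

(** On the band, squaring gives 2 E^2 = 2 H^2 m^2 C^4. Off the band the residual is -phihat S_N,
    with phihat squared: one factor is at most H m pointwise, the other is the weight of
    [off_energy], whence H^2 m^2 C^2. The factor m^2 is the one that [energy_estimate] controls. *)
Lemma residual_L2 N (tau : R) : 0 <= tau ->
  (forall N' b, `|ip wband F (tsum x N' b) - ip ph (S N) (tsum x N' b)| <= tau * Num.sqrt (sqnorm N' b)) ->
  integr (fun xi => dotc (residual N xi) (residual N xi)) /\
  \int[mu]_xi dotc (residual N xi) (residual N xi) <=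
    2 * tau ^+ 2 * C + (2 * H ^+ 2 * C ^+ 4 + H ^+ 2 * C ^+ 2) *
      (defect + 2 * m_ phi * (tau * Num.sqrt (sqnorm N a))).
Proof.
move=> t0 ht.
have [mr ir] := sq_residual N.
have soN : sq (off_weight phi) (S N) by exact: sq_tsum.
have ioS := ip_integr wo soN soN.
pose Z xi := ph xi * (off_weight phi xi * dotc (S N xi) (S N xi)).
have hZ xi : 0 <= Z xi <= H * m_ phi * (off_weight phi xi * dotc (S N xi) (S N xi)).
  have w0 := wo.2 xi; have d0 := dotcc_ge0 (S N xi); have p0 := wp.2 xi.
  rewrite /Z mulr_ge0//=; last exact: mulr_ge0.
  have := rfourier_off phi1 phi2 H2 xi; move: w0; rewrite /off_weight indicE.
  case: (_ \in _) => /=; last by rewrite !mulr0 !mul0r !mulr0.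
  by rewrite !mulr1 => w0 h; apply: ler_wpM2r => //; exact: mulr_ge0.
have iZ : integr Z.
  apply: (integr_le _ _ (integrZ (H * m_ phi) ioS)) => [|t].
    by apply: measurable_funM; [case: wp|exact: integr_meas ioS].
  by case/andP: (hZ t) => z0 zl; rewrite ger0_norm.
have Es xi : wband xi * dotc (residual N xi) (residual N xi) + Z xi =
    dotc (residual N xi) (residual N xi).
  rewrite /Z /off_weight /wband !indicE in_setC /residual.
  have [/set_mem tb|/negP tb] := boolP (xi \in band) => /=; first by ring.
  rewrite F0 ?sub0r ?dotcNl ?dotcNr ?dotcZl ?dotcZr; first ring.
  by move=> h; apply: tb; rewrite inE.
have iR : integr (fun xi => dotc (residual N xi) (residual N xi)).
  by apply: eq_integr Es _; exact: integrD.
split => //.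
have -> : \int[mu]_xi dotc (residual N xi) (residual N xi) =
    ip wband (residual N) (residual N) + \int[mu]_xi Z xi.
  by rewrite -(RintegralD measurableT ir iZ); apply: eq_Rintegral => xi _; rewrite Es.
have hZi : \int[mu]_xi Z xi <= H * m_ phi * (E * ip wband (S N) (S N)).
  apply: (@le_trans _ _ (H * m_ phi * ip (off_weight phi) (S N) (S N))).
    rewrite -(RintegralZl _ measurableT ioS); apply: le_Rintegral => //.
      exact: integrZ.
    by move=> t _; case/andP: (hZ t).
  by apply: ler_wpM2l => //; exact: off_energy.
have hb := residual_band t0 ht.
have he := energy_estimate (ht N a).
have q0 := ip_ge0 (S N) wb.
have := sqr_sqrtr q0; have := sqr_sqrtr (ltW C0).
move: hb hZi he; rewrite /E.
move: (ip wband (residual N) (residual N)) (\int[mu]_xi Z xi) (ip wband (S N) (S N)) q0 => A B q q0.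
move: (Num.sqrt C) (Num.sqrt q) (Num.sqrt (sqnorm N a)) => rc rq rn hA hB he rcE rqE.
have k0 : 0 <= 2 * H ^+ 2 * C ^+ 4 + H ^+ 2 * C ^+ 2.
  by rewrite addr_ge0// mulr_ge0 ?exprn_even_ge0// mulr_ge0 ?exprn_even_ge0.
have hq := ler_wpM2l k0 he.
have h2 : A <= 2 * (tau * rc) ^+ 2 + 2 * (H * m_ phi * C ^+ 2 * rq) ^+ 2.
  apply: (le_trans hA).
  have := sqr_ge0 (tau * rc - H * m_ phi * C ^+ 2 * rq).
  move: (tau * rc) (H * m_ phi * C ^+ 2 * rq) => p r; nra.
rewrite !exprMn rcE rqE in h2.
apply: (le_trans (lerD h2 hB)).
have -> : 2 * (tau ^+ 2 * C) + 2 * (H ^+ 2 * m_ phi ^+ 2 * C ^+ 2 ^+ 2 * q) +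
  H * m_ phi * (H * m_ phi * C ^+ 2 * q) = 2 * tau ^+ 2 * C +
  (2 * H ^+ 2 * C ^+ 4 + H ^+ 2 * C ^+ 2) * (m_ phi ^+ 2 * q) by ring.
by rewrite lerD2l.
Qed.

(** The 4 is that of [plancherel]. As tau is arbitrary and the partial sums converge pointwise,
    Fatou leaves a bound without error terms. *)
Lemma interpolation_error :
  (\int[mu]_t (dotc (f t - shifts phi x a t) (f t - shifts phi x a t))%:E <=
   (4 * (2 * H ^+ 2 * C ^+ 4 + H ^+ 2 * C ^+ 2) * defect)%:E)%E.
Proof.
set c1 := 2 * H ^+ 2 * C ^+ 4 + H ^+ 2 * C ^+ 2.
have k0 : 0 <= c1.
  by rewrite addr_ge0// mulr_ge0 ?exprn_even_ge0// mulr_ge0 ?exprn_even_ge0.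
have [A hA] : exists A, forall N, Num.sqrt (sqnorm N a) <= A.
  have [B hB] := (l2P a).1 la; exists (Num.sqrt B) => N; exact: ler_wsqrtr.
have A0 : 0 <= A by apply: (le_trans _ (hA 0)); exact: sqrtr_ge0.
apply/lee_addgt0Pr => e e0; rewrite -EFinD.
(* Collects the factors of tau, as tau^2 <= tau for tau <= 1; the last 1 makes [Q] positive. *)
pose Q := 4 * (2 * C + c1 * (2 * m_ phi * A)) + 1.
have cA : 0 <= c1 * (2 * m_ phi * A).
  by rewrite mulr_ge0// mulr_ge0// mulr_ge0// ltW.
have Q0 : 0 < Q by rewrite /Q ltr_pwDr// mulr_ge0// addr_ge0// mulr_ge0// ltW.
pose tau := Num.min 1 (e / Q).
have t0 : 0 < tau by rewrite lt_min ltr01/= divr_gt0.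
have t1 : tau <= 1 by rewrite ge_min lexx.
have t2 : tau <= e / Q by rewrite ge_min lexx orbT.
have [N0 hN0] := weak_error t0.
pose I N t := zsum_upto (fun j => a j * cfun phi (t - x j)) N.
have cvI t w : dotc (I N t) w @[N --> \oo] --> dotc (shifts phi x a t) w.
  under eq_fun do rewrite dotc_shifts_partial//.
  exact: (@shifts_cvg _ _ phi1 phi2 x C C0 C2 phi3 a t w la).
(* The shift by [N0] makes the estimates valid for every n. *)
pose g n t := f t - I (n + N0)%N t.
have gE n t w : dotc (g n t) w = fourier_cst * \int[mu]_xi dotc (residual (n + N0) xi) (wave w t xi).
  rewrite /g dotcBl -Ff /I dotc_shifts_partial// -mulrBr; congr (_ * _).
  have se : sq wband (wave w t) by exact: sq_wave.
  have sep : sq ph (wave w t) by exact: sq_wave.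
  have sp : sq ph (S (n + N0)) by exact: sq_tsum.
  rewrite -(RintegralB measurableT (ip_integr wb F2 se) (ip_integr wp sp sep)).
  apply: eq_Rintegral => xi _; rewrite /residual dotcBl dotcZl; congr (_ - _).
  rewrite /wband indicE; have [_|/negP nb] := boolP (xi \in band); first by rewrite mul1r.
  by rewrite mul0r F0 ?dotc0l// => h; apply: nb; rewrite inE.
have L1r n : L1 (residual n).
  have [r1 r2] := L1_rfourier_tsum n; have [f1 f2] := F1; split.
    by apply: eq_integr (integrB f1 r1) => t /=; rewrite cReD cReN.
  by apply: eq_integr (integrB f2 r2) => t /=; rewrite cImD cImN.
have key n : integr (fun t => dotc (g n t) (g n t)) /\
    \int[mu]_t dotc (g n t) (g n t) <= 4 * c1 * defect + e.
  have hN : forall N' b, `|ip wband F (tsum x N' b) - ip ph (S (n + N0)) (tsum x N' b)|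
      <= tau * Num.sqrt (sqnorm N' b) by apply: hN0; exact: leq_addl.
  have [iR bR] := residual_L2 (ltW t0) hN.
  have [ig bg] := plancherel (L1r _) iR (gE n).
  split => //; apply: (le_trans bg); rewrite -/c1 in bR.
  have hm : c1 * (2 * m_ phi * (tau * Num.sqrt (sqnorm (n + N0) a))) <= c1 * (2 * m_ phi * (tau * A)).
    apply: ler_wpM2l => //; apply: ler_wpM2l; first by rewrite mulr_ge0// ltW.
    by apply: ler_wpM2l => //; exact: ltW.
  have ht : tau ^+ 2 <= tau by rewrite expr2 ler_piMr// ltW.
  have htC : 2 * tau ^+ 2 * C <= 2 * tau * C by apply: ler_wpM2r; [exact: ltW|rewrite ler_pM2l].
  have hQ : tau * Q <= e by rewrite -ler_pdivlMr.
  rewrite /Q in hQ; rewrite mulrDr in bR; move: hm hQ bR htC.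
  by rewrite -[2 * m_ phi * (tau * A)]mulrCA [c1 * (tau * _)]mulrCA; lra.
apply: (@fatou_real _ (fun n t => dotc (g n t) (g n t))).
- by move=> n; apply: integr_meas; case: (key n).
- by move=> n t; exact: dotcc_ge0.
- move=> t; have cg w : dotc (g n t) w @[n --> \oo] --> dotc (f t - shifts phi x a t) w.
    rewrite /g dotcBl; under eq_fun do rewrite dotcBl.
    apply: cvgB; first exact: cvg_cst.
    by have := cvI t w; rewrite -(cvg_shiftn N0).
  have cR : complex.Re (g n t) @[n --> \oo] --> complex.Re (f t - shifts phi x a t).
    have := cg 1; rewrite /dotc /= mulr1 mulr0 addr0.
    by under eq_fun do rewrite mulr1 mulr0 addr0.
  have cI : complex.Im (g n t) @[n --> \oo] --> complex.Im (f t - shifts phi x a t).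
    have := cg (0 +i* 1); rewrite /dotc /= mulr1 mulr0 add0r.
    by under eq_fun do rewrite mulr1 mulr0 add0r.
  by apply: cvgD; exact: cvgM.
- move=> n; have [ig bg] := key n; rewrite integral_EFin// lee_fin; exact: bg.
Qed.

End error_estimate.

(** * Passage to the limit along the family *)

Section limit.
Context {R : realType}.
Local Notation mu := (@lebesgue_measure R).

(** Dominated convergence is about sequences: if the claim failed, there would be alpha_n > n in
    [Lambda] with defects above [e]. The majorant is |F|^2 on the band, as m <= phihat there. *)
Lemma defect_cvg0 (Lambda : set R) (phi : R -> R -> R) (F : R -> R[i]) :
  (forall alpha, Lambda alpha -> A1 (phi alpha) /\ A2 (phi alpha)) -> sq wband F ->
  {ae mu, forall xi, `|xi| <= pi ->
    m_ (phi alpha) / rfourier (phi alpha) xi @[alpha --> within Lambda +oo] --> 0} ->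
  forall e, 0 < e -> exists B, forall alpha, Lambda alpha -> B < alpha ->
    defect (phi alpha) F <= e.
Proof.
move=> hphi sF hae e e0; apply: contrapT => /forallNP h.
have /choice[al hal] : forall n : nat, exists al, [/\ Lambda al, n%:R < al &
    e < defect (phi al) F].
  move=> n; have /existsNP[al] := h n%:R; rewrite not_implyE => -[la].
  by rewrite not_implyE => -[na /negP]; rewrite -ltNge => eD; exists al.
have h1 n : A1 (phi (al n)) by case: (hphi (al n)) => //; case: (hal n).
have h2 n : A2 (phi (al n)) by case: (hphi (al n)) => //; case: (hal n).
have [mF iF] := sF.
have alF : al n @[n --> \oo] --> within Lambda +oo.
  move=> P [M [Mr HP]]; exists (Num.truncn `|M|).+1 => // n /= Mn.
  have [la na _] := hal n; apply: HP => //; apply: (le_lt_trans (ler_norm M)).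
  apply: lt_trans na; apply: (lt_le_trans (truncnS_gt _)).
  by rewrite ler_nat.
pose u n xi := wband xi * dotc (F xi) (F xi) * (m_ (phi (al n)) / rfourier (phi (al n)) xi).
have iu n : integr (u n) by exact (integr_defect (h1 n) (h2 n) sF).
have cu : {ae mu, forall xi, u n xi @[n --> \oo] --> (0 : R)}.
  move: hae; apply: filterS; first exact: (ae_filter_ringOfSetsType mu).
  move=> xi hxi; rewrite /u /wband indicE.
  have [/set_mem xb|_] := boolP (xi \in band); last first.
    by under eq_fun do rewrite !mul0r; exact: cvg_cst.
  rewrite -(mulr0 (1 * dotc (F xi) (F xi))); apply: cvgM; first exact: cvg_cst.
  have hx : `|xi| <= pi by move: xb; rewrite /band /= in_itv/= -ler_norml.
  exact: (@cvg_comp _ _ _ al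
    (fun alpha => m_ (phi alpha) / rfourier (phi alpha) xi) _ _ _ alF (hxi hx)).
have bu n xi : `|u n xi| <= wband xi * dotc (F xi) (F xi).
  have d0 := dotcc_ge0 (F xi); have w0 := (@weight_band R).2 xi.
  rewrite ger0_norm; last by rewrite mulr_ge0 ?(ratio_ge0 (h2 n))// mulr_ge0.
  by rewrite /u mulrAC; apply: ler_wpM2r => //; exact: ratio_le1 (h2 n) xi.
have [_ cD] := DCT_real (fun n => integr_meas (iu n)) (measurable_cst (0 : R)) cu bu iF.
have : e <= \int[mu]_xi (0 : R).
  apply: (ler_cvg_to (cvg_cst e) cD); apply: nearW => n; apply: ltW.
  by case: (hal n).
by rewrite Rintegral_cst// mul0r leNgt e0.
Qed.
End limit.

Theorem theorem1 (R : realType) (x : int -> R)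
  (Lambda : set R) (phi : R -> R -> R) (f : R -> R[i])
  (Lambda_pos : forall alpha, Lambda alpha -> 0 < alpha)
  (Lambda_unbounded : forall B : R, exists2 alpha, Lambda alpha & B < alpha)
  (x_CIS : complete_interpolating x)
  (phi_regular : regular_family Lambda phi)
  (f_PW : PW f) :
  L2norm [set: R] (fun t => f t - interpolant (phi alpha) x f t)
    @[alpha --> within Lambda +oo] --> 0%E.
Proof.
have [hA [H hH] hae] := phi_regular.
have [F [F1 F2 F0 Ff]] := PW_band f_PW.
have [C C0 hC] := riesz_bounds x_CIS.
have C1 N a := (hC N a).1; have C2 N a := (hC N a).2.
pose K := 4 * (2 * H ^+ 2 * C ^+ 4 + H ^+ 2 * C ^+ 2).
have K0 : 0 <= K.
  rewrite mulr_ge0// addr_ge0// mulr_ge0 ?exprn_even_ge0//.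
  by rewrite mulr_ge0 ?exprn_even_ge0.
have key alpha : Lambda alpha ->
    exists2 r, L2norm [set: R] (fun t => f t - interpolant (phi alpha) x f t) = r%:E &
      0 <= r <= Num.sqrt (K * defect (phi alpha) F).
  move=> la; have [a1 a2 a3] := hA _ la.
  have [a0 ha0] := interpolant_exists a1 a2 C0 C1 C2 a3 F2 Ff.
  (* Existence makes [xget] return an interpolating sequence instead of its default value. *)
  have ha : interpolates (phi alpha) x f
      (xget (cst 0) [set a | interpolates (phi alpha) x f a]).
    exact: (xgetPex (cst 0) (P := [set a | interpolates (phi alpha) x f a])
      (ex_intro _ a0 ha0)).
  have hM := sum_upto_M_off a1 a2 (hH _ la).
  have := interpolation_error a1 a2 a3 C0 x_CIS C1 C2 hM F1 F2 F0 Ff ha.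
  rewrite -/K L2norm_integral -/(interpolant (phi alpha) x f).
  under [X in _ -> exists2 _, (X `^ _)%E = _ & _]eq_integral do rewrite indicT mul1r.
  set I := (\int[_]_t _)%E => hI.
  have I0 : (0 <= I)%E by apply: integral_ge0 => t _; rewrite lee_fin dotcc_ge0.
  have If : I \is a fin_num by rewrite ge0_fin_numE// (le_lt_trans hI)// ltry.
  exists (Num.sqrt (fine I)); first by rewrite poweR12_sqrt// -[in LHS](fineK If).
  by rewrite sqrtr_ge0 ler_wsqrtr// -lee_fin fineK.
have hA' alpha : Lambda alpha -> A1 (phi alpha) /\ A2 (phi alpha).
  by move=> /hA[].
apply/fine_cvgP; split.
  exists 0; split => // alpha _ la.
  by have [r -> _] := key _ la.
apply/cvgrPdist_le => e e0.
(* The norm is at most the square root of K times the defect, hence the square; the 1 covers K =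
   0. *)
have e20 : 0 < e ^+ 2 / (K + 1) by rewrite divr_gt0 ?exprn_gt0// ltr_pwDr.
have [B hB] := defect_cvg0 hA' F2 hae e20.
exists B; split; first exact: num_real.
move=> alpha Ba la /=; have [r -> /andP[r0 rD]] := key _ la.
rewrite /= sub0r normrN ger0_norm//; apply: (le_trans rD).
rewrite -[leRHS]gtr0_norm// -sqrtr_sqr; apply: ler_wsqrtr.
apply: (le_trans (ler_wpM2l K0 (hB _ la Ba))).
rewrite mulrCA ler_piMr ?sqr_ge0// ler_pdivrMr ?ltr_pwDr// mul1r lerDl.
exact: ler01.
Qed.
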